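(* Let $J\subset\mathbb R$ be a compact interval with nonempty interior and $\varepsilon>0$. Write $\le_{\mathrm{geom}}$ for the CH23 $(J,\varepsilon)$-geometric finite-query preorder. Let $$\mathcal U^{\sigma,\mathrm{sgl}}_J=\{\mathcal P^\sigma_{J,\mathrm{diag}},\mathcal P^\sigma_{J,\mathrm{gen}},\mathcal P^\sigma_{J,\mathrm{graph}}\},\qquad \mathcal U^{\sigma_\varepsilon,\mathrm{sgl}}_{J,\varepsilon}=\{\mathcal P^{\sigma_\varepsilon}_{J,\varepsilon,\mathrm{diag}},\mathcal P^{\sigma_\varepsilon}_{J,\varepsilon,\mathrm{gen}},\mathcal P^{\sigma_\varepsilon}_{J,\varepsilon,\mathrm{graph}}\},$$ and $\mathcal U^\sharp_{2,J,\varepsilon}=\mathcal U^{\sigma,\mathrm{sgl}}_J\cup\mathcal U^{\sigma_\varepsilon,\mathrm{sgl}}_{J,\varepsilon}$. Then $\mathcal U^\sharp_{2,J,\varepsilon}$, with these two blocks and sources $\mathcal P^\sigma_{J,\mathrm{diag}}$, $\mathcal P^{\sigma_\varepsilon}_{J,\varepsilon,\mathrm{diag}}$ respectively, is a source-separated finite theorem block at height $2$ for $\le_{\mathrm{geom}}$; that is: (B1) every member of $\mathcal U^\sharp_{2,J,\varepsilon}$ has $\operatorname{SCI}_{\mathrm G}=2$; (B2) each source is $\le_{\mathrm{geom}}$ every member of its own block; (B3) neither source is $\le_{\mathrm{geom}}$ any member of the other block. Consequently $$\operatorname{MinDeg}^{\mathrm{geom}}_2(\mathcal U^\sharp_{2,J,\varepsilon})=\{[\mathcal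 P^\sigma_{J,\mathrm{diag}}]_{\mathrm{geom}},[\mathcal P^{\sigma_\varepsilon}_{J,\varepsilon,\mathrm{diag}}]_{\mathrm{geom}}\}.$$
   Context: $\mathbb N=\{1,2,\dots\}$, $\mathbb N_0=\{0,1,2,\dots\}$. SCI height. For an SCI problem $\mathcal P=(\Xi,\Omega,(\mathcal M,d),\Lambda)$ (instance set $\Omega$, metric space $\mathcal M$, target $\Xi:\Omega\to\mathcal M$, $\Lambda$ a set of complex-valued functions on $\Omega$ separating instances with distinct target values), a general algorithm is a pair $(\Gamma,\Lambda_\Gamma)$, $\Gamma:\Omega\to\mathcal M$, $\Lambda_\Gamma(A)\subseteq\Lambda$ finite, such that if $f(B)=f(A)$ for all $f\in\Lambda_\Gamma(A)$ then $\Gamma(B)=\Gamma(A)$ and $\Lambda_\Gamma(B)=\Lambda_\Gamma(A)$. A height-$0$ tower is a general algorithm with $\Gamma=\Xi$; a height-$k$ tower ($k\ge1$) is a family of general algorithms with $\Xi(A)=\lim_{n_k\to\infty}\cdots\lim_{n_1\to\infty}\Gamma_{n_k,\dots,n_1}(A)$ for all $A$. $\operatorname{SCI}_{\mathrm G}(\mathcal P)$ is the least height of a tower ($\infty$ if none). Windows. $\mathcal K_{\mathrm{sgl}}(J)=\{\{z\}:z\in J\}$; for each $K=\{z\}$ fix $r_n(K)\in\mathbb Q+i\mathbb Q$ with $|r_n(K)-z|\le2^{-(n+1)}$, $n\in\mathbb N$. Operator instance classes, with Hilbert spaces $H_{\mathrm{diag}}=H_{\mathrm{gen}}=\ell^2(\mathbb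 N)$, $H_{\mathrm{graph}}=\ell^2(V)$, where $V=\{v_1,v_2,\dots\}$ is the vertex set of a fixed connected countable graph. (diag) $\Omega_{\mathrm{diag}}$: maximal diagonal operators, $Ae_j=a_je_j$ with $(a_j)\subset\mathbb C$ arbitrary, $\mathcal D(A)=\{x:(a_jx_j)_j\in\ell^2(\mathbb N)\}$. (gen) $\Omega_{\mathrm{gen}}$: closed densely defined operators $A$ on $\ell^2(\mathbb N)$ for which $\operatorname{span}\{e_n\}$ is a core of $A$ and $A^*$, together with $f:\mathbb N\to\mathbb N$ and a null sequence $(c_n)$ of nonnegative rationals with $\max\{\|(I-P_{f(n)})AP_n\|,\|(I-P_{f(n)})A^*P_n\|\}\le c_n$, $P_n$ the orthogonal projection onto $\operatorname{span}\{e_1,\dots,e_n\}$. (graph) $\Omega_{\mathrm{graph}}$: closed densely defined operators $A$ on $\ell^2(V)$ for which $\operatorname{span}\{\mathbf 1_v\}$ is a core of $A$ and $A^*$, with $\alpha_A(v,w)=\langle A\mathbf 1_w,\mathbf 1_v\rangle$, together with finite sets $S_v\subset V$ such that $\alpha_A(v,w)=\alpha_A(w,v)=0$ for $w\notin S_v$. $\operatorname{op}_\rho:\Omega_\rho\to\mathcal C(H_\rho)$ sends an instance to its underlying closed densely defined operator ($\mathcal C(H)$ = closed densely defined operators on $H$). $\mathcal X_\rho(J)=\Omega_\rho\times\mathcal K_{\mathrm{sgl}}(J)$. Interfaces on $\mathcal X_\rho(J)$, all containing $\rho_n=r_n(K)$: diag has also $\mu_j=a_j$; gen has also $m_{ij}=\langle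 Ae_j,e_i\rangle$ and the values $f(n),c_n$; graph has also $\alpha_{ij}=\alpha_A(v_i,v_j)$ and the finite sets $S_{v_i}$ (injectively coded as natural numbers). Pseudospectrum: $\sigma_\varepsilon(A)=\overline{\{z:\|(A-zI)^{-1}\|>\varepsilon^{-1}\}}$ (norm $=\infty$ on $\sigma(A)$). Problems: for $\star\in\{\mathrm{diag},\mathrm{gen},\mathrm{graph}\}$, $\mathcal P^\sigma_{J,\star}$ has instance set $\mathcal X_\star(J)$, the corresponding interface, output $\{0,1\}$ (discrete) and target $1$ if $\sigma(A)\cap K=\varnothing$, $0$ otherwise; $\mathcal P^{\sigma_\varepsilon}_{J,\varepsilon,\star}$ is the same with $\sigma_\varepsilon$ in place of $\sigma$ (spectra are those of the underlying operators). Geometric encodings. An elementary encoding of type $\rho\to\rho'$ is a map $e:\mathcal X_\rho(J)\to\mathcal X_{\rho'}(J)$, $e(A,K)=(R(A),K)$, where $R:\Omega_\rho\to\Omega_{\rho'}$ is a fixed map of one of the following forms (all data fixed, independent of the input): (E1) unitary conjugacy: $\operatorname{op}_{\rho'}(R(A))=U\operatorname{op}_\rho(A)U^{-1}$ for a fixed unitary $U:H_\rho\to H_{\rho'}$; (E2) basis relabeling ($\rho,\rho'\in\{\mathrm{diag},\mathrm{gen}\}$): the same with $U=U_\pi$, $U_\pi e_j=e_{\pi(j)}$, $\pi$ a bijection of $\mathbb N$; (E3) graph relabeling ($\rho=\rho'=\mathrm{graph}$): the same with $U\mathbf 1_v=\mathbf 1_{\alpha(v)}$, $\alpha$ a graph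 automorphism; (E4) representation inclusion: $\operatorname{op}_{\rho'}(R(A))=W\operatorname{op}_\rho(A)W^{-1}$ with $W:H_\rho\to H_{\rho'}$ a fixed unitary; the two inclusions used are $\mathrm{diag}\to\mathrm{gen}$ with $W=\mathrm{id}$ (a diagonal operator viewed as a general one, with canonical dispersion data $f(n)=n$, $c_n=2^{-n}$) and $\mathrm{diag}\to\mathrm{graph}$ with $We_j=\mathbf 1_{v_j}$ (so $\alpha(v_i,v_j)=a_j$ if $i=j$ and $0$ otherwise, with $S_{v_j}=\{v_j\}$); (E5) neutral stabilization: $\operatorname{op}_{\rho'}(R(A))=W(\operatorname{op}_\rho(A)\oplus T_0)W^{-1}$ with a fixed $T_0\in\mathcal C(H_0)$ on a Hilbert space $H_0$, a fixed unitary $W:H_\rho\oplus H_0\to H_{\rho'}$, and $\sigma(T_0)\cap J=\varnothing=\sigma_\varepsilon(T_0)\cap J$. The collection of elementary encodings (the maps $R$) is part of a fixed CH23 geometric structure; it contains the two inclusions displayed in (E4) and is otherwise any collection of maps of the forms (E1)–(E5). A CH23 $(J,\varepsilon)$-neutral geometric encoding is a finite composition (possibly empty, i.e. an identity) of elementary encodings with compatible types. Geometric preorder. For problems $\mathcal S,\mathcal P\in\mathcal U^\sharp_{2,J,\varepsilon}$ with targets $\Psi,\Xi$, representation labels $\rho,\rho'$ and interfaces $\Lambda_{\mathcal S},\Lambda_{\mathcal P}$, $\mathcal S\le_{\mathrm{geom}}\mathcal P$ means: there are a CH23 $(J,\varepsilon)$-neutral geometric encoding $E:\mathcal X_\rho(J)\to\mathcal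 X_{\rho'}(J)$, a continuous $D:\{0,1\}\to\{0,1\}$ with $D(\Xi(E(x)))=\Psi(x)$ for all $x$, and for every $\lambda\in\Lambda_{\mathcal P}$ finitely many (possibly zero) $\gamma_1,\dots,\gamma_m\in\Lambda_{\mathcal S}$ and an arbitrary map $\vartheta_\lambda$ on their joint image with $\lambda(E(x))=\vartheta_\lambda(\gamma_1(x),\dots,\gamma_m(x))$ for all $x$. Degrees. On $\mathcal O_2(\mathcal U)=\{\mathcal P\in\mathcal U:\operatorname{SCI}_{\mathrm G}(\mathcal P)=2\}$, $[\mathcal P]_{\mathrm{geom}}$ is the class modulo mutual $\le_{\mathrm{geom}}$-reducibility, classes are partially ordered by $\le_{\mathrm{geom}}$, and $\operatorname{MinDeg}^{\mathrm{geom}}_2(\mathcal U)$ is the set of minimal classes. *)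

(* Defs.v *)
From HB Require Import structures.
From mathcomp Require Import all_boot all_order all_algebra finmap.
From mathcomp Require Import complex ring lra.
From mathcomp Require Import all_classical all_reals all_analysis.

Set Implicit Arguments.
Unset Strict Implicit.
Unset Printing Implicit Defensive.

Import Order.TTheory GRing.Theory Num.Theory numFieldNormedType.Exports.
Import ComplexField.Normc.

Local Open Scope classical_set_scope.
Local Open Scope ring_scope.
Local Open Scope complex_scope.

Section modulus.
Context {R : realType}.
Implicit Types z w : R[i].

Lemma normcE z : normc z = Num.sqrt (complex.Re z ^+ 2 + complex.Im z ^+ 2).
Proof. by case: z. Qed.

Lemma normc_ge0 z : 0 <= normc z.
Proof. by rewrite normcE sqrtr_ge0. Qed.

Lemma sqr_normc z : normc z ^+ 2 = complex.Re z ^+ 2 + complex.Im z ^+ 2.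
Proof. by rewrite normcE sqr_sqrtr// addr_ge0 ?sqr_ge0. Qed.

Lemma normcN z : normc (- z) = normc z.
Proof. by case: z => a b; rewrite !normcE /= !sqrrN. Qed.

Lemma normc_conj z : normc (z^*)%C = normc z.
Proof. by case: z => a b; rewrite !normcE /= sqrrN. Qed.

Lemma Re_le_normc z : `|complex.Re z| <= normc z.
Proof. by rewrite -sqrtr_sqr normcE ler_wsqrtr// lerDl sqr_ge0. Qed.

Lemma Im_le_normc z : `|complex.Im z| <= normc z.
Proof. by rewrite -sqrtr_sqr normcE ler_wsqrtr// lerDr sqr_ge0. Qed.

Lemma sqr_normcD z w :
  normc (z + w) ^+ 2 <= 2 * normc z ^+ 2 + 2 * normc w ^+ 2.
Proof.
case: z w => [a b] [c d]; rewrite !sqr_normc /=.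
have := sqr_ge0 (a - c); have := sqr_ge0 (b - d); lra.
Qed.

Lemma normcM_le z w : normc (z * w) <= normc z ^+ 2 + normc w ^+ 2.
Proof.
rewrite normcM.
have := sqr_ge0 (normc z - normc w); have := sqr_ge0 (normc z);
  have := sqr_ge0 (normc w); lra.
Qed.

Lemma ler_normcD z w : normc (z + w) <= normc z + normc w.
Proof. by have := ler_normD z w; rewrite -[leRHS]rmorphD lecR. Qed.

End modulus.

Section unordered_sums.
Context {R : realType} {I : choiceType}.
Implicit Types (u v a b : I -> R) (w z : I -> R[i]).

Definition rsummable u := summable [set: I] (EFin \o u).

(* Unordered sum of an absolutely summable real family (positive part minus
   negative part); the value is meaningless when [rsummable u] fails. *)
Definition rsum u : R :=
  fine (esum [set: I] ((EFin \o u)^\+)%E)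
  - fine (esum [set: I] ((EFin \o u)^\-)%E).

Definition csummable w := rsummable (fun i => normc (w i)).

Definition csum w : R[i] :=
  rsum (fun i => complex.Re (w i)) +i* rsum (fun i => complex.Im (w i)).

Lemma rsummable_le u v : (forall i, `|u i| <= `|v i|) ->
  rsummable v -> rsummable u.
Proof.
move=> uv; apply: le_lt_trans; apply: le_esum => i _ /=.
by rewrite lee_fin.
Qed.

Lemma rsummableD u v : rsummable u -> rsummable v ->
  rsummable (fun i => u i + v i).
Proof. by move=> su sv; exact: (summableD su sv). Qed.

Lemma rsummableN u : rsummable u -> rsummable (fun i => - u i).
Proof. by apply: rsummable_le => i; rewrite normrN. Qed.

Lemma ge0_rsummableE u : (forall i, 0 <= u i) ->
  rsummable u = (\esum_(i in [set: I]) (u i)%:E < +oo)%E.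
Proof.
move=> u0; rewrite /rsummable /summable; congr (_ < _)%E.
by apply: eq_esum => i _ /=; rewrite ger0_norm.
Qed.

Lemma esumZ u (c : R) : 0 <= c -> (forall i, 0 <= u i) ->
  (\esum_(i in [set: I]) (c * u i)%:E = c%:E * \esum_(i in [set: I]) (u i)%:E)%E.
Proof.
move=> c0 u0; rewrite /esum -ereal_supZl//; last first.
  apply/set0P; exists 0%E; exists set0; first exact: fsets_set0.
  by rewrite fsbig_set0.
congr ereal_sup; apply/seteqP; split => [_ [A fA <-]|_ [_ [A fA <-] <-]] /=.
  exists (\sum_(i \in A) (u i)%:E)%E; first by exists A.
  by rewrite ge0_mule_fsumr// => i; rewrite lee_fin.
exists A => //.
by rewrite ge0_mule_fsumr// => i; rewrite lee_fin.
Qed.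

Lemma rsummableZ u c : rsummable u -> rsummable (fun i => c * u i).
Proof.
move=> su; apply: (@rsummable_le _ (fun i => `|c| * `|u i|)) => [i|].
  by rewrite !normrM !normr_id.
rewrite ge0_rsummableE; last by move=> i; rewrite mulr_ge0.
rewrite esumZ// lte_mul_pinfty// ?lee_fin// -ge0_rsummableE//;
  by apply: rsummable_le su => i; rewrite normr_id.
Qed.

Lemma ge0_esum_fin_num a : (forall i, 0 <= a i) -> rsummable a ->
  (\esum_(i in [set: I]) (a i)%:E)%E \is a fin_num.
Proof.
move=> a0; rewrite ge0_rsummableE// => sa; rewrite ge0_fin_numE//.
by apply: esum_ge0 => i _; rewrite lee_fin.
Qed.

Lemma rsum_diff a b : (forall i, 0 <= a i) -> (forall i, 0 <= b i) ->
  rsummable a -> rsummable b ->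
  rsum (fun i => a i - b i) =
  fine (\esum_(i in [set: I]) (a i)%:E) - fine (\esum_(i in [set: I]) (b i)%:E).
Proof.
move=> a0 b0 sa sb; have sab := rsummableD sa (rsummableN sb).
have := @esumB R I setT (EFin \o a) (EFin \o b) sa sb.
have a0' i : setT i -> (0 <= (EFin \o a) i)%E by rewrite lee_fin.
have b0' i : setT i -> (0 <= (EFin \o b) i)%E by rewrite lee_fin.
move=> /(_ a0' b0') /(congr1 fine).
rewrite !fineB// ?ge0_esum_fin_num//.
  have := summable_funepos sab; rewrite summableE.
  by under eq_esum do rewrite gee0_abs//.
have := summable_funeneg sab; rewrite summableE.
by under eq_esum do rewrite gee0_abs//.
Qed.

Lemma ge0_rsum a : (forall i, 0 <= a i) -> rsummable a ->
  rsum a = fine (\esum_(i in [set: I]) (a i)%:E).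
Proof.
move=> a0 sa; have -> : a = (fun i => a i - 0).
  by apply/funext => i; rewrite subr0.
rewrite rsum_diff//; last first.
  rewrite ge0_rsummableE// esum1//.
rewrite (esum1 (a := fun=> 0%E))// subr0.
by congr fine; apply: eq_esum => i _; rewrite subr0.
Qed.

Definition rpos u i := locked (Num.max (u i) 0).
Definition rneg u i := locked (Num.max (- u i) 0).

Lemma rpos_ge0 u i : 0 <= rpos u i.
Proof. by rewrite /rpos -lock le_max lexx orbT. Qed.

Lemma rneg_ge0 u i : 0 <= rneg u i.
Proof. by rewrite /rneg -lock le_max lexx orbT. Qed.

Lemma rposneg u i : u i = rpos u i - rneg u i.
Proof.
rewrite /rpos /rneg -!lock.
by case: (leP (u i) 0) => h; case: (leP (- u i) 0) => h'; lra.
Qed.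

Lemma rsummable_rpos u : rsummable u -> rsummable (rpos u).
Proof.
apply: rsummable_le => i; rewrite ger0_norm ?rpos_ge0// /rpos -lock ge_max.
by rewrite ler_norm normr_ge0.
Qed.

Lemma rsummable_rneg u : rsummable u -> rsummable (rneg u).
Proof.
apply: rsummable_le => i; rewrite ger0_norm ?rneg_ge0// /rneg -lock ge_max.
by rewrite ler_normr lexx orbT normr_ge0.
Qed.

Lemma rsumE u : rsummable u -> rsum u =
  fine (\esum_(i in [set: I]) (rpos u i)%:E)
  - fine (\esum_(i in [set: I]) (rneg u i)%:E).
Proof.
move=> su.
rewrite -(rsum_diff (rpos_ge0 u) (rneg_ge0 u) (rsummable_rpos su)
  (rsummable_rneg su)).
by congr rsum; apply/funext => i; exact: rposneg.
Qed.

Lemma ge0_fine_esumD a b : (forall i, 0 <= a i) -> (forall i, 0 <= b i) ->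
  rsummable a -> rsummable b ->
  fine (\esum_(i in [set: I]) (a i + b i)%:E) =
  fine (\esum_(i in [set: I]) (a i)%:E) + fine (\esum_(i in [set: I]) (b i)%:E).
Proof.
move=> a0 b0 sa sb; rewrite -fineD ?ge0_esum_fin_num// -esumD//.
- by move=> i _; rewrite lee_fin.
- by move=> i _; rewrite lee_fin.
Qed.

Lemma rsumD u v : rsummable u -> rsummable v ->
  rsum (fun i => u i + v i) = rsum u + rsum v.
Proof.
move=> su sv.
have -> : (fun i => u i + v i) =
    (fun i => (rpos u i + rpos v i) - (rneg u i + rneg v i)).
  by apply/funext => i; rewrite [u i]rposneg [v i]rposneg; lra.
have spu := rsummable_rpos su; have spv := rsummable_rpos sv.
have snu := rsummable_rneg su; have snv := rsummable_rneg sv.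
rewrite (rsumE su) (rsumE sv) (@rsum_diff (fun i => rpos u i + rpos v i)
  (fun i => rneg u i + rneg v i)); last first.
- exact: rsummableD.
- exact: rsummableD.
- by move=> i; rewrite addr_ge0 ?rneg_ge0.
- by move=> i; rewrite addr_ge0 ?rpos_ge0.
rewrite (ge0_fine_esumD (rpos_ge0 u) (rpos_ge0 v))//.
rewrite (ge0_fine_esumD (rneg_ge0 u) (rneg_ge0 v))//.
lra.
Qed.

Lemma rsumN u : rsum (fun i => - u i) = - rsum u.
Proof.
rewrite /rsum opprB; congr (fine _ - fine _).
  by apply: eq_esum => i _; rewrite funeposE funenegE.
by apply: eq_esum => i _; rewrite funeposE funenegE /= opprK.
Qed.

Lemma rsumZ u c : rsummable u -> rsum (fun i => c * u i) = c * rsum u.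
Proof.
wlog c0 : c / 0 <= c => [h su|su].
  have [/h->//|c0] := leP 0 c.
  have -> : (fun i => c * u i) = (fun i => - (- c * u i)).
    by apply/funext => i; rewrite mulNr opprK.
  by rewrite rsumN h// ?oppr_ge0 ?ltW//; lra.
rewrite (rsumE su).
have -> : (fun i => c * u i) = (fun i => c * rpos u i - c * rneg u i).
  by apply/funext => i; rewrite -mulrBr -rposneg.
have spu := rsummable_rpos su; have snu := rsummable_rneg su.
rewrite (@rsum_diff (fun i => c * rpos u i) (fun i => c * rneg u i)); last first.
- exact: rsummableZ.
- exact: rsummableZ.
- by move=> i; rewrite mulr_ge0 ?rneg_ge0.
- by move=> i; rewrite mulr_ge0 ?rpos_ge0.
rewrite (esumZ c0 (rpos_ge0 u)) (esumZ c0 (rneg_ge0 u)).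
rewrite !fineM ?ge0_esum_fin_num// ?mulrBr//.
- exact: rneg_ge0.
- exact: rpos_ge0.
Qed.

Lemma csummable_Re w : csummable w -> rsummable (fun i => complex.Re (w i)).
Proof.
by apply: rsummable_le => i; rewrite [leRHS]ger0_norm ?normc_ge0 ?Re_le_normc.
Qed.

Lemma csummable_Im w : csummable w -> rsummable (fun i => complex.Im (w i)).
Proof.
by apply: rsummable_le => i; rewrite [leRHS]ger0_norm ?normc_ge0 ?Im_le_normc.
Qed.

Lemma csummableZ w c : csummable w -> csummable (fun i => c * w i).
Proof.
move=> sw; rewrite /csummable.
have -> : (fun i => normc (c * w i)) = (fun i => normc c * normc (w i)).
  by apply/funext => i; rewrite normcM.
exact: rsummableZ.
Qed.

Lemma csumD w z : csummable w -> csummable z ->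
  csum (fun i => w i + z i) = csum w + csum z.
Proof.
move=> sw sz; rewrite /csum.
have -> : (fun i => complex.Re (w i + z i)) =
    (fun i => complex.Re (w i) + complex.Re (z i)).
  by apply/funext => i; case: (w i) (z i) => [? ?] [].
have -> : (fun i => complex.Im (w i + z i)) =
    (fun i => complex.Im (w i) + complex.Im (z i)).
  by apply/funext => i; case: (w i) (z i) => [? ?] [].
by rewrite !rsumD ?csummable_Re ?csummable_Im.
Qed.

Lemma csumZ w (c : R[i]) : csummable w ->
  csum (fun i => c * w i) = c * csum w.
Proof.
move=> sw; case: c => c d; rewrite /csum.
have -> : (fun i => complex.Re ((c +i* d) * w i)) =
    (fun i => c * complex.Re (w i) + - (d * complex.Im (w i))).
  by apply/funext => i; case: (w i).
have -> : (fun i => complex.Im ((c +i* d) * w i)) =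
    (fun i => c * complex.Im (w i) + d * complex.Re (w i)).
  by apply/funext => i; case: (w i).
rewrite !rsumD ?rsumN ?rsumZ ?rsummableN ?rsummableZ;
  rewrite ?csummable_Re ?csummable_Im//.
Qed.

Lemma csum_conj w : csum (fun i => (w i)^*) = (csum w)^*.
Proof.
rewrite /csum /=; congr (_ +i* _).
  by congr rsum; apply/funext => i; case: (w i).
by rewrite -rsumN; congr rsum; apply/funext => i; case: (w i).
Qed.

Lemma rsum1 (i0 : I) u : (forall i, i != i0 -> u i = 0) -> rsum u = u i0.
Proof.
move=> u0.
have h v : (forall i, i != i0 -> v i = 0) -> (forall i, 0 <= v i) ->
    \esum_(i in [set: I]) (v i)%:E = (v i0)%:E.
  move=> v0 vge0; rewrite (esumID [set i0]) //; last first.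
    by move=> i _; rewrite lee_fin.
  rewrite setTI setTI esum_set1 ?lee_fin// esum1 ?adde0//.
  by move=> i /eqP/v0 ->.
rewrite /rsum.
have -> : esum [set: I] ((EFin \o u)^\+)%E = (rpos u i0)%:E.
  rewrite -(h (rpos u)); last exact: rpos_ge0; last first.
    by move=> i /u0 ui; rewrite /rpos -lock ui maxxx.
  by apply: eq_esum => i _; rewrite funeposE /rpos -lock /= EFin_max.
have -> : esum [set: I] ((EFin \o u)^\-)%E = (rneg u i0)%:E.
  rewrite -(h (rneg u)); last exact: rneg_ge0; last first.
    by move=> i /u0 ui; rewrite /rneg -lock ui oppr0 maxxx.
  by apply: eq_esum => i _; rewrite funenegE /rneg -lock /= EFin_max.
by rewrite /= -rposneg.
Qed.

Lemma csum1 (i0 : I) w : (forall i, i != i0 -> w i = 0) -> csum w = w i0.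
Proof.
move=> w0; rewrite /csum !(@rsum1 i0) => [|i /w0->//|i /w0->//].
by case: (w i0).
Qed.

End unordered_sums.

Section hilbert_spaces.
Context {R : realType}.

Definition dotnorm (H : lmodType R[i]) (dot : {dot H for Num.conj}) (x : H) : R :=
  Num.sqrt (complex.Re (dot x x)).

(* The inner product is linear in its first argument and conjugate-linear in the
   second; completeness is stated for the norm it induces. *)
Record hilbert := Hilbert {
  hcarrier :> lmodType R[i];
  hdot : {dot hcarrier for Num.conj};
  hcomplete : forall u : nat -> hcarrier,
    (forall e : R, 0 < e -> exists N, forall m n, (N <= m)%N -> (N <= n)%N ->
      dotnorm hdot (u m - u n) < e) ->
    exists l, dotnorm hdot (u n - l) @[n --> \oo] --> (0 : R) }.

End hilbert_spaces.
Arguments hilbert R : clear implicits.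

Section ell2.
Context {R : realType} {I : choiceType}.

Definition ell2_pred : {pred I -> R[i]^o} :=
  [pred x | rsummable (fun i => normc (x i) ^+ 2)].

(* ell^2(I), for an arbitrary index type I: complex families whose squared
   moduli have a finite unordered sum. *)
Record ell2 := Ell2 { ell2_val :> I -> R[i]^o ; _ : ell2_val \in ell2_pred }.

HB.instance Definition _ := [isSub for ell2_val].

HB.instance Definition _ := [Choice of ell2 by <:].

Fact ell2_submod_closed : submod_closed ell2_pred.
Proof.
split=> [|c x y]; rewrite !inE.
  rewrite ge0_rsummableE; last by move=> i; rewrite sqr_ge0.
  by rewrite esum1// => i _; rewrite [0 i]/(0 : R[i]) normc0 expr0n.
move=> sx sy; pose d := 2 * normc c ^+ 2.
apply: (@rsummable_le _ _ _
  (fun i => d * normc (x i) ^+ 2 + 2 * normc (y i) ^+ 2)) => [i|]; last first.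
  by apply: rsummableD; exact: rsummableZ.
rewrite !ger0_norm ?addr_ge0 ?mulr_ge0 ?normc_ge0//.
by rewrite (le_trans (sqr_normcD _ _))// normcM exprMn mulrA.
Qed.

HB.instance Definition _ :=
  GRing.isSubmodClosed.Build _ _ ell2_pred ell2_submod_closed.
HB.instance Definition _ := [SubChoice_isSubLmodule of ell2 by <:].

Definition ell2_dot (x y : ell2) : R[i] := csum (fun i => x i * (y i)^*).

Lemma ell2P (x : ell2) : rsummable (fun i => normc (x i) ^+ 2).
Proof. by case: x => x /= px; have := px; rewrite !inE. Qed.

Lemma ell2_inj (x y : ell2) : (forall i, x i = y i) -> x = y.
Proof. by move=> xy; apply: val_inj; apply/funext => i; exact: xy. Qed.

Lemma ell2_0E i : (0 : ell2) i = 0. Proof. by []. Qed.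
Lemma ell2_DE (x y : ell2) i : (x + y) i = x i + y i. Proof. by []. Qed.
Lemma ell2_NE (x : ell2) i : (- x) i = - x i. Proof. by []. Qed.
Lemma ell2_BE (x y : ell2) i : (x - y) i = x i - y i. Proof. by []. Qed.
Lemma ell2_ZE c (x : ell2) i : (c *: x) i = c * x i. Proof. by []. Qed.

Lemma ell2_csummable (x y : ell2) : csummable (fun i => x i * (y i)^*).
Proof.
apply: (@rsummable_le _ _ _ (fun i => normc (x i) ^+ 2 + normc (y i) ^+ 2)).
  move=> i; rewrite !ger0_norm ?addr_ge0 ?sqr_ge0 ?normc_ge0//.
  by rewrite (le_trans (normcM_le _ _))// normc_conj.
by apply: rsummableD; exact: ell2P.
Qed.

Fact ell2_dot_bilinear : bilinear_for
  (GRing.Scale.Law.clone _ _ *%R _) (GRing.Scale.Law.clone _ _ (Num.conj \; *%R) _)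
  ell2_dot.
Proof.
split=> [y c x x'|x c y y'] /=; rewrite /ell2_dot.
  have -> : (fun i => (c *: x + x') i * (y i)^*) =
      (fun i => c * (x i * (y i)^*) + x' i * (y i)^*).
    by apply/funext => i; rewrite mulrA -mulrDl.
  rewrite (csumD (w := fun i => c * (x i * (y i)^*))) ?csumZ//.
  - exact: ell2_csummable.
  - exact/csummableZ/ell2_csummable.
  - exact: ell2_csummable.
have -> : (fun i => x i * ((c *: y + y') i)^*) =
    (fun i => c^* * (x i * (y i)^*) + x i * (y' i)^*).
  by apply/funext => i; rewrite /= rmorphD rmorphM /= mulrDr mulrCA.
rewrite (csumD (w := fun i => c^* * (x i * (y i)^*))) ?csumZ//.
- exact: ell2_csummable.
- exact/csummableZ/ell2_csummable.
- exact: ell2_csummable.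
Qed.

Fact ell2_dot_hermitian x y : ell2_dot x y = (-1) ^+ false * Num.conj (ell2_dot y x).
Proof.
rewrite expr0 mul1r -[Num.conj _]/(conjc _) -csum_conj /ell2_dot; congr csum.
by apply/funext => i; rewrite rmorphM /= conjcK mulrC.
Qed.

Lemma ell2_dotE x :
  ell2_dot x x = (fine (\esum_(i in [set: I]) (normc (x i) ^+ 2)%:E))%:C.
Proof.
have xx i : x i * (x i)^* = (normc (x i) ^+ 2)%:C.
  by case: (x i) => a b; rewrite sqr_normc; simpc; congr (_ +i* _); ring.
rewrite /ell2_dot /csum; congr (_ +i* _).
  rewrite -ge0_rsum ?ell2P//; last by move=> i; rewrite sqr_ge0.
  by congr rsum; apply/funext => i; rewrite xx.
have -> : (fun i => complex.Im (x i * (x i)^*)) = fun=> 0.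
  by apply/funext => i; rewrite xx.
rewrite ge0_rsum ?esum1//.
by rewrite ge0_rsummableE// esum1.
Qed.

Lemma ell2_coord_le (x : ell2) i :
  normc (x i) ^+ 2 <= fine (\esum_(i in [set: I]) (normc (x i) ^+ 2)%:E).
Proof.
have n0 j : 0 <= normc (x j) ^+ 2 by rewrite sqr_ge0.
rewrite -lee_fin fineK ?ge0_esum_fin_num ?ell2P//.
apply: esum_ge; exists [set i]; first by split => //; exact: finite_set1.
by rewrite fsbig_set1.
Qed.

Fact ell2_dot_gt0 x : x != 0 -> 0 < ell2_dot x x.
Proof.
rewrite ell2_dotE => x0; rewrite ltcR; apply: contraNT x0; rewrite -leNgt => x0.
apply/eqP/ell2_inj => i; apply: eq0_normc; apply/eqP.
rewrite -sqrf_eq0 eq_le sqr_ge0 andbT.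
exact: le_trans (ell2_coord_le x i) x0.
Qed.

HB.instance Definition _ :=
  bilinear_isBilinear.Build _ _ _ _ _ _ ell2_dot ell2_dot_bilinear.
HB.instance Definition _ :=
  isHermitianSesquilinear.Build _ _ _ _ ell2_dot ell2_dot_hermitian.
HB.instance Definition _ :=
  isDotProduct.Build _ _ ell2_dot ell2_dot_gt0.

Lemma ell2_normE (x : ell2) : dotnorm (ell2_dot : {dot ell2 for Num.conj}) x =
  Num.sqrt (fine (\esum_(i in [set: I]) (normc (x i) ^+ 2)%:E)).
Proof. by rewrite /dotnorm [X in complex.Re X]ell2_dotE. Qed.

Lemma ell2_norm_coord (x : ell2) i : normc (x i) <= dotnorm (ell2_dot : {dot ell2 for Num.conj}) x.
Proof.
by rewrite ell2_normE -[leLHS]ger0_norm ?normc_ge0// -sqrtr_sqr ler_wsqrtr ?ell2_coord_le.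
Qed.

End ell2.

Section completeness.
Context {R : realType}.

Lemma real_cauchy (a : nat -> R) :
  (forall e : R, 0 < e -> exists N, forall m n, (N <= m)%N -> (N <= n)%N ->
    `|a m - a n| < e) ->
  exists l : R, a n @[n --> \oo] --> l.
Proof.
move=> ca; suff : cvg (a @ \oo) by move=> ?; exists (lim (a @ \oo)).
apply: cauchy_cvg; apply: cauchy_exP => e e0.
have [N aN] := ca e e0; exists (a N); exists N => // n /= Nn.
exact: aN.
Qed.

Lemma ell2_complete (I : choiceType) (u : nat -> @ell2 R I) :
  let dot := ell2_dot : {dot ell2 for Num.conj} in
  (forall e : R, 0 < e -> exists N, forall m n, (N <= m)%N -> (N <= n)%N ->
    dotnorm dot (u m - u n) < e) ->
  exists l, dotnorm dot (u n - l) @[n --> \oo] --> (0 : R).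
Proof.
move=> dot cu.
have /choice[f cf] i : exists f : R, (complex.Re (u n i) : R) @[n --> \oo] --> f.
  apply: real_cauchy => e /cu[N uN]; exists N => m n Nm Nn.
  apply: le_lt_trans (uN _ _ Nm Nn).
  apply: le_trans (ell2_norm_coord _ i); rewrite ell2_BE.
  apply: le_trans (Re_le_normc _).
  by case: (u m i) (u n i) => [? ?] [].
have /choice[g cg] i : exists g : R, (complex.Im (u n i) : R) @[n --> \oo] --> g.
  apply: real_cauchy => e /cu[N uN]; exists N => m n Nm Nn.
  apply: le_lt_trans (uN _ _ Nm Nn).
  apply: le_trans (ell2_norm_coord _ i); rewrite ell2_BE.
  apply: le_trans (Im_le_normc _).
  by case: (u m i) (u n i) => [? ?] [].
pose l i : R[i] := f i +i* g i.
have bound (e : R) : 0 < e -> exists N, forall n, (N <= n)%N ->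
    (\esum_(i in [set: I]) (normc (u n i - l i) ^+ 2)%:E <= (e ^+ 2)%:E)%E.
  move=> e0; have [N uN] := cu e e0; exists N => n Nn.
  apply: ge_ereal_sup => _ [A [fA _] <-].
  rewrite fsbig_finite//= sumEFin lee_fin.
  have cA : \sum_(i <- fset_set A) (normc (u n i - u m i) ^+ 2) @[m --> \oo] -->
      \sum_(i <- fset_set A) (normc (u n i - l i) ^+ 2).
    apply: cvg_big => [|i _]; first exact: add_continuous.
    under eq_fun do rewrite sqr_normc.
    rewrite sqr_normc; apply: cvgD.
      have -> : complex.Re (u n i - l i) = complex.Re (u n i) - f i.
        by case: (u n i).
      have -> : (fun m => complex.Re (u n i - u m i) ^+ 2) =
          (fun m => (complex.Re (u n i) - complex.Re (u m i)) ^+ 2).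
        by apply/funext => m; case: (u n i) (u m i) => [? ?] [].
      by rewrite expr2; under eq_fun do rewrite expr2; apply: cvgM; apply: cvgB => //; exact: cvg_cst.
    have -> : complex.Im (u n i - l i) = complex.Im (u n i) - g i.
      by case: (u n i).
    have -> : (fun m => complex.Im (u n i - u m i) ^+ 2) =
        (fun m => (complex.Im (u n i) - complex.Im (u m i)) ^+ 2).
      by apply/funext => m; case: (u n i) (u m i) => [? ?] [].
    by rewrite expr2; under eq_fun do rewrite expr2; apply: cvgM; apply: cvgB => //; exact: cvg_cst.
  rewrite -(cvg_lim _ cA)//; apply: limr_le; first by apply/cvg_ex; eexists; exact: cA.
  exists N => // m /= Nm.
  have := uN _ _ Nn Nm; rewrite ell2_normE => /ltW.
  rewrite -ler_sqr ?nnegrE ?sqrtr_ge0 ?(ltW e0)//.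
  rewrite sqr_sqrtr; last by rewrite fine_ge0// esum_ge0// => i _; rewrite lee_fin sqr_ge0.
  apply: le_trans; rewrite -lee_fin fineK; last first.
    by apply: ge0_esum_fin_num => [i|]; [rewrite sqr_ge0|exact: ell2P].
  apply: esum_ge; exists A; first by split.
  by rewrite fsbig_finite//= sumEFin.
have [N0 bN0] := bound 1 ltr01.
have dl : (fun i => u N0 i - l i : R[i]^o) \in ell2_pred.
  rewrite inE ge0_rsummableE; last by move=> i; rewrite sqr_ge0.
  exact: le_lt_trans (bN0 _ (leqnn _)) (ltry _).
pose L := u N0 - Ell2 dl.
have LE i : L i = l i by rewrite ell2_BE /= opprB addrC subrK.
exists L; apply/cvgrPdist_lt => e e0.
have [N bN] := bound (e / 2) (divr_gt0 e0 (ltr0Sn _ _)).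
exists N => // n /= Nn; rewrite sub0r normrN ger0_norm ?sqrtr_ge0//.
rewrite ell2_normE.
suff h : Num.sqrt (fine (\esum_(i in [set: I]) (normc ((u n - L) i) ^+ 2)%:E))
    <= e / 2 by lra.
rewrite -[leRHS]ger0_norm ?divr_ge0 ?(ltW e0)// -sqrtr_sqr ler_wsqrtr//.
rewrite -lee_fin fineK; last first.
  by apply: ge0_esum_fin_num => [i|]; [rewrite sqr_ge0|exact: ell2P].
apply: le_trans (bN _ Nn); apply: le_esum => i _.
by rewrite ell2_BE LE.
Qed.

Definition l2 (I : choiceType) : hilbert R := Hilbert (@ell2_complete I).

End completeness.

Section direct_sum.
Context {R : realType} (H K : hilbert R).

Definition sum_dot (p q : H * K) : R[i] :=
  hdot H p.1 q.1 + hdot K p.2 q.2.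

Fact sum_dot_bilinear : bilinear_for
  (GRing.Scale.Law.clone _ _ *%R _) (GRing.Scale.Law.clone _ _ (Num.conj \; *%R) _)
  sum_dot.
Proof.
split=> [q c p p'|p c q q']; rewrite /sum_dot /=.
  by rewrite !linearPl mulrDr addrACA.
by rewrite !linearPr /= mulrDr addrACA.
Qed.

Fact sum_dot_hermitian p q :
  sum_dot p q = (-1) ^+ false * Num.conj (sum_dot q p).
Proof.
by rewrite expr0 mul1r /sum_dot rmorphD /= (hermC (hdot H)) (hermC (hdot K)) !expr0 !mul1r.
Qed.

Fact sum_dot_gt0 p : p != 0 -> 0 < sum_dot p p.
Proof.
case: p => x y; rewrite /sum_dot /=.
have [->|x0 _] := eqVneq x 0; last first.
  by rewrite ltr_wpDr ?dnorm_ge0 ?dnorm_gt0.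
have [->|y0 _] := eqVneq y 0; first by rewrite eqxx.
by rewrite ltr_wpDl ?dnorm_ge0 ?dnorm_gt0.
Qed.

HB.instance Definition _ :=
  bilinear_isBilinear.Build _ _ _ _ _ _ sum_dot sum_dot_bilinear.
HB.instance Definition _ :=
  isHermitianSesquilinear.Build _ _ _ _ sum_dot sum_dot_hermitian.
HB.instance Definition _ :=
  isDotProduct.Build _ _ sum_dot sum_dot_gt0.

Lemma sum_complete (u : nat -> (H * K)%type) :
  let dot := sum_dot : {dot (H * K)%type for Num.conj} in
  (forall e : R, 0 < e -> exists N, forall m n, (N <= m)%N -> (N <= n)%N ->
    dotnorm dot (u m - u n) < e) ->
  exists l, dotnorm dot (u n - l) @[n --> \oo] --> (0 : R).
Proof.
move=> dot cu.
have dot_ge0 (L : hilbert R) (x : L) : 0 <= complex.Re (hdot L x x).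
  by have := dnorm_ge0 (hdot L) x; rewrite lecE => /andP[].
have nE (p : (H * K)%type) : dotnorm dot p = Num.sqrt
    (complex.Re (hdot H p.1 p.1) + complex.Re (hdot K p.2 p.2)).
  rewrite /dotnorm [X in complex.Re X]/(sum_dot p p) /sum_dot.
  by case: (hdot H _ _) (hdot K _ _) => [? ?] [].
have [|x ux] := @hcomplete _ H (fst \o u).
  move=> e /cu[N uN]; exists N => m n Nm Nn.
  apply: le_lt_trans (uN _ _ Nm Nn); rewrite nE ler_wsqrtr// lerDl.
  exact: dot_ge0.
have [|y uy] := @hcomplete _ K (snd \o u).
  move=> e /cu[N uN]; exists N => m n Nm Nn.
  apply: le_lt_trans (uN _ _ Nm Nn); rewrite nE ler_wsqrtr// lerDr.
  exact: dot_ge0.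
exists (x, y).
have uxy : dotnorm (hdot H) (fst (u n) - x) + dotnorm (hdot K) (snd (u n) - y)
    @[n --> \oo] --> (0 : R).
  by rewrite -[0]addr0; exact: cvgD ux uy.
apply: squeeze_cvgr uxy; last exact: cvg_cst.
exists 0%N => // n _ /=; rewrite sqrtr_ge0/= nE /=.
rewrite -[leLHS]ger0_norm ?sqrtr_ge0// -[leRHS]ger0_norm ?addr_ge0 ?sqrtr_ge0//.
rewrite -ler_sqr ?nnegrE ?normr_ge0// !real_normK ?num_real// sqrrD.
rewrite !sqr_sqrtr ?addr_ge0 ?dot_ge0//.
by rewrite addrAC lerDl mulrn_wge0// mulr_ge0 ?sqrtr_ge0.
Qed.

Definition hsum : hilbert R := Hilbert sum_complete.
End direct_sum.

Section operators.
Context {R : realType}.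
Implicit Types H K : hilbert R.

(* An unbounded operator is represented by its graph, a subset of H * H, so that
   equality of operators (including equality of domains) is equality of sets. *)
Definition hnorm H (x : H) : R := dotnorm (hdot H) x.

Definition hcvg H (u : nat -> H) (x : H) : Prop :=
  hnorm (u n - x) @[n --> \oo] --> (0 : R).

Definition span H (S : set H) : set H :=
  [set x | exists n (c : 'I_n -> R[i]) (s : 'I_n -> H),
    (forall k, S (s k)) /\ x = \sum_(k < n) c k *: s k].

Definition domain H K (G : set (H * K)) : set H := [set p.1 | p in G].

(* Closed densely defined operators. *)
Record cd_operator H := CdOperator {
  op_graph :> set (H * H);
  op_graph0 : op_graph 0;
  op_graph_linear : forall c p q,
    op_graph p -> op_graph q -> op_graph (c *: p + q);
  op_graph_fun : forall y, op_graph (0, y) -> y = 0;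
  op_graph_closed : forall (u v : nat -> H) x y,
    (forall n, op_graph (u n, v n)) -> hcvg u x -> hcvg v y -> op_graph (x, y);
  op_graph_dense : forall x (e : R), 0 < e ->
    exists2 x', domain op_graph x' & hnorm (x - x') < e }.

(* A x for x in the domain of A, and 0 elsewhere. *)
Definition op_app H (A : cd_operator H) (x : H) : H :=
  xget 0 [set y | op_graph A (x, y)].

Definition adjoint H (G : set (H * H)) : set (H * H) :=
  [set q | forall p, G p -> hdot H p.2 q.1 = hdot H p.1 q.2].

(* S is contained in the domain, and G is the closure of its restriction to S. *)
Definition is_core H (G : set (H * H)) (S : set H) : Prop :=
  S `<=` domain G /\
  forall p, G p -> forall e : R, 0 < e -> exists q,
    [/\ G q, S q.1, hnorm (p.1 - q.1) < e & hnorm (p.2 - q.2) < e].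

(* The operator norm, +oo when G is unbounded. *)
Definition opnorm H K (G : set (H * K)) : \bar R :=
  ereal_sup [set (hnorm p.2)%:E | p in [set p | G p /\ hnorm p.1 <= 1]].

(* The graph of (A - z I)^-1: the pairs (w, x) with (A - z I) x = w. *)
Definition shift_inverse H (G : set (H * H)) (z : R[i]) : set (H * H) :=
  [set p | G (p.2, p.1 + z *: p.2)].

Definition spectrum H (G : set (H * H)) : set R[i] :=
  [set z | ~ ((forall w, exists! x, shift_inverse G z (w, x)) /\
              (opnorm (shift_inverse G z) < +oo)%E)].

Definition resolvent_norm H (G : set (H * H)) (z : R[i]) : \bar R :=
  if `[< spectrum G z >] then +oo%E else opnorm (shift_inverse G z).

Definition pseudospectrum (eps : R) H (G : set (H * H)) : set R[i] :=
  closure ([set z | ((eps^-1)%:E < resolvent_norm G z)%E] : set R[i]^o).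

Definition unitary H K (U : H -> K) : Prop :=
  [/\ linear U, bijective U & forall x y, hdot K (U x) (U y) = hdot H x y].

(* The graph of U A U^-1. *)
Definition conj_graph H K (U : H -> K) (G : set (H * H)) : set (K * K) :=
  [set (U p.1, U p.2) | p in G].

Definition sum_graph H K (G : set (H * H)) (T : set (K * K)) :
    set (hsum H K * hsum H K) :=
  [set p | G (p.1.1, p.2.1) /\ T (p.1.2, p.2.2)].

End operators.

Section ell2_operators.
Context {R : realType}.

Fact l2_delta_subproof (I : choiceType) (i : I) :
  (fun j => (j == i)%:R : R[i]^o) \in ell2_pred.
Proof.
rewrite inE ge0_rsummableE; last by move=> j; rewrite sqr_ge0.
rewrite (esumID [set i]) //; last by move=> j _; rewrite lee_fin sqr_ge0.
rewrite setTI setTI esum_set1 ?lee_fin ?sqr_ge0// esum1 ?adde0 ?ltry//.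
by move=> j /eqP/negbTE ->; rewrite normc0 expr0n.
Qed.

Definition l2_delta {I : choiceType} (i : I) : l2 I := Ell2 (l2_delta_subproof i).

(* The basis (e_n), n = 1, 2, ..., of ell^2(N) is indexed here from 0: e_(k+1) is
   [l2_delta k]. Thus [proj n] is the orthogonal projection onto
   span {e_1, ..., e_n}. *)
Definition proj (n : nat) (x : l2 nat) : l2 nat :=
  \sum_(k < n) hdot (l2 nat) x (l2_delta (k : nat)) *: l2_delta (k : nat).

(* The graph of (I - P_m) A P_n. *)
Definition band (m n : nat) (G : set (l2 nat * l2 nat)) :
    set (l2 nat * l2 nat) :=
  [set p | exists2 w, G (proj n p.1, w) & p.2 = w - proj m w].

(* The maximal diagonal operator: x is in the domain iff (a_j x_j) is in ell^2. *)
Definition diag_graph (a : nat -> R[i]) : set (l2 nat * l2 nat) :=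
  [set p : l2 nat * l2 nat | forall j, p.2 j = a j * p.1 j].

Lemma hcvg_coord (I : choiceType) (u : nat -> l2 I) (x : l2 I) i (e : R) :
  hcvg u x -> 0 < e -> exists N, forall n, (N <= n)%N -> normc (u n i - x i) < e.
Proof.
move=> ux e0; have /cvgrPdist_lt/(_ e e0)[N _ uN] := ux.
exists N => n /uN /=; rewrite sub0r normrN ger0_norm ?sqrtr_ge0//.
by apply: le_lt_trans; rewrite -ell2_BE; exact: ell2_norm_coord.
Qed.

Fact diag_graph0 a : diag_graph a 0.
Proof. by move=> j; rewrite mulr0. Qed.

Fact diag_graph_linear a c p q :
  diag_graph a p -> diag_graph a q -> diag_graph a (c *: p + q).
Proof.
move=> dp dq j; rewrite -[LHS]/(c * p.2 j + q.2 j) dp dq.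
by rewrite -[X in _ = a j * X]/(c * p.1 j + q.1 j) mulrDr mulrCA.
Qed.

Fact diag_graph_fun a y : diag_graph a (0, y) -> y = 0.
Proof. by move=> dy; apply: ell2_inj => j; rewrite (dy j) mulr0. Qed.

Fact diag_graph_closed a (u v : nat -> l2 nat) x y :
  (forall n, diag_graph a (u n, v n)) -> hcvg u x -> hcvg v y ->
  diag_graph a (x, y).
Proof.
move=> auv ux vy j /=; apply/eqP; rewrite -subr_eq0; apply/eqP/eq0_normc.
apply/eqP; rewrite eq_le normc_ge0 andbT; apply/ler_addgt0Pl => e e0.
rewrite addr0.
have d0 : 0 < 1 + normc (a j) by rewrite ltr_pwDl ?normc_ge0.
have e1 : 0 < e / (1 + normc (a j)) by rewrite divr_gt0.
have [N1 uN] := hcvg_coord j ux e1.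
have [N2 vN] := hcvg_coord j vy e1.
have := uN _ (leq_maxl N1 N2); have := vN _ (leq_maxr N1 N2).
have := auv (maxn N1 N2) j; move: (maxn _ _) => n /= ->.
move=> hv hu; apply: ltW.
have -> : y j - a j * x j = - (a j * u n j - y j) + a j * (u n j - x j).
  by rewrite mulrBr opprB addrA subrK.
apply: le_lt_trans (ler_normcD _ _) _; rewrite normcN normcM.
have : normc (a j) * normc (u n j - x j) <= normc (a j) * (e / (1 + normc (a j))).
  by rewrite ler_wpM2l ?normc_ge0// ltW.
have : e = e / (1 + normc (a j)) + normc (a j) * (e / (1 + normc (a j))).
  by field; rewrite gt_eqF.
lra.
Qed.

Lemma l2_sum_delta (I : choiceType) (s : seq I) (c : I -> R[i]) i : uniq s ->
  (\sum_(k <- s) c k *: l2_delta k : l2 I) i = if i \in s then c i else 0.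
Proof.
elim: s => [|k s IH] /=; first by rewrite big_nil.
move=> /andP[ks us]; rewrite big_cons ell2_DE IH// ell2_ZE in_cons /=.
case: eqVneq => [->|ik] /=; first by rewrite (negbTE ks) mulr1 addr0.
by rewrite mulr0 add0r.
Qed.

Lemma l2_finite_dense (I : choiceType) (x : l2 I) (e : R) : 0 < e ->
  exists s : seq I, hnorm (x - \sum_(k <- s) x k *: l2_delta k) < e.
Proof.
move=> e0; have sx := ell2P x.
have x0 i : 0 <= normc (x i) ^+ 2 by rewrite sqr_ge0.
have fx := ge0_esum_fin_num x0 sx.
have e20 : 0 < e ^+ 2 by rewrite exprn_gt0.
have [_ [A [fA _] <-] xA] := ub_ereal_sup_adherent e20 fx.
exists (fset_set A); set y : l2 I := x - _; rewrite /hnorm (ell2_normE y).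
rewrite -[ltRHS]ger0_norm ?(ltW e0)// -sqrtr_sqr ltr_sqrt//.
have y0 i : 0 <= normc (y i) ^+ 2 by rewrite sqr_ge0.
have fy := ge0_esum_fin_num y0 (ell2P y).
have yE i : y i = if i \in fset_set A then 0 else x i.
  by rewrite /y ell2_BE l2_sum_delta// ; case: ifP; rewrite ?subrr ?subr0.
rewrite -lte_fin fineK//.
have : (\esum_(i in [set: I]) (normc (x i) ^+ 2)%:E - (e ^+ 2)%:E <
    \sum_(i \in A) (normc (x i) ^+ 2)%:E)%E by exact: xA.
rewrite lteBlDr// => h.
have le : (\esum_(i in [set: I]) (normc (y i) ^+ 2)%:E +
    \sum_(i \in A) (normc (x i) ^+ 2)%:E <=
    \esum_(i in [set: I]) (normc (x i) ^+ 2)%:E)%E.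
  rewrite [leRHS](esumID A); last by move=> i _; rewrite lee_fin.
  rewrite setTI setTI (esum_fset fA); last by move=> i _; rewrite lee_fin.
  rewrite addeC leeD2l// [leRHS]esum_mkcond.
  apply: le_esum => i _; rewrite yE in_fset_set// in_setC.
  by case: (i \in A); rewrite ?lexx// normc0 expr0n.
have fA' : (\sum_(i \in A) (normc (x i) ^+ 2)%:E)%E \is a fin_num.
  by rewrite fsbig_finite//= sumEFin.
rewrite -(lteD2rE _ _ fA').
by apply: le_lt_trans le _; rewrite addeC.
Qed.

Fact diag_graph_dense a (x : l2 nat) (e : R) : 0 < e ->
  exists2 x', domain (diag_graph a) x' & hnorm (x - x') < e.
Proof.
move=> /(@l2_finite_dense _ x)[s xs]; exists (\sum_(k <- s) x k *: l2_delta k) => //.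
exists (\sum_(k <- s) x k *: l2_delta k, \sum_(k <- s) x k *: (a k *: l2_delta k)) => //.
elim: s {xs} => [|k s IH]; first by rewrite !big_nil; exact: diag_graph0.
rewrite !big_cons.
apply: (diag_graph_linear (x k) (p := (l2_delta k, a k *: l2_delta k))) IH => j.
rewrite -[LHS]/(a k * (j == k)%:R) -[RHS]/(a j * (j == k)%:R).
by case: (eqVneq j k) => [->//|_]; rewrite !mulr0.
Qed.

Definition diag_op (a : nat -> R[i]) : cd_operator (l2 nat) :=
  CdOperator (diag_graph0 a) (@diag_graph_linear a) (@diag_graph_fun a)
    (@diag_graph_closed a) (@diag_graph_dense a).

End ell2_operators.
Arguments l2 R I : clear implicits.

Section sci.
Context {R : realType}.

Record sci_problem := SciProblem {
  sci_inst : Type;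
  sci_out : Type;
  sci_dist : sci_out -> sci_out -> R;
  sci_dist_eq0 : forall x y, sci_dist x y = 0 <-> x = y;
  sci_dist_sym : forall x y, sci_dist x y = sci_dist y x;
  sci_dist_triangle : forall x y z,
    sci_dist x z <= sci_dist x y + sci_dist y z;
  sci_target : sci_inst -> sci_out;
  sci_eval : set (sci_inst -> R[i]);
  sci_separating : forall A B, sci_target A <> sci_target B ->
    exists2 f, sci_eval f & f A <> f B }.

Arguments sci_eval : clear implicits.

Record general_algorithm (P : sci_problem) := GeneralAlgorithm {
  alg_out :> sci_inst P -> sci_out P;
  alg_query : sci_inst P -> set (sci_inst P -> R[i]);
  alg_query_eval : forall A, alg_query A `<=` sci_eval P;
  alg_query_finite : forall A, finite_set (alg_query A);
  alg_consistent : forall A B, (forall f, alg_query A f -> f B = f A) ->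
    alg_out B = alg_out A /\ alg_query B = alg_query A }.

(* A family of algorithms with k indices in N, the first one being n_k and the
   last one n_1. *)
Fixpoint alg_family (P : sci_problem) (k : nat) : Type :=
  if k is k'.+1 then nat -> alg_family P k' else general_algorithm P.

(* y is the iterated limit lim_(n_k) ... lim_(n_1) of the family at A, every inner
   limit being required to exist. With k = 0 this says that the algorithm
   returns y. *)
Fixpoint iterated_limit (P : sci_problem) (A : sci_inst P) (k : nat) :
    alg_family P k -> sci_out P -> Prop :=
  match k return alg_family P k -> sci_out P -> Prop with
  | 0 => fun G y => G A = y
  | k'.+1 => fun G y => exists h : nat -> sci_out P,
      (forall n, iterated_limit A (G n) (h n)) /\
      sci_dist (h n) y @[n --> \oo] --> (0 : R)
  end.

Definition has_tower (P : sci_problem) (k : nat) : Prop :=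
  exists G : alg_family P k, forall A, iterated_limit A G (sci_target A).

(* The least height of a tower; the infimum of the empty set is +oo. *)
Definition SCI_G (P : sci_problem) : \bar R :=
  ereal_inf [set k%:R%:E | k in has_tower P].

Definition discrete_dist (T : Type) (x y : T) : R := (~~ `[< x = y >])%:R.

Fact discrete_dist_eq0 (T : Type) (x y : T) : discrete_dist x y = 0 <-> x = y.
Proof.
rewrite /discrete_dist; case: asboolP => [->|xy] //=; split => // /eqP.
by rewrite oner_eq0.
Qed.

Fact discrete_dist_sym (T : Type) (x y : T) :
  discrete_dist x y = discrete_dist y x.
Proof.
rewrite /discrete_dist; congr ((~~ _)%:R); apply/asboolP/asboolP => //.
Qed.

Fact discrete_dist_triangle (T : Type) (x y z : T) :
  discrete_dist x z <= discrete_dist x y + discrete_dist y z.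
Proof.
rewrite /discrete_dist; case: (asboolP (x = z)) => [_|xz] /=.
  by rewrite addr_ge0.
case: (asboolP (x = y)) => [xy|_] /=; last by rewrite lerDl.
case: (asboolP (y = z)) => [yz|_] /=; last by rewrite add0r.
by case: xz; rewrite xy.
Qed.

End sci.
Arguments sci_problem R : clear implicits.

Section instances.
Context {R : realType}.

(* A connected graph with vertex set {v_1, v_2, ...}; v_(k+1) is [vnum k]. Loops
   are not excluded. *)
Record cgraph := CGraph {
  vertex : choiceType;
  adj : rel vertex;
  adj_sym : symmetric adj;
  adj_connected : forall u w, exists2 p, path adj u p & last u p = w;
  vnum : nat -> vertex;
  vnum_bij : bijective vnum }.

Record fset_coding (V : choiceType) := FsetCoding {
  fset_code :> {fset V} -> nat;
  fset_code_inj : injective fset_code }.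

(* The sequences indexed by N = {1, 2, ...} are indexed here from 0: [gen_disp k]
   and [gen_bound k] are f(k+1) and c_(k+1). *)
Record gen_inst := GenInst {
  gen_op : cd_operator (l2 R nat);
  gen_core : is_core gen_op (span (range l2_delta));
  gen_core_adj : is_core (adjoint gen_op) (span (range l2_delta));
  gen_disp : nat -> nat;
  gen_disp_gt0 : forall k, (0 < gen_disp k)%N;
  gen_bound : nat -> rat;
  gen_bound_ge0 : forall k, 0 <= gen_bound k;
  gen_bound_null : (ratr (gen_bound k) : R) @[k --> \oo] --> (0 : R);
  gen_dispersion : forall k,
    (maxe (opnorm (band (gen_disp k) k.+1 gen_op))
          (opnorm (band (gen_disp k) k.+1 (adjoint gen_op)))
     <= (ratr (gen_bound k))%:E)%E }.

Definition matrix_entry (I : choiceType) (A : cd_operator (l2 R I)) (i j : I) :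
    R[i] := hdot (l2 R I) (op_app A (l2_delta j)) (l2_delta i).

Record graph_inst (Gr : cgraph) := GraphInst {
  graph_op : cd_operator (l2 R (vertex Gr));
  graph_core : is_core graph_op (span (range l2_delta));
  graph_core_adj : is_core (adjoint graph_op) (span (range l2_delta));
  graph_nbr : vertex Gr -> {fset vertex Gr};
  graph_supp : forall v w, w \notin graph_nbr v ->
    matrix_entry graph_op v w = 0 /\ matrix_entry graph_op w v = 0 }.

Inductive rep := Diag | Gen | Graph.

Variable Gr : cgraph.

Definition rep_space (rho : rep) : hilbert R :=
  match rho with Graph => l2 R (vertex Gr) | _ => l2 R nat end.

Definition rep_basis (rho : rep) : nat -> rep_space rho :=
  match rho return nat -> rep_space rho with
  | Graph => fun j => l2_delta (vnum Gr j)
  | _ => fun j => l2_delta j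
  end.

Definition rep_inst (rho : rep) : Type :=
  match rho with
  | Diag => nat -> R[i]
  | Gen => gen_inst
  | Graph => graph_inst Gr
  end.

Definition rep_op (rho : rep) : rep_inst rho -> cd_operator (rep_space rho) :=
  match rho return rep_inst rho -> cd_operator (rep_space rho) with
  | Diag => diag_op
  | Gen => gen_op
  | Graph => @graph_op Gr
  end.

Definition embed (J : set R) : set R[i] := [set t%:C | t in J].

Variable J : set R.

(* The singletons {z} with z in J. *)
Definition window := {K : set R[i] | exists2 z, embed J z & K = [set z]}.

(* [readout_val k] is r_(k+1). *)
Record readout := Readout {
  readout_val :> nat -> window -> R[i];
  readout_rat : forall k K, exists p q : rat,
    readout_val k K = (ratr p : R) +i* (ratr q : R);
  readout_close : forall k K z, sval K z ->
    normc (readout_val k K - z) <= 2 ^- k.+2 }.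

Variables (r : readout) (code : fset_coding (vertex Gr)).

Definition input (rho : rep) : Type := (rep_inst rho * window)%type.

Definition interface (rho : rep) : set (input rho -> R[i]) :=
  match rho return set (input rho -> R[i]) with
  | Diag =>
      range (fun k (x : input Diag) => r k x.2) `|`
      range (fun j (x : input Diag) => x.1 j)
  | Gen =>
      range (fun k (x : input Gen) => r k x.2) `|`
      range (fun (ij : nat * nat) (x : input Gen) =>
        matrix_entry (gen_op x.1) ij.1 ij.2) `|`
      range (fun k (x : input Gen) => (gen_disp x.1 k)%:R) `|`
      range (fun k (x : input Gen) => ratr (gen_bound x.1 k))
  | Graph =>
      range (fun k (x : input Graph) => r k x.2) `|`
      range (fun (ij : nat * nat) (x : input Graph) =>
        matrix_entry (graph_op x.1) (vnum Gr ij.1) (vnum Gr ij.2)) `|`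
      range (fun i (x : input Graph) =>
        (code (graph_nbr x.1 (vnum Gr i)))%:R)
  end.

Lemma pair_lin (H : hilbert R) (c : R[i]) (x y x' y' : H) :
  c *: ((x, y) : H * H) + (x', y') = (c *: x + x', c *: y + y').
Proof. by []. Qed.

Lemma op_uniq (H : hilbert R) (A : cd_operator H) x y y' :
  op_graph A (x, y) -> op_graph A (x, y') -> y = y'.
Proof.
move=> Ay Ay'; apply/eqP; rewrite eq_sym -subr_eq0; apply/eqP.
apply: (@op_graph_fun _ _ A); have := op_graph_linear (-1) Ay Ay'.
by rewrite pair_lin !scaleN1r addNr addrC.
Qed.

Lemma op_appP (H : hilbert R) (A : cd_operator H) x :
  domain A x -> op_graph A (x, op_app A x).
Proof.
move=> [[x' y] /= Ay xx']; rewrite /op_app; case: xgetP => [z ->//|].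
by move=> /(_ y); rewrite -xx'.
Qed.

Lemma op_sub (H : hilbert R) (I : Type) (e : I -> H) (A B : cd_operator H) :
  is_core A (span (range e)) -> is_core B (span (range e)) ->
  (forall i, op_app A (e i) = op_app B (e i)) ->
  op_graph A `<=` op_graph B.
Proof.
move=> [dA cA] [dB _] AB.
have se i : span (range e) (e i).
  exists 1%N, (fun=> 1), (fun=> e i); split => [_|]; first by exists i.
  by rewrite big_ord1 scale1r.
have spanAB x : span (range e) x ->
    exists y, op_graph A (x, y) /\ op_graph B (x, y).
  move=> [n [c [s [es ->]]]]; exists (\sum_(k < n) c k *: op_app A (s k)).
  have sumG (T : cd_operator H) : (forall k, op_graph T (s k, op_app A (s k))) ->
      op_graph T (\sum_(k < n) c k *: s k, \sum_(k < n) c k *: op_app A (s k)).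
    move=> Ts; elim/big_ind2 : _ => [||k _]; first exact: op_graph0.
    - move=> x1 y1 x2 y2 T1 T2.
      have := op_graph_linear 1 T1 T2.
      by rewrite pair_lin !scale1r.
    - have := op_graph_linear (c k) (Ts k) (op_graph0 T).
      by rewrite pair_lin !addr0.
  split; apply: sumG => k; have [i _ <-] := es k.
    exact/op_appP/dA.
  by rewrite AB; exact/op_appP/dB.
move=> [x y] Axy.
have /choice[q qP] (n : nat) : exists q : H * H, [/\ op_graph A q,
    span (range e) q.1, hnorm (x - q.1) < n.+1%:R^-1 &
    hnorm (y - q.2) < n.+1%:R^-1].
  by apply: (cA (x, y) Axy); rewrite invr_gt0.
have hsym (u v : H) : hnorm (u - v) = hnorm (v - u).
  by rewrite /hnorm /dotnorm -opprB hnormN.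
apply: (@op_graph_closed _ _ B (fst \o q) (snd \o q)) => [n||].
- have [Aq Sq _ _] := qP n; have [z [Az Bz]] := spanAB _ Sq.
  move: Aq Az Bz => /=; case: (q n) => q1 q2 /= Aq Az Bz.
  by rewrite (op_uniq Aq Az).
- apply: squeeze_cvgr (@cvg_harmonic R); last exact: cvg_cst.
  near=> n; have [_ _ h _] := qP n.
  by rewrite sqrtr_ge0 /= hsym ltW.
- apply: squeeze_cvgr (@cvg_harmonic R); last exact: cvg_cst.
  near=> n; have [_ _ _ h] := qP n.
  by rewrite sqrtr_ge0 /= hsym ltW.
Unshelve. all: by end_near. Qed.

Lemma hdot_delta (I : choiceType) (x : l2 R I) i :
  hdot (l2 R I) x (l2_delta i) = x i.
Proof.
rewrite -[LHS]/(ell2_dot x (l2_delta i)) /ell2_dot (@csum1 _ _ i).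
  by rewrite /= eqxx rmorph1 mulr1.
by move=> j /negbTE /= ->; rewrite rmorph0 mulr0.
Qed.

Lemma matrix_determined (I : Type) (K : choiceType) (v : I -> K)
    (A B : cd_operator (l2 R K)) : (forall k, exists i, v i = k) ->
  is_core A (span (range l2_delta)) -> is_core B (span (range l2_delta)) ->
  (forall i j, matrix_entry A (v i) (v j) = matrix_entry B (v i) (v j)) ->
  op_graph A = op_graph B.
Proof.
move=> sv cA cB AB.
have AB' k : op_app A (l2_delta k) = op_app B (l2_delta k).
  have [j <-] := sv k; apply: ell2_inj => k'; have [i <-] := sv k'.
  by rewrite -!hdot_delta; exact: AB.
by apply/seteqP; split; [apply: (op_sub cA cB)|apply: (op_sub cB cA)] => k;
  rewrite AB'.
Qed.

Lemma window_determined (x y : window) :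
  (forall k, r k x = r k y) -> sval x = sval y.
Proof.
case: x y => [Kx [z zJ ex]] [Ky [w wJ ey]] rxy /=.
have rx k := readout_close r k (K := exist _ Kx (ex_intro2 _ _ z zJ ex)) (z := z).
have ry k := readout_close r k (K := exist _ Ky (ex_intro2 _ _ w wJ ey)) (z := w).
rewrite ex ey; congr [set _]; apply/eqP; rewrite -subr_eq0; apply/eqP/eq0_normc.
apply/eqP; rewrite eq_le normc_ge0 andbT.
apply/ler_addgt0Pl => e e0; rewrite addr0; have [k ke] : exists k, 2 ^- k.+1 < e :> R.
  have half1 : `|2^-1 : R| < 1.
    by rewrite ger0_norm ?invr_ge0// invf_lt1// ltr1n.
  have /cvgrPdist_lt/(_ e e0)[N _ hN] := @cvg_geometric R 1 _ half1.
  exists N; have := hN N.+1 (leqnSn N).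
  by rewrite /= /geometric /= mul1r sub0r normrN exprVn ger0_norm ?invr_ge0 ?exprn_ge0.
apply: ltW; apply: le_lt_trans ke.
have -> : z - w = - (r k (exist _ Kx (ex_intro2 _ _ z zJ ex)) - z)
    + (r k (exist _ Ky (ex_intro2 _ _ w wJ ey)) - w).
  by rewrite rxy; ring.
apply: le_trans (ler_normcD _ _) _; rewrite normcN.
have -> : 2 ^- k.+1 = 2 ^- k.+2 + 2 ^- k.+2 :> R.
  by rewrite [in RHS]exprS invfM; field.
by apply: lerD; [apply: rx|apply: ry]; rewrite /= (ex, ey).
Qed.

Lemma interface_determines rho (x y : input rho) :
  (forall f, interface f -> f x = f y) ->
  op_graph (rep_op x.1) = op_graph (rep_op y.1) /\ sval x.2 = sval y.2.
Proof.
case: rho x y => -[A Kx] [B Ky] /= fxy; split => /=.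
- suff -> : A = B by [].
  apply/funext => j; apply: (fxy (fun x : input Diag => x.1 j)).
  by right; exists j.
- apply: window_determined => k.
  by apply: (fxy (fun x : input Diag => r k x.2)); left; exists k.
- apply: (@matrix_determined _ _ id) => [k|||i j]; first by exists k.
  + exact: gen_core.
  + exact: gen_core.
  + apply: (fxy (fun x : input Gen => matrix_entry (gen_op x.1) i j)).
    by left; left; right; exists (i, j).
- apply: window_determined => k.
  by apply: (fxy (fun x : input Gen => r k x.2)); left; left; left; exists k.
- apply: (@matrix_determined _ _ (vnum Gr)) => [v|||i j].
  + by have [u _ uK] := vnum_bij Gr; exists (u v); rewrite uK.
  + exact: graph_core.
  + exact: graph_core.
  + apply: (fxy (fun x : input Graph =>
        matrix_entry (graph_op x.1) (vnum Gr i) (vnum Gr j))).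
    by left; right; exists (i, j).
- apply: window_determined => k.
  by apply: (fxy (fun x : input Graph => r k x.2)); left; left; exists k.
Qed.

(* An SCI problem on the inputs of one representation class, with discrete output
   {0, 1}. *)
Record gproblem := GProblem {
  gp_rep : rep;
  gp_target : input gp_rep -> bool;
  gp_interface : set (input gp_rep -> R[i]);
  gp_separating : forall x y, gp_target x <> gp_target y ->
    exists2 f, gp_interface f & f x <> f y }.

Arguments gp_interface : clear implicits.

Definition gp_sci (P : gproblem) : sci_problem R :=
  SciProblem (@discrete_dist_eq0 R bool) (@discrete_dist_sym R bool)
    (@discrete_dist_triangle R bool) (@gp_separating P).

(* [misses S] is the 0/1 answer to whether S(A) and K are disjoint. *)
Definition misses (S : forall H : hilbert R, set (H * H) -> set R[i]) rho (x : input rho) : bool :=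
  `[< S _ (op_graph (rep_op x.1)) `&` sval x.2 = set0 >].

Fact misses_separating S rho (x y : input rho) : misses S x <> misses S y ->
  exists2 f, interface f & f x <> f y.
Proof.
move=> Sxy; apply: contrapT => nf; apply: Sxy.
have [|exy wxy] := @interface_determines rho x y.
  by move=> f fi; apply: contrapT => fxy; apply: nf; exists f.
by rewrite /misses exy wxy.
Qed.

Definition problem_sigma (rho : rep) : gproblem :=
  GProblem (@misses_separating (@spectrum R) rho).

Definition problem_pseudo (eps : R) (rho : rep) : gproblem :=
  GProblem (@misses_separating (@pseudospectrum R eps) rho).

Definition block (P : rep -> gproblem) : set gproblem :=
  [set P Diag; P Gen; P Graph].

Variable eps : R.

(* op(F A) = U op(A) U^-1 for all instances A. *)
Definition unitary_form rho rho' (F : rep_inst rho -> rep_inst rho')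
    (U : rep_space rho -> rep_space rho') : Prop :=
  unitary U /\ forall A, op_graph (rep_op (F A)) = conj_graph U (rep_op A).

(* f(n) = n and c_n = 2^-n with n = k+1. *)
Definition diag_gen_inclusion (F : rep_inst Diag -> rep_inst Gen) : Prop :=
  forall a, [/\ op_graph (rep_op (F a)) = op_graph (rep_op a),
    forall k, gen_disp (F a) k = k.+1 &
    forall k, gen_bound (F a) k = 2 ^- k.+1].

Definition diag_graph_inclusion (F : rep_inst Diag -> rep_inst Graph) : Prop :=
  (exists2 W : rep_space Diag -> rep_space Graph,
    unitary_form F W & forall j, W (rep_basis Diag j) = rep_basis Graph j) /\
  forall a j, graph_nbr (F a) (vnum Gr j) = [fset (vnum Gr j)]%fset.

(* The five admissible forms; E2, E3 and E4 are instances of E1, kept separate as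
   in the definition of the encodings. *)
Inductive elementary_form :
    forall rho rho', (rep_inst rho -> rep_inst rho') -> Prop :=
| E1_unitary rho rho' (F : rep_inst rho -> rep_inst rho') U :
    unitary_form F U -> elementary_form F
| E2_relabel rho rho' (F : rep_inst rho -> rep_inst rho') U (pi : nat -> nat) :
    rho <> Graph -> rho' <> Graph -> bijective pi ->
    (forall j, U (rep_basis rho j) = rep_basis rho' (pi j)) ->
    unitary_form F U -> elementary_form F
| E3_automorphism (F : rep_inst Graph -> rep_inst Graph)
    (U : l2 R (vertex Gr) -> l2 R (vertex Gr)) (alpha : vertex Gr -> vertex Gr) :
    bijective alpha -> {mono alpha : u v / adj u v} ->
    (forall v, U (l2_delta v) = l2_delta (alpha v)) ->
    @unitary_form Graph Graph F U -> elementary_form F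
| E4_inclusion rho rho' (F : rep_inst rho -> rep_inst rho') W :
    unitary_form F W -> elementary_form F
| E5_stabilization rho rho' (F : rep_inst rho -> rep_inst rho')
    (H0 : hilbert R) (T0 : cd_operator H0)
    (W : hsum (rep_space rho) H0 -> rep_space rho') :
    unitary W ->
    spectrum T0 `&` embed J = set0 ->
    pseudospectrum eps T0 `&` embed J = set0 ->
    (forall A, op_graph (rep_op (F A)) =
       conj_graph W (sum_graph (rep_op A) T0)) ->
    elementary_form F.

(* The last two fields say that the collection contains the two representation
   inclusions: each of them is determined by its specification. *)
Record geometric_structure := GeometricStructure {
  elementary : forall rho rho', set (rep_inst rho -> rep_inst rho');
  elementary_formP : forall rho rho' (F : rep_inst rho -> rep_inst rho'),
    elementary F -> elementary_form F;
  elementary_diag_gen : forall F, diag_gen_inclusion F -> elementary F;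
  elementary_diag_graph : forall F, diag_graph_inclusion F -> elementary F }.

Variable CH : geometric_structure.

(* Finite compositions of maps (A, K) |-> (F A, K), F in the collection. *)
Inductive encoding : forall rho rho', (input rho -> input rho') -> Prop :=
| encoding_id rho : @encoding rho rho id
| encoding_comp rho1 rho2 rho3 (F : rep_inst rho1 -> rep_inst rho2)
    (E : input rho2 -> input rho3) :
    elementary CH F -> encoding E ->
    encoding (fun x : input rho1 => E (F x.1, x.2)).

Definition le_geom (S P : gproblem) : Prop :=
  exists (E : input (gp_rep S) -> input (gp_rep P)) (D : bool -> bool),
    [/\ encoding E, continuous D,
        forall x, D (gp_target (E x)) = gp_target x &
        forall lam, gp_interface P lam ->
          exists m (g : 'I_m -> input (gp_rep S) -> R[i])
              (theta : ('I_m -> R[i]) -> R[i]),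
            (forall i, gp_interface S (g i)) /\
            forall x, lam (E x) = theta (fun i => g i x)].

End instances.

Section degrees.
Context {R : realType} {T : Type}.
Variables (sci : T -> \bar R) (le : T -> T -> Prop) (U : set T).

Definition order2 : set T := [set P | U P /\ sci P = 2%:E].

Definition degree (P : T) : set T :=
  [set Q | order2 Q /\ le P Q /\ le Q P].

Definition degree_le (c d : set T) : Prop :=
  exists P Q, c P /\ d Q /\ le P Q.

Definition min_degrees : set (set T) :=
  [set c | [set degree P | P in order2] c /\
    forall d, [set degree P | P in order2] d -> degree_le d c -> d = c].

End degrees.

(* Main.v *)
From mathcomp Require Import complex finmap ring lra.
Require Import Defs.
From mathcomp Require Import all_boot all_order all_algebra.
From mathcomp Require Import all_classical all_reals all_analysis.

Set Implicit Arguments.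
Unset Strict Implicit.
Unset Printing Implicit Defensive.

Import Order.TTheory GRing.Theory Num.Theory numFieldNormedType.Exports.
Import ComplexField.Normc.

Local Open Scope classical_set_scope.
Local Open Scope ring_scope.
Local Open Scope complex_scope.

(** Both questions ask how the resolvent behaves near the point [z] of the window,
    and the proof rests on one two-sided criterion, [resolvent_boundP]: for a closed
    densely defined [A] and [d > 0], the point [z] is in the resolvent set with
    resolvent norm at most [1/d] iff [A - z] and [A^* - z^*] are both bounded below
    by [d].  So the spectrum misses [z] iff, for some [m], the bound [1/(m+1)] holds
    at [z], and the [eps]-pseudospectrum misses [z] iff, for some [m], the bound
    [eps] holds at all points within [1/(m+1)] of [z]; the record [resolvent_test]
    treats both at once.  For a diagonal operator the answer is 1 iff the distances
    [|a_j - z|] exceed 0, respectively [eps], by a uniform margin ([diag_margin]).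

    Height at most 2 ([has_tower2]).  As the basis spans a core of [A] and of [A^*],
    lower bounds need only be checked on finitely supported vectors, and the
    dispersion data or the neighbourhoods [S_v] turn finitely many queries into the
    action of [A] and [A^*] on the span of the first [n] basis vectors, up to an
    error tending to 0 with [n].  Stage [(m, n)] answers 1 iff some instance with the
    same query values satisfies the [m]-th condition on that span.  This decreases
    in [n], increases in [m], and the iterated limit is the right answer.

    Height at least 2 ([diag_not_height1]).  Given a height-1 tower on diagonal
    operators, an adversary lets the diagonal entries approach the critical distance
    from [z], waiting before each move until an algorithm has answered 1 on the basis
    of finitely many entries.  In the limit the answer is 0 although 1 was given
    infinitely often.

    The inclusions of diagonal operators are encodings, which gives the reductions
    within each block ([diag_le]); heights do not increase along reductions
    ([has_tower_le_geom]), so the lower bound is needed for diagonal operators only.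

    Separation ([not_le_geom]).  Every encoding preserves both answers: resolvent
    bounds are invariant under unitary conjugation, and for an orthogonal sum they
    are the bounds of both summands, of which the neutral one passes at points of
    [J].  A decoder would thus recover [0 < |a - z|] from [eps < |a - z|], or
    conversely, for all constant sequences [a].  Distance 0 and a large distance
    force it to be the identity, and a distance in between contradicts this.

    The description of the minimal degrees is then formal
    ([min_degrees_sources]). *)

(** * Hilbert spaces and the projection theorem *)

Lemma normcR (R : realType) (x : R) : normc x%:C = `|x|.
Proof. by rewrite Defs.normcE /= expr0n addr0 sqrtr_sqr. Qed.

Section hilbert_norm.
Context {R : realType} {H : hilbert R}.
Implicit Types x y z : H.
Local Notation "<< x , y >>" := (hdot H x y).

Lemma hdot_conj x y : << y, x >> = conjc << x, y >>.
Proof. by rewrite (hermC (hdot H)) expr0 mul1r. Qed.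

Lemma hdotZl c x y : << c *: x, y >> = c * << x, y >>.
Proof. by rewrite linearZl_LR. Qed.

Lemma hdotZr c x y : << x, c *: y >> = conjc c * << x, y >>.
Proof. by rewrite linearZr_LR. Qed.

Lemma hdotxx x : << x, x >> = (hnorm x ^+ 2)%:C.
Proof.
have := dnorm_ge0 (hdot H) x; rewrite lecE => /andP[/eqP im0 re0].
apply: eqP; rewrite eq_complex /= /hnorm /dotnorm sqr_sqrtr// eqxx.
by rewrite im0 eqxx.
Qed.

Lemma hnorm_ge0 x : 0 <= hnorm x. Proof. exact: sqrtr_ge0. Qed.

Lemma hnorm0 : hnorm (0 : H) = 0.
Proof. by rewrite /hnorm /dotnorm linear0r /= sqrtr0. Qed.

Lemma hnorm_eq0 x : hnorm x = 0 -> x = 0.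
Proof.
by move=> x0; apply/eqP; rewrite -(dnorm_eq0 (hdot H)) hdotxx x0 expr0n.
Qed.

Lemma sqr_hnormD x y : hnorm (x + y) ^+ 2 =
  hnorm x ^+ 2 + 2 * complex.Re << x, y >> + hnorm y ^+ 2.
Proof.
apply: complexI; rewrite -hdotxx linearDl /= !linearDr /= (hdot_conj x y).
rewrite !hdotxx; case: (<< x, y >>) => a b; simpc.
by congr (_ +i* _); rewrite /=; ring.
Qed.

Lemma hnormZ c x : hnorm (c *: x) = normc c * hnorm x.
Proof.
apply/eqP; rewrite -(@eqrXn2 _ 2)// ?mulr_ge0 ?hnorm_ge0 ?normc_ge0//.
apply/eqP/complexI; rewrite -hdotxx linearZl_LR /= linearZr_LR /= hdotxx.
rewrite exprMn sqr_normc; case: c => a b; simpc.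
by congr (_ +i* _); rewrite /=; ring.
Qed.

Lemma hnorm_opp x : hnorm (- x) = hnorm x.
Proof. by rewrite /hnorm /dotnorm hnormN. Qed.

Lemma hnorm_sym x y : hnorm (x - y) = hnorm (y - x).
Proof. by rewrite -hnorm_opp opprB. Qed.

(** Subtracting the component along [y] shortens [x] unless the two are orthogonal:
    this gives both the Cauchy-Schwarz inequality and the orthogonality of a
    minimal residual. *)
Lemma sqr_hnorm_residual x y : hnorm y != 0 ->
  hnorm (x - (<< x, y >> / (hnorm y ^+ 2)%:C) *: y) ^+ 2 =
  hnorm x ^+ 2 - normc << x, y >> ^+ 2 / hnorm y ^+ 2.
Proof.
move=> y0; set d := << x, y >>.
rewrite sqr_hnormD hnorm_opp hnormZ linearNr linearZr_LR /= -/d.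
have -> : complex.Re (- ((d / (hnorm y ^+ 2)%:C)^* * d)) =
    - (normc d ^+ 2 / hnorm y ^+ 2).
  rewrite sqr_normc -fmorphV; case: d => a b /=; simpc.
  by rewrite /=; ring.
rewrite normcM normcV normcR ger0_norm ?sqr_ge0//.
by field.
Qed.

Lemma cauchy_schwarz x y : normc << x, y >> <= hnorm x * hnorm y.
Proof.
have [y0|y0] := eqVneq (hnorm y) 0.
  by rewrite (hnorm_eq0 y0) linear0r normc0 hnorm0 mulr0.
have n0 : 0 < hnorm y ^+ 2 by rewrite exprn_gt0 ?lt_def ?y0 ?hnorm_ge0.
have := sqr_ge0 (hnorm (x - (<< x, y >> / (hnorm y ^+ 2)%:C) *: y)).
rewrite sqr_hnorm_residual// subr_ge0 ler_pdivrMr// -exprMn.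
by rewrite ler_sqr ?nnegrE ?normc_ge0 ?mulr_ge0 ?hnorm_ge0.
Qed.

Lemma ler_hnormD x y : hnorm (x + y) <= hnorm x + hnorm y.
Proof.
rewrite -ler_sqr ?nnegrE ?addr_ge0 ?hnorm_ge0// sqr_hnormD sqrrD.
have := le_trans (ler_norm _) (le_trans (Re_le_normc _) (cauchy_schwarz x y)).
lra.
Qed.

Lemma ler_hnormB x y : hnorm x - hnorm y <= hnorm (x - y).
Proof. by rewrite lerBlDr; have := ler_hnormD (x - y) y; rewrite subrK. Qed.

Lemma parallelogram x y : hnorm (x + y) ^+ 2 + hnorm (x - y) ^+ 2 =
  2 * hnorm x ^+ 2 + 2 * hnorm y ^+ 2.
Proof.
rewrite !sqr_hnormD hnorm_opp linearNr.
have -> : complex.Re (- << x, y >>) = - complex.Re << x, y >>.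
  by case: (<< x, y >>).
by ring.
Qed.

Lemma hcvg_le (u : nat -> H) x w (a : nat -> R) (d : R) :
  hcvg u x -> a n @[n --> \oo] --> d ->
  (forall n, hnorm (w - u n) <= a n) -> hnorm (w - x) <= d.
Proof.
move=> ux ad ua.
have h : a n + hnorm (u n - x) @[n --> \oo] --> d.
  by rewrite -[d]addr0; exact: cvgD ad ux.
rewrite -(cvg_lim _ h)//; apply: limr_ge; first by apply/cvg_ex; exists d.
near=> n; apply: le_trans (lerD (ua n) (lexx _)).
by rewrite (_ : w - x = (w - u n) + (u n - x)) ?ler_hnormD// addrA subrK.
Unshelve. all: by end_near. Qed.

(** The nearest-point argument: minimise the distance from [w] to [M].  By the
    parallelogram identity a minimising sequence is Cauchy, and the difference
    between [w] and its limit is orthogonal to [M]. *)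
Theorem closed_subspace_full (M : set H) :
  M 0 -> (forall c x y, M x -> M y -> M (c *: x + y)) ->
  (forall u x, (forall n, M (u n)) -> hcvg u x -> M x) ->
  (forall y, (forall x, M x -> << x, y >> = 0) -> y = 0) ->
  forall w, M w.
Proof.
move=> M0 Mlin Mclosed Mperp w.
pose D := [set hnorm (w - m) | m in M]; pose d := inf D.
have hD : has_inf D.
  split; first by exists (hnorm (w - 0)), 0.
  by exists 0 => _ [m _ <-]; exact: hnorm_ge0.
have d_le m : M m -> d <= hnorm (w - m).
  by move=> Mm; apply: ge_inf; [case: hD|exists m].
have d0 : 0 <= d by apply: lb_le_inf; [case: hD|move=> _ [m _ <-]; exact: hnorm_ge0].
have /choice[u uP] n : exists m, M m /\ hnorm (w - m) < d + n.+1%:R^-1.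
  have n0 : 0 < n.+1%:R^-1 :> R by rewrite invr_gt0.
  by have [_ [m Mm <-] mlt] := inf_adherent n0 hD; exists m.
have cu (e : R) : 0 < e -> exists N, forall m n, (N <= m)%N -> (N <= n)%N ->
    dotnorm (hdot H) (u m - u n) < e.
  move=> e0.
  have e1 : 0 < e ^+ 2 / (8 * d + 4) by rewrite divr_gt0 ?exprn_gt0//; lra.
  have /cvgrPdist_lt/(_ _ e1)[N _ hN] := @cvg_harmonic R.
  exists N => i j Ni Nj; have := hN N (leqnn N).
  rewrite /= sub0r normrN ger0_norm ?invr_ge0// ltr_pdivlMr; last lra.
  set t := N.+1%:R^-1 => te.
  have t0 : 0 < t by rewrite invr_gt0.
  have t1 : t <= 1 by rewrite invf_le1// ler1n.
  have bound k : (N <= k)%N -> hnorm (w - u k) ^+ 2 <= (d + t) ^+ 2.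
    move=> Nk; rewrite ler_sqr ?nnegrE ?addr_ge0 ?hnorm_ge0//; last lra.
    have [_ /ltW/le_trans] := uP k; apply.
    by rewrite lerD2l lef_pV2 ?posrE ?ltr0n// ler_nat.
  (* the midpoint of [u i] and [u j] is in [M], hence at distance at least [d] *)
  have mid : (2 * d) ^+ 2 <= hnorm ((w - u i) + (w - u j)) ^+ 2.
    rewrite ler_sqr ?nnegrE ?mulr_ge0 ?hnorm_ge0//.
    have -> : (w - u i) + (w - u j) =
        (2 : R)%:C *: (w - (2^-1 : R)%:C *: (u i + u j)).
      rewrite scalerBr scalerA -rmorphM divff// scale1r.
      by rewrite rmorph_nat scaler_nat mulr2n opprD addrACA.
    rewrite hnormZ normcR ger0_norm// ler_pM2l//; apply: (d_le).
    rewrite scalerDr; apply: (Mlin); first by case: (uP i).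
    by rewrite -[_ *: u j]addr0; apply: (Mlin) => //; case: (uP j).
  have := parallelogram (w - u i) (w - u j).
  have -> : w - u i - (w - u j) = - (u i - u j) by rewrite opprB addrC addrA subrK opprB.
  rewrite hnorm_opp => E; rewrite -/(hnorm _).
  rewrite -ltr_sqr ?nnegrE ?hnorm_ge0 ?(ltW e0)//.
  have := bound i Ni; have := bound j Nj.
  have : t ^+ 2 <= t by rewrite expr2 ler_piMl// ltW.
  move: mid te; rewrite (_ : (2 * d) ^+ 2 = 4 * d ^+ 2); last by ring.
  rewrite (_ : (d + t) ^+ 2 = d ^+ 2 + 2 * (t * d) + t ^+ 2); last by ring.
  rewrite (_ : t * (8 * d + 4) = 8 * (t * d) + 4 * t); last by ring.
  by lra.
have [l ul] := hcomplete cu.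
have Ml : M l by apply: (Mclosed _ _ _ ul) => n; case: (uP n).
have ld : hnorm (w - l) <= d.
  apply: (hcvg_le (a := fun n => d + n.+1%:R^-1) ul) => [|n]; last by apply: ltW; case: (uP n).
  by rewrite -[X in _ --> X]addr0; apply: cvgD; [exact: cvg_cst|exact: cvg_harmonic].
suff -> : w = l by [].
apply/eqP; rewrite -subr_eq0; apply/eqP; apply: (Mperp) => m Mm.
(* otherwise moving from [l] along [m] would come closer to [w] *)
have [m0|m0] := eqVneq (hnorm m) 0; first by rewrite (hnorm_eq0 m0) linear0l.
have n0 : 0 < hnorm m ^+ 2 by rewrite exprn_gt0 ?lt_def ?m0 ?hnorm_ge0.
set c := << w - l, m >> / (hnorm m ^+ 2)%:C.
have : d <= hnorm ((w - l) - c *: m).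
  by rewrite -addrA -opprD [l + _]addrC; apply: (d_le); exact: Mlin.
rewrite -ler_sqr ?nnegrE ?hnorm_ge0// sqr_hnorm_residual// => h.
have : hnorm (w - l) ^+ 2 <= d ^+ 2 by rewrite ler_sqr ?nnegrE ?hnorm_ge0.
move=> h'; have : normc << w - l, m >> ^+ 2 / hnorm m ^+ 2 <= 0 by lra.
rewrite pmulr_lle0 ?invr_gt0// => h2.
rewrite hdot_conj (_ : << w - l, m >> = 0) ?conjc0//; apply: eq0_normc.
by apply/eqP; rewrite -sqrf_eq0 eq_le h2 sqr_ge0.
Qed.

End hilbert_norm.

(** * Resolvents and lower bounds *)

Section hilbert_convergence.
Context {R : realType} {H : hilbert R}.

Lemma hcvg_linear (u v : nat -> H) x y c : hcvg u x -> hcvg v y ->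
  hcvg (fun n => u n + c *: v n) (x + c *: y).
Proof.
move=> ux vy.
have h : hnorm (u n - x) + normc c * hnorm (v n - y) @[n --> \oo] --> (0 : R).
  rewrite -[X in _ --> X](addr0 0) -[X in _ + X](mulr0 (normc c)).
  by apply: cvgD => //; apply: cvgMr vy.
apply: squeeze_cvgr h; last exact: cvg_cst.
near=> n; rewrite hnorm_ge0 /= -hnormZ.
apply: le_trans (ler_hnormD _ _).
by rewrite scalerBr opprD addrACA.
Unshelve. all: by end_near. Qed.

End hilbert_convergence.

Section operator_norm.
Context {R : realType} {H K : hilbert R}.

(** Rescaling to the unit ball fails for [p.1 = 0] only, where [G] is
    single-valued. *)
Lemma opnorm_leP (G : set (H * K)) (c : R) : 0 <= c ->
  (forall a p, G p -> G (a *: p)) -> (forall y, G (0, y) -> y = 0) ->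
  (opnorm G <= c%:E)%E <-> forall p, G p -> hnorm p.2 <= c * hnorm p.1.
Proof.
move=> c0 GZ G0; split=> [Gc [x y] Gxy /=|Gc]; last first.
  apply: ge_ereal_sup => _ [p [Gp p1] <-]; rewrite lee_fin.
  by apply: le_trans (Gc _ Gp) _; rewrite ler_piMr.
have [x0|x0] := eqVneq (hnorm x) 0.
  move: Gxy; rewrite (hnorm_eq0 x0) => /G0 ->.
  by rewrite !hnorm0 mulr0.
have xp : 0 < hnorm x by rewrite lt_def x0 hnorm_ge0.
pose a : R[i] := ((hnorm x)^-1)%:C.
have na : normc a = (hnorm x)^-1 by rewrite normcR ger0_norm// invr_ge0 ltW.
have : ((hnorm (a *: y))%:E <= c%:E)%E.
  apply: le_trans Gc; apply: ereal_sup_ubound; exists (a *: (x, y)) => //=.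
  by split; [exact: GZ|rewrite hnormZ na mulVf].
by rewrite lee_fin hnormZ na mulrC ler_pdivrMr.
Qed.

End operator_norm.

Section resolvent_bounds.
Context {R : realType} {H : hilbert R}.
Implicit Types (G : set (H * H)) (A : cd_operator H) (z : R[i]) (d : R).

Definition bounded_below G z d : Prop :=
  forall p, G p -> d * hnorm p.1 <= hnorm (p.2 - z *: p.1).

(** The bound on the adjoint replaces the surjectivity of [G - z]; unlike the latter
    it can be checked on a core. *)
Definition resolvent_bound G z d : Prop :=
  bounded_below G z d /\ bounded_below (adjoint G) (conjc z) d.

Lemma cd_scale A c p : op_graph A p -> op_graph A (c *: p).
Proof. by move=> Ap; rewrite -[_ *: p]addr0; apply: op_graph_linear Ap (op_graph0 A). Qed.

Lemma adjoint_scale G c p : adjoint G p -> adjoint G (c *: p).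
Proof.
move=> Gp q Gq; rewrite -[(c *: p).1]/(c *: p.1) -[(c *: p).2]/(c *: p.2).
by rewrite !hdotZr (Gp q Gq).
Qed.

Lemma shift_inverse_linear A z c p q : shift_inverse A z p ->
  shift_inverse A z q -> shift_inverse A z (c *: p + q).
Proof.
case: p q => [w x] [w' x'] Ap Aq; rewrite /shift_inverse /=.
have := op_graph_linear c Ap Aq; congr (op_graph A (_, _)); rewrite /=.
by rewrite !scalerDr !scalerA [z * c]mulrC addrACA.
Qed.

Lemma shift_inverse_scale A z c p :
  shift_inverse A z p -> shift_inverse A z (c *: p).
Proof.
move=> Ap; rewrite -[_ *: p]addr0; apply: shift_inverse_linear => //.
rewrite /shift_inverse /= scaler0 addr0; exact: op_graph0.
Qed.

Lemma bounded_below_shift_inverse G z d p : bounded_below G z d ->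
  shift_inverse G z p -> d * hnorm p.2 <= hnorm p.1.
Proof. by move=> Gd /Gd /=; rewrite addrK. Qed.

(** Boundedness below of [A - z] makes its range closed, and the orthogonal
    complement of the range is the kernel of [A^* - z^*], which is trivial because
    the adjoint is bounded below too. *)
Lemma resolvent_bound_onto A z d : 0 < d -> resolvent_bound A z d ->
  forall w : H, exists x, shift_inverse A z (w, x).
Proof.
move=> d0 [bA bA']; apply: closed_subspace_full.
- by exists 0; rewrite /shift_inverse /= scaler0 addr0; exact: op_graph0.
- move=> c w w' [x Ax] [x' Ax']; exists (c *: x + x').
  exact: (shift_inverse_linear c Ax Ax').
- move=> u w /choice[x Ax] uw.
  have [e e0|l xl] := @hcomplete _ H x.
    have e1 : 0 < d * e / 2 by rewrite divr_gt0// mulr_gt0.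
    have /cvgrPdist_lt/(_ _ e1)[N _ uN] := uw.
    exists N => m n Nm Nn; rewrite -(ltr_pM2l d0).
    have := shift_inverse_linear (-1) (Ax n) (Ax m).
    rewrite !scaleN1r => /(bounded_below_shift_inverse bA) /=.
    rewrite ![- _ + _]addrC => /le_lt_trans; apply.
    rewrite -(subrKA w); apply: le_lt_trans (ler_hnormD _ _) _.
    have := uN _ Nm; have := uN _ Nn.
    rewrite /= !sub0r !normrN !ger0_norm ?hnorm_ge0// (hnorm_sym (u n)).
    by lra.
  exists l; apply: (op_graph_closed (u := x) (v := fun n => u n + z *: x n)) => //.
  exact: hcvg_linear.
- move=> y ranP; apply: hnorm_eq0; apply/eqP; rewrite eq_le hnorm_ge0 andbT.
  rewrite -(ler_pM2l d0) mulr0.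
  have Ay : adjoint A (y, conjc z *: y).
    move=> p Ap /=; apply/eqP; rewrite hdotZr conjcK -hdotZl.
    rewrite -subr_eq0 -linearBl; apply/eqP; apply: ranP; exists p.1.
    by rewrite /shift_inverse /= subrK; case: p Ap.
  by apply: le_trans (bA' _ Ay) _; rewrite subrr hnorm0.
Qed.

(** In the converse direction the bound for the adjoint at [y] comes from
    [|y|^2 = <x, A^* y - z^* y>] with [x] the solution of [(A - z) x = y]. *)
Theorem resolvent_boundP A z d : 0 < d ->
  resolvent_bound A z d <-> ~ spectrum A z /\
    (opnorm (shift_inverse A z) <= (d^-1)%:E)%E.
Proof.
move=> d0; have opP : (forall y, shift_inverse A z (0, y) -> y = 0) ->
    (opnorm (shift_inverse A z) <= (d^-1)%:E)%E <->
    forall p, shift_inverse A z p -> d * hnorm p.2 <= hnorm p.1.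
  move=> S0; rewrite opnorm_leP ?invr_ge0 ?(ltW d0)//; last first.
    by move=> c p; exact: shift_inverse_scale.
  by split=> h p /h; rewrite ler_pdivlMl.
split=> [Ad|[zA Ad]].
  have [bA bA'] := Ad.
  have S0 y : shift_inverse A z (0, y) -> y = 0.
    move=> /(bounded_below_shift_inverse bA) /=; rewrite hnorm0 -(mulr0 d).
    by rewrite ler_pM2l// => y0; apply: hnorm_eq0; apply/eqP; rewrite eq_le y0 hnorm_ge0.
  have Sd : (opnorm (shift_inverse A z) <= (d^-1)%:E)%E.
    by apply/(opP S0) => p; exact: bounded_below_shift_inverse.
  split=> //; apply; split; last exact: le_lt_trans Sd (ltry _).
  move=> w; have [x Ax] := resolvent_bound_onto d0 Ad w.
  exists x; split=> // x' Ax'; apply/eqP; rewrite -subr_eq0; apply/eqP/S0.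
  have := shift_inverse_linear (-1) Ax' Ax.
  by rewrite !scaleN1r -[(_, _) + _]/(- w + w, - x' + x) addNr addrC.
have {}zA : forall w, exists! x, shift_inverse A z (w, x).
  by have /contrapT[] := zA.
have S0 y : shift_inverse A z (0, y) -> y = 0.
  move=> Ay; have [x [_ xu]] := zA 0; rewrite -(xu _ Ay); apply: xu.
  by rewrite /shift_inverse /= scaler0 addr0; exact: op_graph0.
have {}Ad := (opP S0).1 Ad; split=> [p Ap|p A'p].
  by apply: (Ad (p.2 - z *: p.1, p.1)); rewrite /shift_inverse /= subrK; case: p Ap.
have [y0|y0] := eqVneq (hnorm p.1) 0; first by rewrite y0 mulr0 hnorm_ge0.
have yp : 0 < hnorm p.1 by rewrite lt_def y0 hnorm_ge0.
have [x [Ax _]] := zA p.1.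
have E : hdot H p.1 p.1 = hdot H x (p.2 - conjc z *: p.1).
  rewrite linearBr /= -(A'p _ Ax) /= linearDl /= hdotZl hdotZr.
  by rewrite conjcK addrK.
have := cauchy_schwarz x (p.2 - conjc z *: p.1).
rewrite -E hdotxx normcR ger0_norm ?sqr_ge0// => h.
rewrite -(ler_pM2l yp) mulrCA -expr2.
apply: le_trans (ler_wpM2l (ltW d0) h) _.
by rewrite mulrA ler_wpM2r ?hnorm_ge0//; exact: (Ad _ Ax).
Qed.

Lemma spectrumP A z :
  ~ spectrum A z <-> exists2 d, 0 < d & resolvent_bound A z d.
Proof.
split=> [zA|[d d0 /(resolvent_boundP A z d0)[]//]].
have [_] : _ /\ (opnorm (shift_inverse A z) < +oo)%E := contrapT zA.
case E : (opnorm _) => [r| |]// _.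
  exists (`|r| + 1)^-1; first by rewrite invr_gt0 ltr_wpDl.
  apply/resolvent_boundP; first by rewrite invr_gt0 ltr_wpDl.
  split=> //; rewrite invrK E lee_fin.
  by apply: le_trans (ler_norm _) _; rewrite lerDl.
by exists 1 => //; apply/resolvent_boundP => //; rewrite E leNye.
Qed.

Lemma resolvent_normP A z (eps : R) : 0 < eps ->
  ((eps^-1)%:E < resolvent_norm A z)%E <-> ~ resolvent_bound A z eps.
Proof.
move=> e0; rewrite resolvent_boundP// /resolvent_norm.
case: asboolP => zA; first by split=> // _; [case|exact: ltry].
split=> [|h]; first by rewrite ltNge => /negP h [_ /h].
by rewrite ltNge; apply/negP => h'; exact: h.
Qed.

Lemma pseudospectrumP A z (eps : R) : 0 < eps ->
  ~ pseudospectrum eps A z <-> exists2 rho : R, 0 < rho &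
    forall w, normc (w - z) < rho -> resolvent_bound A w eps.
Proof.
move=> e0; rewrite /pseudospectrum /closure /=.
split=> [|[rho rho0 h] /(_ (ball (z : R[i]^o) rho%:C))[]].
- move=> /existsNP[B /not_implyP[/nbhs_ballP[r /= r0 rB] nB]].
  have rE : r = (complex.Re r)%:C by rewrite RRe_real// gtr0_real.
  exists (complex.Re r) => [|w wz]; first by rewrite -ltcR -rE.
  apply: contrapT => /resolvent_normP-/(_ e0) we; apply: nB; exists w; split=> //.
  apply: rB; rewrite -ball_normE /= distrC rE.
  by rewrite -[ltLHS]/(normc (w - z))%:C ltcR.
- by apply: (nbhsx_ballx (z : R[i]^o)); rewrite ltcR.
- move=> w [/resolvent_normP-/(_ e0) we]; rewrite -ball_normE /= distrC.
  by rewrite -[ltLHS]/(normc (w - z))%:C ltcR => /h.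
Qed.

End resolvent_bounds.

(** * Unitary conjugation, orthogonal sums and the two spectral tests *)

Section unitary_transport.
Context {R : realType} {H K : hilbert R} (U : H -> K) (uU : unitary U).
Implicit Types (G : set (H * H)) (A : cd_operator H) (z : R[i]) (d : R).

Lemma unitaryP c x y : U (c *: x + y) = c *: U x + U y.
Proof. by have [lU _ _] := uU; exact: lU. Qed.

Lemma unitary0 : U 0 = 0.
Proof. by have := unitaryP (-1) 0 0; rewrite !scaleN1r !addNr. Qed.

Lemma unitaryZ c x : U (c *: x) = c *: U x.
Proof. by have := unitaryP c x 0; rewrite unitary0 !addr0. Qed.

Lemma unitaryB x y : U (x - y) = U x - U y.
Proof. by have := unitaryP (-1) y x; rewrite !scaleN1r ![- _ + _]addrC. Qed.

Lemma hnorm_unitary x : hnorm (U x) = hnorm x.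
Proof. by have [_ _ dU] := uU; rewrite /hnorm /dotnorm dU. Qed.

Lemma unitary_inj : injective U.
Proof. by have [_ /bij_inj] := uU. Qed.

Lemma unitary_surj y : exists x, U x = y.
Proof. by have [_ [V _ VK] _] := uU; exists (V y). Qed.

Lemma conj_graphE G x y : conj_graph U G (U x, U y) <-> G (x, y).
Proof.
split=> [[[x' y'] Gxy' /= [/unitary_inj <- /unitary_inj <-]]//|Gxy].
by exists (x, y).
Qed.

Lemma conj_graph_ind G (P : K * K -> Prop) :
  (forall x y, G (x, y) -> P (U x, U y)) -> forall p, conj_graph U G p -> P p.
Proof. by move=> GP _ [[x y] Gxy <-]; exact: GP. Qed.

Lemma adjoint_conj_graph G :
  adjoint (conj_graph U G) = conj_graph U (adjoint G).
Proof.
have [_ _ dU] := uU; apply/seteqP; split=> [[y y']|]; last first.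
  apply: conj_graph_ind => y y' Gyy' p; move: p; apply: conj_graph_ind.
  by move=> x x' Gxx'; rewrite /= !dU; exact: (Gyy' _ Gxx').
have [x <-] := unitary_surj y; have [x' <-] := unitary_surj y' => UG.
apply/conj_graphE => -[v v'] Gvv' /=; rewrite -!dU.
by apply: (UG (U v, U v')); apply/conj_graphE.
Qed.

Lemma bounded_below_conj_graph G z d :
  bounded_below (conj_graph U G) z d <-> bounded_below G z d.
Proof.
split=> [bG [x y] Gxy /=|bG].
  rewrite -(hnorm_unitary x) -(hnorm_unitary (y - _)) unitaryB unitaryZ.
  by apply: (bG (U x, U y)); apply/conj_graphE.
apply: conj_graph_ind => x y /bG /=.
by rewrite -unitaryZ -unitaryB !hnorm_unitary.
Qed.

Lemma resolvent_bound_conj_graph G z d :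
  resolvent_bound (conj_graph U G) z d <-> resolvent_bound G z d.
Proof.
by rewrite /resolvent_bound adjoint_conj_graph !bounded_below_conj_graph.
Qed.

End unitary_transport.

Section orthogonal_sum.
Context {R : realType} {H K : hilbert R}.
Implicit Types (G : set (H * H)) (T : set (K * K)) (z : R[i]) (d : R).

Lemma sqr_hnorm_sum (p : hsum H K) :
  hnorm p ^+ 2 = hnorm p.1 ^+ 2 + hnorm p.2 ^+ 2.
Proof.
by apply: complexI; rewrite rmorphD /= -!hdotxx.
Qed.

Lemma adjoint_sum_graph G T : G 0 -> T 0 ->
  adjoint (sum_graph G T) = sum_graph (adjoint G) (adjoint T).
Proof.
move=> G0 T0; apply/seteqP; split=> [[[x y] [x' y']] A|].
  split=> [[u v] Guv|[u v] Tuv] /=.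
    have := A ((u, 0), (v, 0)) (conj Guv T0).
    by rewrite /= /hdot /= /sum_dot /= !linear0l !addr0.
  have := A ((0, u), (0, v)) (conj G0 Tuv).
  by rewrite /= /hdot /= /sum_dot /= !linear0l !add0r.
move=> [[x y] [x' y']] [/= Ax Ay] [[u v] [u' v']] [/= Gu Tv].
by rewrite /hdot /= /sum_dot /= (Ax (u, u') Gu) (Ay (v, v') Tv).
Qed.

Lemma bounded_below_sum_graph G T z d : 0 <= d -> G 0 -> T 0 ->
  bounded_below (sum_graph G T) z d <->
  bounded_below G z d /\ bounded_below T z d.
Proof.
move=> d0 G0 T0.
have nE (p : hsum H K) : hnorm p = Num.sqrt (hnorm p.1 ^+ 2 + hnorm p.2 ^+ 2).
  by rewrite -sqr_hnorm_sum sqrtr_sqr ger0_norm ?hnorm_ge0.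
split=> [b|[bG bT] [[x y] [x' y']] [/= Gx Ty]].
  split=> [[x x'] Gx|[y y'] Ty] /=.
    have := b ((x, 0), (x', 0)) (conj Gx T0).
    rewrite !nE /= scaler0 subr0 !hnorm0 expr0n !addr0 !sqrtr_sqr.
    by rewrite !ger0_norm ?hnorm_ge0.
  have := b ((0, y), (0, y')) (conj G0 Ty).
  rewrite !nE /= scaler0 subr0 !hnorm0 expr0n !add0r !sqrtr_sqr.
  by rewrite !ger0_norm ?hnorm_ge0.
rewrite -ler_sqr ?nnegrE ?mulr_ge0 ?hnorm_ge0// exprMn !sqr_hnorm_sum mulrDr.
rewrite -!exprMn lerD// ler_sqr ?nnegrE ?mulr_ge0 ?hnorm_ge0//.
- exact: (bG (x, x')).
- exact: (bT (y, y')).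
Qed.

Lemma resolvent_bound_sum_graph (A : cd_operator H) (T : cd_operator K) z d :
  0 <= d -> resolvent_bound (sum_graph A T) z d <->
  resolvent_bound A z d /\ resolvent_bound T z d.
Proof.
move=> d0; have A0 := op_graph0 A; have T0 := op_graph0 T.
have adj0 (L : hilbert R) (B : set (L * L)) : adjoint B 0.
  by move=> p _; rewrite !linear0r.
rewrite /resolvent_bound adjoint_sum_graph//.
by rewrite !bounded_below_sum_graph//; tauto.
Qed.

End orthogonal_sum.

Section resolvent_tests.
Context {R : realType}.

(** The common form of the two spectral questions at a point.  For the spectrum the
    point is kept and the level tends to 0; for the pseudospectrum the level is
    [eps] and a neighbourhood of the point shrinks. *)
Record resolvent_test := ResolventTest {
  offsets : nat -> set R[i];
  level : nat -> R;
  level_gt0 : forall m, 0 < level m;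
  offsets_anti : forall m n, (m <= n)%N -> offsets n `<=` offsets m;
  level_anti : forall m n, (m <= n)%N -> level n <= level m }.

Variable t : resolvent_test.

Definition passes_at (H : hilbert R) (G : set (H * H)) (z : R[i]) (m : nat) : Prop :=
  forall h, offsets t m h -> resolvent_bound G (z + h) (level t m).

Definition passes (H : hilbert R) (G : set (H * H)) (z : R[i]) : Prop :=
  exists m, passes_at G z m.

Lemma resolvent_bound_le (H : hilbert R) (G : set (H * H)) z (d d' : R) :
  d <= d' -> resolvent_bound G z d' -> resolvent_bound G z d.
Proof.
by move=> dd [b b']; split=> p Gp; [move: (b _ Gp)|move: (b' _ Gp)];
  apply: le_trans; rewrite ler_wpM2r ?hnorm_ge0.
Qed.

Lemma passes_at_le (H : hilbert R) (G : set (H * H)) z m n :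
  (m <= n)%N -> passes_at G z m -> passes_at G z n.
Proof.
move=> mn pm h hn; apply: resolvent_bound_le (level_anti t mn) _.
by apply: pm; exact: offsets_anti hn.
Qed.

Lemma passes_conj_graph (H K : hilbert R) (U : H -> K) (G : set (H * H)) z :
  unitary U -> passes (conj_graph U G) z <-> passes G z.
Proof.
move=> uU; split=> -[m pm]; exists m => h /pm;
  by rewrite (resolvent_bound_conj_graph uU).
Qed.

Lemma passes_sum_graph (H K : hilbert R) (A : cd_operator H) (T : cd_operator K) z :
  passes (sum_graph A T) z <-> passes A z /\ passes T z.
Proof.
split=> [[m pm]|[[m pm] [n pn]]].
  by split; exists m => h /pm /(resolvent_bound_sum_graph _ _ _ (ltW (level_gt0 t m))) [].
exists (maxn m n) => h hmn.
apply/(resolvent_bound_sum_graph _ _ _ (ltW (level_gt0 t _))).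
by split; [exact: (passes_at_le (leq_maxl m n) pm)
          |exact: (passes_at_le (leq_maxr m n) pn)].
Qed.

End resolvent_tests.

Definition decided_by (R : realType) (t : @resolvent_test R)
    (S : forall H : hilbert R, set (H * H) -> set R[i]) : Prop :=
  forall (H : hilbert R) (A : cd_operator H) z, ~ S H A z <-> passes t A z.

Section tests_of_spectra.
Context {R : realType}.

Fact spectrum_level_gt0 (m : nat) : 0 < m.+1%:R^-1 :> R.
Proof. by rewrite invr_gt0. Qed.

Fact spectrum_level_anti (m n : nat) :
  (m <= n)%N -> n.+1%:R^-1 <= m.+1%:R^-1 :> R.
Proof. by move=> mn; rewrite lef_pV2 ?posrE ?ltr0n// ler_nat. Qed.

Definition spectrum_test : @resolvent_test R :=
  @ResolventTest R (fun=> [set 0]) (fun m => m.+1%:R^-1)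
    spectrum_level_gt0 (fun m n _ => @subset_refl _ _) spectrum_level_anti.

Fact pseudospectrum_offsets_anti (m n : nat) : (m <= n)%N ->
  [set h : R[i] | normc h < n.+1%:R^-1] `<=` [set h | normc h < m.+1%:R^-1].
Proof. by move=> /spectrum_level_anti mn h /lt_le_trans; apply. Qed.

Definition pseudospectrum_test (eps : R) (eps0 : 0 < eps) : @resolvent_test R :=
  @ResolventTest R (fun m => [set h | normc h < m.+1%:R^-1]) (fun=> eps)
    (fun=> eps0) pseudospectrum_offsets_anti (fun m n _ => lexx eps).

Lemma exists_harmonic_lt (e : R) : 0 < e -> exists m, m.+1%:R^-1 < e.
Proof.
move=> e0; have /cvgrPdist_lt/(_ _ e0)[N _ hN] := @cvg_harmonic R.
exists N; have := hN N (leqnn N).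
by rewrite /= sub0r normrN ger0_norm ?invr_ge0.
Qed.

Lemma spectrum_decided : decided_by spectrum_test (@spectrum R).
Proof.
move=> H A z; rewrite spectrumP; split=> [[d d0 bA]|[m /(_ 0 erefl)]].
  have [m md] := exists_harmonic_lt d0; exists m => h /= ->; rewrite addr0.
  exact: resolvent_bound_le (ltW md) bA.
by rewrite addr0; exists m.+1%:R^-1.
Qed.

Lemma pseudospectrum_decided (eps : R) (eps0 : 0 < eps) :
  decided_by (pseudospectrum_test eps0) (@pseudospectrum R eps).
Proof.
move=> H A z; rewrite (pseudospectrumP _ _ eps0).
split=> [[rho /exists_harmonic_lt[m mr] bA]|[m bA]].
  exists m => h /= hm; apply: bA.
  by rewrite addrC addKr; exact: lt_trans mr.
exists m.+1%:R^-1 => // w wz.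
by have := bA (w - z) wz; rewrite addrC subrK.
Qed.

End tests_of_spectra.

(** * Diagonal operators *)

Section ell2_vectors.
Context {R : realType} {I : choiceType}.
Implicit Types x y : l2 R I.

Lemma hnorm_delta (i : I) : hnorm (l2_delta i : l2 R I) = 1.
Proof.
have := hdotxx (l2_delta i : l2 R I); rewrite hdot_delta /= eqxx => /complexI/esym/eqP.
by rewrite sqrp_eq1 ?hnorm_ge0// => /eqP.
Qed.

Lemma hnorm_l2_le x y :
  (forall i, normc (x i) <= normc (y i)) -> hnorm x <= hnorm y.
Proof.
move=> xy; rewrite /hnorm !ell2_normE ler_wsqrtr// fine_le//.
- by apply: ge0_esum_fin_num => [i|]; [rewrite sqr_ge0|exact: ell2P].
- by apply: ge0_esum_fin_num => [i|]; [rewrite sqr_ge0|exact: ell2P].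
- apply: le_esum => i _; rewrite lee_fin.
  by rewrite ler_sqr ?nnegrE ?normc_ge0.
Qed.

Lemma hdot_deltal i y : hdot (l2 R I) (l2_delta i) y = conjc (y i).
Proof. by rewrite hdot_conj hdot_delta. Qed.

Lemma span_sum_delta n (c : 'I_n -> R[i]) (s : 'I_n -> I) :
  Defs.span (range l2_delta) (\sum_(k < n) c k *: l2_delta (s k) : l2 R I).
Proof. by exists n, c, (fun k => l2_delta (s k)); split=> // k; exists (s k). Qed.

End ell2_vectors.

Section truncation.
Context {R : realType}.
Implicit Types x : l2 R nat.

Lemma projE n x i : Defs.proj n x i = if (i < n)%N then x i else 0.
Proof.
rewrite /Defs.proj -(big_mkord xpredT
  (fun k => hdot (l2 R nat) x (l2_delta k) *: (l2_delta k : l2 R nat))).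
by rewrite l2_sum_delta ?iota_uniq// mem_index_iota /= hdot_delta.
Qed.

Lemma proj_span n x : Defs.span (range l2_delta) (Defs.proj n x).
Proof. exact: span_sum_delta. Qed.

Lemma proj_dense x (e : R) : 0 < e ->
  exists N, forall n, (N <= n)%N -> hnorm (x - Defs.proj n x) < e.
Proof.
(* [s] may repeat indices, but outside of [s] the sum has no coordinate at all *)
move=> /(@l2_finite_dense _ _ x)[s sx]; exists (\max_(k <- s) k).+1 => n Nn.
apply: le_lt_trans sx; apply: hnorm_l2_le => i; rewrite !ell2_BE projE.
case: ltnP => ni; first by rewrite subrr normc0 normc_ge0.
suff -> : (\sum_(k <- s) x k *: l2_delta k : l2 R nat) i = 0 by [].
have : i \notin s.
  apply: contraTN (leq_trans Nn ni) => si; rewrite -leqNgt.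
  exact: (@leq_bigmax_seq _ s xpredT id i si isT).
elim: s {Nn} => [|k s IH]; first by rewrite big_nil.
rewrite inE negb_or => /andP[ik /IH E]; rewrite big_cons ell2_DE E addr0.
by rewrite ell2_ZE /= (negbTE ik) mulr0.
Qed.

End truncation.

Section diagonal_operators.
Context {R : realType}.
Implicit Types (a : nat -> R[i]) (z : R[i]) (d : R).

Lemma diag_graph_delta a j : diag_graph a (l2_delta j, a j *: l2_delta j).
Proof.
move=> i; rewrite -[LHS]/(a j * (i == j)%:R) -[RHS]/(a i * (i == j)%:R).
by case: (eqVneq i j) => [->//|_]; rewrite !mulr0.
Qed.

Lemma adjoint_diag_graph a :
  adjoint (diag_graph a) = diag_graph (fun j => conjc (a j)).
Proof.
apply/seteqP; split=> [[y y'] A j|[y y'] A [x x'] Ax].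
  have : hdot (l2 R nat) (a j *: (l2_delta j : l2 R nat)) y =
      hdot (l2 R nat) (l2_delta j) y' := A _ (diag_graph_delta a j).
  rewrite hdotZl !hdot_deltal.
  by move=> /(congr1 (@conjc _)); rewrite rmorphM /= !conjcK.
rewrite -[LHS]/(csum (fun j => x' j * conjc (y j))).
rewrite -[RHS]/(csum (fun j => x j * conjc (y' j))); congr csum.
apply/funext => j; rewrite (Ax j) (A j) /= rmorphM /= conjcK.
by rewrite mulrCA mulrA.
Qed.

Lemma bounded_below_diag_graph a z d : 0 <= d ->
  bounded_below (diag_graph a) z d <-> forall j, d <= normc (a j - z).
Proof.
move=> d0; split=> [b j|da [x y] Axy /=].
  have := b _ (diag_graph_delta a j).
  by rewrite /= -scalerBl hnormZ hnorm_delta !mulr1.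
rewrite -[d]ger0_norm// -normcR -hnormZ; apply: hnorm_l2_le => j.
rewrite ell2_BE !ell2_ZE (Axy j) /= -mulrBl !normcM normcR ger0_norm//.
by rewrite ler_wpM2r ?normc_ge0.
Qed.

Lemma resolvent_bound_diag_graph a z d : 0 <= d ->
  resolvent_bound (diag_graph a) z d <-> forall j, d <= normc (a j - z).
Proof.
move=> d0; rewrite /resolvent_bound adjoint_diag_graph !bounded_below_diag_graph//.
split=> [[]//|da]; split=> // j.
by rewrite -rmorphB normc_conj.
Qed.

Lemma span_core_diag_graph a : is_core (diag_graph a) (Defs.span (range l2_delta)).
Proof.
split=> [_ [n [c [s [es ->]]]]|[x y] Axy e e0].
  have /choice[f fP] k : exists j, l2_delta j = s k by have [j] := es k; exists j.
  exists (\sum_(k < n) c k *: (l2_delta (f k) : l2 R nat),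
          \sum_(k < n) c k *: (a (f k) *: (l2_delta (f k) : l2 R nat))); last first.
    by apply: eq_bigr => k _; rewrite fP.
  elim/big_ind2 : _ => [|x1 x2 y1 y2 d1 d2|k _]; first exact: diag_graph0.
    by have := diag_graph_linear 1 d1 d2; rewrite pair_lin !scale1r.
  have := diag_graph_linear (c k) (diag_graph_delta a (f k)) (diag_graph0 a).
  by rewrite pair_lin !addr0.
have [N xN] := proj_dense x e0; have [M yM] := proj_dense y e0.
exists (Defs.proj (maxn N M) x, Defs.proj (maxn N M) y); split=> /=.
- by move=> j; rewrite /= !projE; case: ifP; rewrite ?mulr0// (Axy j).
- exact: proj_span.
- exact: xN (leq_maxl _ _).
- exact: yM (leq_maxr _ _).
Qed.

Definition diag_margin (t : @resolvent_test R) (e0 : R) : Prop :=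
  forall a z, passes t (diag_graph a) z <->
    exists2 rho : R, 0 < rho & forall j, e0 + rho <= normc (a j - z).

Lemma spectrum_margin : diag_margin spectrum_test 0.
Proof.
move=> a z; split=> [[m /(_ 0 erefl)]|[rho /exists_harmonic_lt[m mr] ar]].
  rewrite addr0 resolvent_bound_diag_graph ?(ltW (level_gt0 _ _))// => ma.
  by exists m.+1%:R^-1 => // j; rewrite add0r.
exists m => h /= ->; rewrite addr0 resolvent_bound_diag_graph// => j.
by apply: le_trans (ltW mr) _; have := ar j; rewrite add0r.
Qed.

Lemma pseudospectrum_margin (eps : R) (eps0 : 0 < eps) :
  diag_margin (pseudospectrum_test eps0) eps.
Proof.
move=> a z; split=> [[m am]|[rho /exists_harmonic_lt[m mr] ar]]; last first.
  exists m => h /= hm; rewrite resolvent_bound_diag_graph ?ltW// => j.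
  have := ler_normcD (a j - (z + h)) h; rewrite opprD addrA subrK.
  have := ar j; have := lt_trans hm mr; lra.
have r0 : 0 < m.+1%:R^-1 :> R by rewrite invr_gt0.
exists m.+1%:R^-1 => // j; set rho := m.+1%:R^-1; rewrite leNgt; apply/negP => adj.
have rho0 : 0 < rho := r0; have er0 : 0 < eps + rho by lra.
(* the point dividing the segment from [z] to [a j] in the ratio rho : eps *)
pose s : R := rho / (eps + rho).
have s0 : 0 <= s by rewrite divr_ge0// ltW.
have sE : 1 - s = eps / (eps + rho) by rewrite /s; field; rewrite gt_eqF.
have s1 : 0 <= 1 - s by rewrite sE divr_ge0// ltW.
have /am : [set h | normc h < rho] (s%:C * (a j - z)).
  rewrite /= normcM normcR ger0_norm// /s mulrAC -mulrA gtr_pMr//.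
  by rewrite ltr_pdivrMr ?mul1r.
rewrite /= resolvent_bound_diag_graph ?ltW// => /(_ j).
have -> : a j - (z + s%:C * (a j - z)) = (1 - s)%:C * (a j - z).
  by rewrite rmorphB rmorph1; ring.
rewrite normcM normcR ger0_norm// sE leNgt mulrAC -mulrA gtr_pMr//.
by rewrite ltr_pdivrMr// mul1r adj.
Qed.

End diagonal_operators.

(** * Towers of algorithms and their transfer along reductions *)

Section discrete_limits.
Context {R : realType}.

Lemma cvg_discreteP (T : Type) (h : nat -> T) (y : T) :
  discrete_dist (h n) y @[n --> \oo] --> (0 : R) <->
  exists N, forall n, (N <= n)%N -> h n = y.
Proof.
split=> [/cvgrPdist_lt/(_ 1 ltr01)[N _ hN]|[N hN]].
  exists N => n /hN /=; rewrite sub0r normrN /discrete_dist.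
  by case: asboolP => // _; rewrite normr1 ltxx.
apply/cvgrPdist_lt => e e0; exists N => // n /hN ->.
by rewrite /= /discrete_dist asboolT//= subrr normr0.
Qed.

Lemma cvg_decreasing_bool (b : nat -> bool) : (forall n, b n.+1 -> b n) ->
  discrete_dist (b n) `[< forall n, b n >] @[n --> \oo] --> (0 : R).
Proof.
move=> bS; apply/cvg_discreteP.
have [b1|/existsNP[N bN]] := pselect (forall n, b n).
  by exists 0%N => n _; rewrite asboolT//; exact: b1.
exists N => n Nn; rewrite asboolF; last by move=> /(_ N).
apply/negP => bn; apply: bN; elim: n Nn bn => [|n IH].
  by rewrite leqn0 => /eqP ->.
rewrite leq_eqVlt => /predU1P[->//|]; rewrite ltnS => Nn /bS; exact: IH.
Qed.

Lemma cvg_increasing_bool (b : nat -> bool) : (forall n, b n -> b n.+1) ->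
  discrete_dist (b n) `[< exists n, b n >] @[n --> \oo] --> (0 : R).
Proof.
move=> bS; apply/cvg_discreteP.
have [[N bN]|b0] := pselect (exists n, b n); last first.
  exists 0%N => n _; rewrite asboolF//; apply/negP => bn; apply: b0.
  by exists n.
exists N => n Nn; rewrite asboolT; last by exists N.
elim: n Nn => [|n IH]; first by rewrite leqn0 => /eqP <-.
by rewrite leq_eqVlt => /predU1P[<-//|]; rewrite ltnS => /IH/bS.
Qed.

End discrete_limits.

Section towers.
Context {R : realType}.
Implicit Types P : sci_problem R.

Lemma has_towerS P k : has_tower P k -> has_tower P k.+1.
Proof.
move=> [G GP]; exists (fun=> G) => A; exists (fun=> sci_target A); split=> //.
by rewrite (_ : sci_dist _ _ = 0); [exact: cvg_cst|exact/sci_dist_eq0].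
Qed.

Lemma has_tower_le P k l : (k <= l)%N -> has_tower P k -> has_tower P l.
Proof.
move=> /subnK <-; elim: (l - k)%N => [//|n IH] /IH; exact: has_towerS.
Qed.

Lemma SCI_G_eq P k : has_tower P k.+1 -> ~ has_tower P k ->
  SCI_G P = k.+1%:R%:E.
Proof.
move=> Pk Pk'; apply/eqP; rewrite eq_le; apply/andP; split.
  by apply: ereal_inf_lbound; exists k.+1.
apply: le_ereal_inf_tmp => _ [l Pl <-]; rewrite lee_fin ler_nat ltnNge.
by apply/negP => /has_tower_le/(_ Pl).
Qed.

End towers.

Section problems.
Context {R : realType} {Gr : cgraph} {J : set R}.
Variables (r : readout J) (code : fset_coding (vertex Gr)).
Local Notation problem := (@gproblem R Gr J).
Local Notation input := (@input R Gr J).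
Local Notation queries S := (@gp_interface R Gr J S).

(** The problems on spectra and on pseudospectra are those for [S = spectrum] and
    [S = pseudospectrum eps]. *)
Definition spectral_problem (S : forall H : hilbert R, set (H * H) -> set R[i])
    (rho : rep) : problem :=
  GProblem (@misses_separating R Gr J r code S rho).

Lemma missesE (S : forall H : hilbert R, set (H * H) -> set R[i])
    (t : resolvent_test) rho (x : input rho) z :
  decided_by t S -> sval x.2 = [set z] ->
  misses S x <-> passes t (op_graph (rep_op x.1)) z.
Proof.
move=> tS xz; rewrite -tS /misses xz; split=> [/asboolP Sz zS|nS].
  by have : [set: R[i]] z := I; rewrite -(setC0) -Sz => /(_ (conj zS erefl)).
by apply/asboolP; rewrite -subset0 => w [Sw /= wz]; apply: nS; rewrite -wz.
Qed.

Definition reads (S : problem) (lam : input (gp_rep S) -> R[i]) : Prop :=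
  exists F : set (input (gp_rep S) -> R[i]),
    [/\ finite_set F, F `<=` queries S &
        forall x y, (forall f, F f -> f x = f y) -> lam x = lam y].

(** As the decoding of the query values is an arbitrary map, only the set of the
    queries matters. *)
Lemma readsP (S P : problem) (E : input (gp_rep S) -> input (gp_rep P))
    (lam : input (gp_rep P) -> R[i]) :
  (exists m (g : 'I_m -> input (gp_rep S) -> R[i]) (theta : ('I_m -> R[i]) -> R[i]),
    (forall i, queries S (g i)) /\
    forall x, lam (E x) = theta (fun i => g i x)) <->
  reads (lam \o E).
Proof.
split=> [[m [g [theta [gS gE]]]]|[F [fF FS FE]]].
  exists (range g); split=> [|_ [i _ <-]//|x y xy /=].
    exact/finite_image/finite_finset.
  by rewrite !gE; congr theta; apply/funext => i; apply: xy; exists i.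
have [m /card_set_bijP[num [numF num_inj num_surj]]] := (finite_setP F).1 fF.
have /choice[g gP] (i : 'I_m) : exists f, F f /\ num f = i.
  by have [f Ff fi] := num_surj i (ltn_ord i); exists f.
exists m, g, (fun v => xget 0 [set c | exists x,
  (fun i : 'I_m => g i x) = v /\ lam (E x) = c]); split=> [i|x].
  by apply: FS; case: (gP i).
case: xgetP => [_ -> [y [yx <-]]|/(_ (lam (E x)))[]]; last by exists x.
apply: FE => f Ff; have im : (num f < m)%N := numF f Ff.
have /(congr1 (fun h => h (Ordinal im))) := yx.
have [Fg numg] := gP (Ordinal im).
by rewrite (num_inj _ _ (mem_set Fg) (mem_set Ff) numg).
Qed.


Variables (eps : R) (CH : geometric_structure Gr J eps).

Lemma le_geomP (S P : problem) : le_geom CH S P <->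
  exists (E : input (gp_rep S) -> input (gp_rep P)) (D : bool -> bool),
    [/\ encoding CH E, forall x, D (gp_target (E x)) = gp_target x &
        forall lam, queries P lam -> reads (lam \o E)].
Proof.
split=> [[E [D [EE _ DE lamE]]]|[E [D [EE DE lamE]]]]; exists E, D; split=> //.
- by move=> lam /lamE h; exact: ((readsP E lam).1 h).
- by apply/continuousP => A _; exact: discrete_open.
- by move=> lam /lamE h; exact: ((readsP E lam).2 h).
Qed.

(** A general algorithm for [P] runs on the encoded instance; its queries are
    replaced by the finitely many queries that determine them. *)
Lemma pull_algorithm (S P : problem) (E : input (gp_rep S) -> input (gp_rep P))
    (D : bool -> bool) (G : general_algorithm (gp_sci P)) :
  (forall lam, queries P lam -> reads (lam \o E)) ->
  exists G' : general_algorithm (gp_sci S), forall x, G' x = D (G (E x)).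
Proof.
move=> lamE.
have /choice[F FP] lam : exists F : set (input (gp_rep S) -> R[i]),
    queries P lam -> [/\ finite_set F, F `<=` queries S &
      forall x y, (forall f, F f -> f x = f y) -> lam (E x) = lam (E y)].
  have [/lamE[F FP]|nl] := pselect (queries P lam); first by exists F.
  by exists set0.
have FQ x lam : alg_query G (E x) lam -> _ := fun h => FP lam (alg_query_eval h).
pose Q x := \bigcup_(lam in alg_query G (E x)) F lam.
have Qeval x : Q x `<=` queries S.
  by move=> f [lam /FQ[_ FS _]]; exact: FS.
have Qfin x : finite_set (Q x).
  by apply: bigcup_finite => [|lam /FQ[]//]; exact: alg_query_finite.
have Qcons x y : (forall f, Q x f -> f y = f x) ->
    D (G (E y)) = D (G (E x)) /\ Q y = Q x.
  move=> xy; have [|-> GQ] := @alg_consistent _ _ G (E x) (E y).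
    move=> lam lamG; have [_ _ h] := FQ _ _ lamG.
    by apply: h => f Ff; apply: xy; exists lam.
  by rewrite /Q GQ.
by exists (@GeneralAlgorithm _ (gp_sci S) (fun x => D (G (E x))) Q Qeval Qfin Qcons).
Qed.

Lemma has_tower_le_geom (S P : problem) k :
  le_geom CH S P -> has_tower (gp_sci P) k -> has_tower (gp_sci S) k.
Proof.
move=> /le_geomP[E [D [_ DE lamE]]] [G GP].
suff [G' G'P] : exists G' : alg_family (gp_sci S) k, forall x y,
    @iterated_limit _ (gp_sci P) (E x) k G y ->
    @iterated_limit _ (gp_sci S) x k G' (D y).
  by exists G' => x; have := G'P x _ (GP (E x)); rewrite /= DE.
elim: k G {GP} => [|k IH] G.
  have [G' G'E] := pull_algorithm D G lamE.
  by exists G' => x y /= <-; exact: G'E.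
have /choice[G' G'P] n := IH (G n).
exists G' => x y [h [hG /cvg_discreteP[N hN]]]; exists (D \o h); split=> [n|].
  exact/G'P/hG.
by apply/cvg_discreteP; exists N => n /hN /= ->.
Qed.

End problems.

(** * No tower of height 1 for diagonal operators *)

Section lower_bound.

(** Sequences are built block by block: while [s] stays bounded, [P s n] holds for
    some large [n], and this only depends on an initial segment of [s]; freeze
    that segment and raise the bound on the rest.  The limit sequence is unbounded,
    but inherits [P s n] for infinitely many [n]. *)
Lemma bounded_approximation (P : (nat -> nat) -> nat -> bool) :
  (forall s n, exists N, forall s', (forall j, (j < N)%N -> s' j = s j) ->
    P s' n = P s n) ->
  (forall s k, (forall j, s j <= k)%N -> exists N, forall n, (N <= n)%N -> P s n) ->
  exists s, (forall k, exists j, k <= s j)%N /\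
    forall m, exists2 n, (m <= n)%N & P s n.
Proof.
move=> Ploc Pbnd.
(* a state: the current sequence, its bound, the frozen length, and an index n *)
pose state := ((nat -> nat) * nat * nat * nat)%type.
pose seq_ (x : state) := x.1.1.1; pose bound (x : state) := x.1.1.2.
pose len (x : state) := x.1.2; pose idx (x : state) := x.2.
pose good x := (forall j, seq_ x j <= bound x)%N /\
  forall s', (forall j, (j < len x)%N -> s' j = seq_ x j) -> P s' (idx x).
pose next x y := [/\ bound y = (bound x).+1, (len x < len y)%N, (idx x < idx y)%N,
  (forall j, (j < len x)%N -> seq_ y j = seq_ x j) &
  seq_ y (len x) = bound y].
have extend s k N0 n0 : (forall j, s j <= k)%N -> exists N n,
    [/\ (N0 <= N)%N, (n0 <= n)%N & forall s', (forall j, (j < N)%N -> s' j = s j) -> P s' n].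
  move=> sk; have [n1 Pn] := Pbnd s k sk.
  have [N PN] := Ploc s (maxn n0 n1).
  exists (maxn N0 N), (maxn n0 n1); split; rewrite ?leq_maxl// => s' s's.
  rewrite PN ?Pn ?leq_maxr// => j jN; apply: s's.
  by rewrite (leq_trans jN) ?leq_maxr.
have /choice[step stepP] x : exists y, good x -> good y /\ next x y.
  have [gx|ngx] := pselect (good x); last by exists x => /ngx.
  pose s j := if (j < len x)%N then seq_ x j else (bound x).+1.
  have sk j : (s j <= (bound x).+1)%N.
    by rewrite /s; case: ifP => // _; rewrite (leq_trans (gx.1 j)).
  have [N [n [N0 n0 PN]]] := extend s _ (len x).+1 (idx x).+1 sk.
  exists (s, (bound x).+1, N, n) => _; split=> //; split=> //.
    by move=> j jx; rewrite /seq_ /= /s jx.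
  by rewrite /seq_ /= /s ltnn.
have [N [n [_ _ PN]]] := extend (fun=> 0%N) 0%N 0%N 0%N (fun=> leqnn 0).
pose x i : state := iter i step (fun=> 0%N, 0%N, N, n).
have xS i : good (x i) -> good (x i.+1) /\ next (x i) (x i.+1) := @stepP (x i).
have gx i : good (x i).
  elim: i => [|i IH]; last by case: (xS i IH).
  by split.
have nx i : next (x i) (x i.+1) by case: (xS i (gx i)).
have bx i : bound (x i) = i.
  by elim: i => // i IH; case: (nx i) => ->; rewrite IH.
have lx i : (i <= len (x i))%N.
  by elim: i => // i IH; case: (nx i) => _ h _ _ _; exact: leq_ltn_trans IH h.
have ix i : (i <= idx (x i))%N.
  by elim: i => // i IH; case: (nx i) => _ _ h _ _; exact: leq_ltn_trans IH h.
have stable i d j : (j < len (x i))%N -> seq_ (x (d + i)%N) j = seq_ (x i) j.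
  move=> ji; suff [] : seq_ (x (d + i)%N) j = seq_ (x i) j /\ (j < len (x (d + i)%N))%N by [].
  elim: d => // d [IH jd]; case: (nx (d + i)%N) => _ h _ E _; split.
    by rewrite addSn E.
  by rewrite addSn (ltn_trans jd).
pose s j := seq_ (x j.+1) j.
have sE i j : (j < len (x i))%N -> s j = seq_ (x i) j.
  move=> ji; have [h|h] := leqP i j.+1.
    by rewrite /s -(subnK h) stable.
  by rewrite -(subnK (ltnW h)) stable// lx.
exists s; split=> [k|m].
  case: (nx k) => Eb lt _ _ El; exists (len (x k)).
  by rewrite (sE k.+1)// El bx.
exists (idx (x m)); first exact: ix.
by have [_] := gx m; apply=> j; exact: sE.
Qed.

Lemma finite_set_bounded (T : Type) (A : set T) (P : T -> nat -> Prop) :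
  finite_set A -> (forall f m n, (m <= n)%N -> P f m -> P f n) ->
  (forall f, A f -> exists N, P f N) -> exists N, forall f, A f -> P f N.
Proof.
move=> fA Pmono AP.
have /choice[N NP] f : exists N, A f -> P f N.
  by have [/AP[N]|nA] := pselect (A f); [exists N|exists 0%N].
have /finite_fsetP[X XE] := finite_image N fA.
exists (\max_(k <- X) k) => f Af; apply: Pmono (NP f Af).
have NX : N f \in X by have : [set` X] (N f) by rewrite -XE; exists f.
exact: (@leq_bigmax_seq _ _ xpredT id (N f) NX isT).
Qed.

Context {R : realType} {Gr : cgraph} {J : set R}.
Variables (r : readout J) (code : fset_coding (vertex Gr)).

(** The diagonal entries run through the points at distance [e0 + 1/(k+1)] from
    the window.  While the levels [k] stay bounded the answer is 1, along the
    unbounded sequence of levels of [bounded_approximation] it is 0, yet the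
    algorithms output 1 infinitely often. *)
Theorem diag_not_height1 (S : forall H : hilbert R, set (H * H) -> set R[i])
    (t : resolvent_test) (e0 : R) :
  decided_by t S -> diag_margin t e0 -> 0 <= e0 -> J !=set0 ->
  ~ has_tower (gp_sci (spectral_problem r code S Diag)) 1.
Proof.
move=> tS te0 e00 [z0 Jz0] [G GP]; pose z : R[i] := z0%:C.
have zJ : embed J z by exists z0.
pose K : window J := exist _ [set z] (ex_intro2 _ _ z zJ erefl).
pose b k : R[i] := z + (e0 + k.+1%:R^-1)%:C.
have bz k : normc (b k - z) = e0 + k.+1%:R^-1.
  by rewrite /b addrC addKr normcR ger0_norm// addr_ge0// invr_ge0.
pose x (s : nat -> nat) : input Gr J Diag := (b \o s, K).
have xE s : misses S (x s) <->
    exists2 rho : R, 0 < rho & forall j, rho <= (s j).+1%:R^-1.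
  rewrite (missesE (x := x s) (z := z) tS erefl) (te0 (b \o s) z).
  by split=> -[rho rho0 h]; exists rho => // j; move: (h j);
    rewrite [(b \o s) j]/(b (s j)) bz lerD2l.
have settle s : exists N, forall n, (N <= n)%N -> G n (x s) = misses S (x s).
  have [h [Gh /cvg_discreteP[N hN]]] := GP (x s).
  by exists N => n /hN hn; exact: etrans (Gh n) hn.
have [|s k sk|s [s_unb sP]] := @bounded_approximation (fun s n => G n (x s)).
- move=> s n; have [|f p q pq fp s' s's|f|N NP] := @finite_set_bounded _
    (alg_query (G n) (x s))
    (fun f N => forall s', (forall j, (j < N)%N -> s' j = s j) -> f (x s') = f (x s)).
  + exact: alg_query_finite.
  + by apply: fp => j jp; apply: s's; exact: leq_trans pq.
  + move=> /alg_query_eval[[k _ <-]|[j _ <-]]; first by exists 0%N.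
    by exists j.+1 => s' /(_ j (leqnn _)) /= ->.
  exists N => s' s's; suff [] : G n (x s') = G n (x s) /\
    alg_query (G n) (x s') = alg_query (G n) (x s) by [].
  by apply: alg_consistent => f /NP; apply.
- have [N NP] := settle s; exists N => n /NP ->.
  apply/xE; exists k.+1%:R^-1; first by rewrite invr_gt0.
  by move=> j; rewrite lef_pV2 ?posrE ?ltr0n// ler_nat ltnS.
- have [N NP] := settle s; have [n Nn] := sP N; rewrite NP//.
  move=> /xE[rho /exists_harmonic_lt[k kr] rs]; have [j kj] := s_unb k.
  have sk : (s j).+1%:R^-1 <= k.+1%:R^-1 :> R.
    by rewrite lef_pV2 ?posrE ?ltr0n// ler_nat ltnS.
  by have := le_lt_trans (le_trans (rs j) sk) kr; rewrite ltxx.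
Qed.

End lower_bound.

(** * A tower of height 2 from finite readings *)

Section upper_bound.
Context {R : realType} {Gr : cgraph} {J : set R}.
Variables (r : readout J) (code : fset_coding (vertex Gr)).
Local Notation input := (@input R Gr J).
Local Notation graph x := (op_graph (rep_op x.1)).

Definition agree_on (T : Type) (Q : set (T -> R[i])) (x y : T) : Prop :=
  forall f, Q f -> f y = f x.

Definition close_on (H : hilbert R) (V : set H) (eta : R) (G G' : set (H * H)) :=
  forall u v, V u -> G (u, v) ->
    exists2 v', G' (u, v') & hnorm (v' - v) <= eta * hnorm u.

(** Finitely many queries, growing with the stage [n], which locate the point of
    the window and the action of the operator and of its adjoint on the subspace
    [stage_space n], with an error [stage_error n] tending to 0. *)
Record local_reading (rho : rep) := LocalReading {
  stage_space : nat -> set (rep_space Gr rho);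
  stage_query : nat -> input rho -> set (input rho -> R[i]);
  stage_error : nat -> input rho -> R;
  stage_spaceS : forall n, stage_space n `<=` stage_space n.+1;
  stage_space_span : forall u, Defs.span (range (rep_basis Gr rho)) u ->
    exists n, stage_space n u;
  stage_query_eval : forall n x, stage_query n x `<=` interface r code (rho := rho);
  stage_query_finite : forall n x, finite_set (stage_query n x);
  stage_queryS : forall n x, stage_query n x `<=` stage_query n.+1 x;
  stage_query_agree : forall n x y, agree_on (stage_query n x) x y ->
    stage_query n y = stage_query n x;
  stage_error0 : forall x, stage_error n x @[n --> \oo] --> (0 : R);
  stage_core : forall x : input rho,
    is_core (graph x) (Defs.span (range (rep_basis Gr rho)));
  stage_core_adj : forall x : input rho,
    is_core (adjoint (graph x)) (Defs.span (range (rep_basis Gr rho)));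
  stage_window : forall n x y, agree_on (stage_query n x) x y ->
    forall z w, sval x.2 z -> sval y.2 w -> normc (w - z) <= stage_error n x;
  stage_close : forall n x y, agree_on (stage_query n x) x y ->
    close_on (stage_space n) (stage_error n x) (graph x) (graph y);
  stage_close_adj : forall n x y, agree_on (stage_query n x) x y ->
    close_on (stage_space n) (stage_error n x)
      (adjoint (graph x)) (adjoint (graph y)) }.

Definition bounded_below_on (H : hilbert R) (V : set H) (G : set (H * H))
    (z : R[i]) (d : R) : Prop :=
  forall u v, V u -> G (u, v) -> d * hnorm u <= hnorm (v - z *: u).

(** The constant [d + normc z + 1] adds up the three errors of replacing [(u, v)] by
    a nearby element of the core. *)
Lemma bounded_below_core (H : hilbert R) (V : set H) (G : set (H * H)) z (d : R) :
  0 <= d -> is_core G V -> bounded_below_on V G z d -> bounded_below G z d.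
Proof.
move=> d0 [_ core] bV [u v] Guv /=; apply/ler_addgt0Pr => e e0.
have c0 : 0 < d + normc z + 1 by rewrite ltr_wpDl// addr_ge0 ?normc_ge0.
have [[u' v'] [Gq Vu' /= uu' vv']] := core _ Guv _ (divr_gt0 e0 c0).
have := bV _ _ Vu' Gq => /=; set e1 := e / _ in uu' vv' *.
have -> : v' - z *: u' = (v - z *: u) + (z *: (u - u') - (v - v')).
  by rewrite scalerBr !addrA subrK opprB [RHS]addrC subrKA.
have := ler_hnormD (v - z *: u) (z *: (u - u') - (v - v')).
have := ler_hnormD (z *: (u - u')) (- (v - v')).
rewrite hnorm_opp hnormZ => h1 h2 h3.
have h4 : normc z * hnorm (u - u') <= normc z * e1.
  by rewrite ler_wpM2l ?normc_ge0// ltW.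
have h5 : d * (hnorm u - e1) <= d * hnorm u'.
  rewrite ler_wpM2l//; have := ler_hnormB u (u - u').
  by rewrite subKr; have := ltW uu'; lra.
have E : e = d * e1 + normc z * e1 + e1.
  by rewrite /e1; field; rewrite gt_eqF.
by move: h5; rewrite mulrBr; lra.
Qed.

Variables (rho : rep) (L : local_reading rho) (t : @resolvent_test R).

Lemma window_singleton (K : window J) : exists z, sval K = [set z].
Proof. by have [z _ KE] := proj2_sig K; exists z. Qed.

Definition stage_passes (m n : nat) (x : input rho) : Prop :=
  forall z h, sval x.2 z -> offsets t m h ->
    bounded_below_on (stage_space L n) (graph x) (z + h) (level t m) /\
    bounded_below_on (stage_space L n) (adjoint (graph x)) (conjc (z + h)) (level t m).

(** The output asks whether the answers are compatible with some instance that
    satisfies the condition.  So it is a function of the answers alone, and it is 1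
    whenever [x] itself satisfies the condition. *)
Definition stage_output (m n : nat) (x : input rho) : bool :=
  `[< exists2 y, agree_on (stage_query L n x) x y & stage_passes m n y >].

Lemma stage_outputS m n x : stage_output m n.+1 x -> stage_output m n x.
Proof.
move=> /asboolP[y xy py]; apply/asboolP; exists y => [f /stage_queryS|z h yz th].
  exact: xy.
by have [b b'] := py z h yz th; split=> u v /stage_spaceS; [exact: b|exact: b'].
Qed.

(** A lower bound shared by operators [G' n] that approach [G] on each stage passes
    to [G]: on a core, the vector is fixed while [n] grows. *)
Lemma bounded_below_limit (G : set (rep_space Gr rho * rep_space Gr rho))
    (G' : nat -> set (rep_space Gr rho * rep_space Gr rho))
    (x : input rho) (z : R[i]) (w : nat -> R[i]) d :
  0 <= d -> is_core G (Defs.span (range (rep_basis Gr rho))) ->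
  (forall n, close_on (stage_space L n) (stage_error L n x) G (G' n)) ->
  (forall n, normc (w n - z) <= stage_error L n x) ->
  (forall n, bounded_below_on (stage_space L n) (G' n) (w n) d) ->
  bounded_below G z d.
Proof.
move=> d0 coreG GG' wz bG'; apply: bounded_below_core d0 coreG _ => u v.
move=> /stage_space_span-/(_ L)[n0 n0u] Guv.
have nu n : (n0 <= n)%N -> stage_space L n u.
  by move=> /subnK <-; elim: (n - n0)%N => // k IH; exact: stage_spaceS.
have lim : hnorm (v - z *: u) + stage_error L n x * (hnorm u + hnorm u)
    @[n --> \oo] --> hnorm (v - z *: u).
  rewrite -[X in _ --> X]addr0; apply: cvgD; first exact: cvg_cst.
  by rewrite -[X in _ --> X](mul0r (hnorm u + hnorm u)); apply: cvgMl; exact: stage_error0.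
rewrite -(cvg_lim _ lim)//; apply: limr_ge.
  by apply/cvg_ex; eexists; exact: lim.
exists n0 => // n /= /nu nu'; have [v' G'v' vv'] := GG' n u v nu' Guv.
apply: le_trans (bG' n u v' nu' G'v') _.
have -> : v' - w n *: u = (v - z *: u) + ((v' - v) - (w n - z) *: u).
  by rewrite scalerBl opprB [RHS]addrC [RHS]addrAC !subrKA.
apply: le_trans (ler_hnormD _ _) _; rewrite lerD2l.
apply: le_trans (ler_hnormD _ _) _; rewrite hnorm_opp hnormZ mulrDr lerD//.
by rewrite ler_wpM2r ?hnorm_ge0.
Qed.

(** The compatible instances found at the stages [n] form the approximating
    sequence. *)
Lemma stage_outputP m x z : sval x.2 = [set z] ->
  (forall n, stage_output m n x) <-> passes_at t (graph x) z m.
Proof.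
move=> xz; split=> [xm h th|xm n]; last first.
  apply/asboolP; exists x => // z' h; rewrite xz => -> /xm[b b'].
  by split=> u v _ ?; [exact: (b (u, v))|exact: (b' (u, v))].
have /choice[y yP] n : exists y, agree_on (stage_query L n x) x y /\
    stage_passes m n y by have /asboolP[y] := xm n; exists y.
have /choice[w wP] n : exists w, sval (y n).2 = [set w].
  exact: window_singleton.
have wz n : normc (w n + h - (z + h)) <= stage_error L n x.
  rewrite opprD addrACA subrr addr0.
  by apply: (stage_window (yP n).1); rewrite ?xz ?wP.
have yw n : sval (y n).2 (w n) by rewrite wP.
have d0 := ltW (level_gt0 t m).
split.
- apply: (bounded_below_limit (x := x) (w := fun n => w n + h) d0 (stage_core L x)) wz _ => n.
    exact: stage_close (yP n).1.
  by have [] := (yP n).2 (w n) h (yw n) th.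
- apply: (bounded_below_limit (x := x) (w := fun n => conjc (w n + h)) d0
    (stage_core_adj L x)) _ _ => n.
  + exact: stage_close_adj (yP n).1.
  + by rewrite -rmorphB /= normc_conj.
  + by have [] := (yP n).2 (w n) h (yw n) th.
Qed.

Lemma stage_output_mono m m' n x :
  (m <= m')%N -> stage_output m n x -> stage_output m' n x.
Proof.
move=> mm' /asboolP[y xy py]; apply/asboolP; exists y => // z h yz th.
have [b b'] := py z h yz (offsets_anti mm' th).
split=> u v Vu Guv; apply: le_trans (ler_wpM2r (hnorm_ge0 _) (level_anti t mm')) _.
  exact: b.
exact: b'.
Qed.

(** The inner limits decrease in [n] and the outer limit increases in [m], so both
    exist. *)
Theorem has_tower2 (S : forall H : hilbert R, set (H * H) -> set R[i]) :
  decided_by t S -> has_tower (gp_sci (spectral_problem r code S rho)) 2.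
Proof.
move=> tS; pose P := spectral_problem r code S rho.
have cons m n x y : agree_on (stage_query L n x) x y ->
    stage_output m n y = stage_output m n x /\ stage_query L n y = stage_query L n x.
  move=> xy; have E := stage_query_agree xy; split=> //.
  rewrite /stage_output E; apply/asboolP/asboolP => -[w wP pw]; exists w => // f Qf.
    by rewrite (wP f Qf); exact: xy.
  by rewrite (wP f Qf) (xy f Qf).
pose G m n := @GeneralAlgorithm _ (gp_sci P) (stage_output m n) (stage_query L n)
  (@stage_query_eval rho L n) (stage_query_finite L n) (cons m n).
exists G => x; have [z xz] := window_singleton x.2.
pose lim m := `[< forall n, stage_output m n x >].
exists lim; split=> [m|].
  exists (fun n => stage_output m n x); split=> //.
  by apply: cvg_decreasing_bool => n; exact: stage_outputS.
suff -> : sci_target (s := gp_sci P) x = `[< exists m, lim m >].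
  apply: cvg_increasing_bool => m /asboolP lm; apply/asboolP => n.
  exact: stage_output_mono (leqnSn m) (lm n).
apply/idP/asboolP => [/(missesE tS xz)[m pm]|[m /asboolP xm]].
  by exists m; apply/asboolP; exact/(stage_outputP m xz).
by apply/(missesE tS xz); exists m; exact/(stage_outputP m xz).
Qed.

End upper_bound.

(** * Readings of general operators and of operators on graphs *)

Section matrix_data.
Context {R : realType} {I : choiceType} (e : nat -> I) (idx : I -> nat).
Variables (eK : cancel e idx) (idxK : cancel idx e).
Local Notation H := (l2 R I).
Local Notation basis := (fun j => l2_delta (e j) : H).
Implicit Types (u v w : H) (A B : cd_operator H) (G : set (H * H)).

Definition head_space (n : nat) : set H := [set u | forall k, (n < k)%N -> u (e k) = 0].

Definition truncate (p : nat) (v : H) : H := \sum_(k < p) v (e k) *: l2_delta (e k).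

Lemma truncateE p v i : truncate p v (e i) = if (i < p)%N then v (e i) else 0.
Proof.
rewrite /truncate -(big_mkord xpredT (fun k => v (e k) *: (l2_delta (e k) : H))).
rewrite -(big_map e xpredT (fun k => v k *: (l2_delta k : H))).
have e_inj : injective e := can_inj eK.
by rewrite l2_sum_delta ?map_inj_uniq ?iota_uniq// mem_map// mem_index_iota.
Qed.

Lemma coord_inj u v : (forall k, u (e k) = v (e k)) -> u = v.
Proof. by move=> uv; apply: ell2_inj => i; rewrite -(idxK i). Qed.

Lemma head_truncate n u : head_space n u -> u = truncate n.+1 u.
Proof.
move=> nu; apply: coord_inj => k; rewrite truncateE ltnS.
by case: leqP => // /nu.
Qed.

Lemma range_basis : range basis = range l2_delta.
Proof.
apply/seteqP; split=> _ [i _ <-]; first by exists (e i).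
by exists (idx i) => //; rewrite idxK.
Qed.

Lemma span_head u : Defs.span (range basis) u -> exists n, head_space n u.
Proof.
move=> [m [c [s [sP ->]]]].
have /choice[f fP] k : exists j, basis j = s k by have [j] := sP k; exists j.
exists (\max_(k < m) f k) => k km; elim/big_ind : _ => [//|x y|i _].
  by rewrite ell2_DE => -> ->; rewrite addr0.
rewrite -fP ell2_ZE /= (can_eq eK) gtn_eqF ?mulr0//.
by apply: leq_ltn_trans km; exact: leq_bigmax.
Qed.

Lemma head_span n u : head_space n u -> Defs.span (range basis) u.
Proof.
by move=> /head_truncate ->; rewrite range_basis; exact: span_sum_delta.
Qed.

Section coordinates.
Variables (A : cd_operator H) (coreA : is_core A (Defs.span (range basis))).

Lemma core_basis j : op_graph A (l2_delta (e j), op_app A (l2_delta (e j))).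
Proof.
apply/op_appP/coreA.1; exists 1%N, (fun=> 1), (fun=> basis j); split=> [_|].
  by exists j.
by rewrite big_ord1 scale1r.
Qed.

Lemma action_coord n u v i : head_space n u -> op_graph A (u, v) ->
  v (e i) = \sum_(k < n.+1) u (e k) * matrix_entry A (e i) (e k).
Proof.
move=> nu Auv.
pose w : H := \sum_(k < n.+1) u (e k) *: op_app A (l2_delta (e k)).
have Aw : op_graph A (u, w).
  rewrite (head_truncate nu) /truncate /w.
  elim/big_ind2 : _ => [|x1 x2 y1 y2 h1 h2|k _]; first exact: op_graph0.
    by have := op_graph_linear 1 h1 h2; rewrite pair_lin !scale1r.
  by have := cd_scale (u (e k)) (core_basis k).
rewrite (op_uniq Auv Aw) -hdot_delta linear_sumlz; apply: eq_bigr => k _.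
exact: hdotZl.
Qed.

Lemma adjoint_action_coord n u v i : head_space n u -> adjoint A (u, v) ->
  v (e i) = \sum_(k < n.+1) u (e k) * conjc (matrix_entry A (e k) (e i)).
Proof.
move=> nu Auv; apply: (can_inj (@conjcK _)); rewrite -hdot_deltal.
have <- : hdot H (op_app A (l2_delta (e i))) u = hdot H (l2_delta (e i)) v.
  exact: (Auv _ (core_basis i)).
rewrite [in LHS](head_truncate nu) linear_sumr rmorph_sum; apply: eq_bigr => k _.
apply: etrans (hdotZr _ _ _) _; rewrite [RHS]rmorphM; congr (_ * _).
exact/esym/conjcK.
Qed.

Lemma core_adjoint_fun y : adjoint A (0, y) -> y = 0.
Proof.
move=> Ay; apply: coord_inj => i; rewrite (@adjoint_action_coord 0%N 0 y i)//.
by rewrite big_ord1 mul0r.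
Qed.

End coordinates.

(** The common form of the structural data: [p = f(n+1)] and [c = c_(n+1)] for
    general operators; on graphs [p] exceeds the indices of all neighbours and
    [c = 0]. *)
Definition tail_le G (n p : nat) (c : R) : Prop := forall u v,
  head_space n u -> G (u, v) -> hnorm (v - truncate p v) <= c * hnorm u.

(** Both images have the same truncation, so that only their tails differ. *)
Lemma close_on_of_coords G G' n p c :
  tail_le G n p c -> tail_le G' n p c -> head_space n `<=` domain G' ->
  (forall u v v', head_space n u -> G (u, v) -> G' (u, v') ->
    forall i, (i < p)%N -> v' (e i) = v (e i)) ->
  close_on (head_space n) (c + c) G G'.
Proof.
move=> tG tG' dG' vv' u v nu Guv; have [[u' v'] /= G'uv' uu'] := dG' u nu.
move: G'uv'; rewrite {u'}uu' => G'uv'; exists v' => //.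
have E : truncate p v' = truncate p v.
  apply: coord_inj => k; rewrite !truncateE; case: ifP => // kp.
  exact: vv' nu Guv G'uv' k kp.
have -> : v' - v = (v' - truncate p v') - (v - truncate p v).
  by rewrite E opprB addrA subrK.
apply: le_trans (ler_hnormD _ _) _; rewrite hnorm_opp mulrDl lerD//.
  exact: tG'.
exact: tG.
Qed.

Lemma close_on_entries A B n M p c : (n < M)%N -> (p <= M)%N ->
  is_core A (Defs.span (range basis)) ->
  is_core B (Defs.span (range basis)) ->
  is_core (adjoint B) (Defs.span (range basis)) ->
  (forall i k, (i < M)%N -> (k < M)%N ->
    matrix_entry B (e i) (e k) = matrix_entry A (e i) (e k)) ->
  tail_le A n p c -> tail_le B n p c ->
  tail_le (adjoint A) n p c -> tail_le (adjoint B) n p c ->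
  close_on (head_space n) (c + c) A B /\
  close_on (head_space n) (c + c) (adjoint A) (adjoint B).
Proof.
move=> nM pM cA cB cB' AB tA tB tA' tB'; split; apply: (@close_on_of_coords _ _ n p) => //.
- by move=> u /head_span/cB.1.
- move=> u v v' nu Av Bv' i ip; rewrite (action_coord cA i nu Av) (action_coord cB i nu Bv').
  apply: eq_bigr => k _; rewrite AB//; first exact: leq_trans pM.
  exact: leq_trans (ltn_ord k) nM.
- by move=> u /head_span/cB'.1.
- move=> u v v' nu Av Bv' i ip.
  rewrite (adjoint_action_coord cA i nu Av) (adjoint_action_coord cB i nu Bv').
  apply: eq_bigr => k _; rewrite AB//; last exact: leq_trans pM.
  exact: leq_trans (ltn_ord k) nM.
Qed.

End matrix_data.

Section readings.
Context {R : realType} {Gr : cgraph} {J : set R}.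
Variables (r : readout J) (code : fset_coding (vertex Gr)).
Local Notation input := (@input R Gr J).

Lemma readout_agree n (K K' : window J) z w :
  (forall k, (k < n.+1)%N -> r k K' = r k K) -> sval K z -> sval K' w ->
  normc (w - z) <= 2 ^- n.
Proof.
move=> rKK' Kz K'w.
have h := readout_close r n Kz; have h' := readout_close r n K'w.
have -> : w - z = (r n K - z) - (r n K' - w).
  by rewrite (rKK' n (ltnSn n)); ring.
apply: le_trans (ler_normcD _ _) _; rewrite normcN.
apply: le_trans (lerD h h') _.
have -> : 2 ^- n.+2 = 2 ^- n / 4 :> R.
  by rewrite !exprS; field; rewrite expf_neq0.
have : 0 < 2 ^- n :> R by rewrite invr_gt0 exprn_gt0.
lra.
Qed.

Lemma cvg_pow2V : (2 ^- n : R) @[n --> \oo] --> (0 : R).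
Proof.
have h : `|2^-1 : R| < 1 by rewrite ger0_norm ?invr_ge0// invf_lt1// ltr1n.
have := @cvg_geometric R 1 _ h; apply: cvg_trans; apply: near_eq_cvg.
by near=> n; rewrite /geometric /= mul1r exprVn.
Unshelve. all: by end_near. Qed.

Section general_operators.
Let idK : cancel (@id nat) id := fun=> erefl.
Local Notation basis := (fun j : nat => l2_delta (id j) : l2 R nat).

Lemma tail_band (G : set (l2 R nat * l2 R nat)) f n (c : R) : 0 <= c ->
  (forall a p, G p -> G (a *: p)) -> (forall y, G (0, y) -> y = 0) ->
  (opnorm (band f n.+1 G) <= c%:E)%E -> tail_le id G n f c.
Proof.
move=> c0 GZ G0 Gc u v nu Guv.
have projT p (x : l2 R nat) : truncate id p x = Defs.proj p x.
  by apply: ell2_inj => i; rewrite (truncateE idK p x i) projE.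
have bandG : band f n.+1 G (u, v - truncate id f v).
  exists v; last by rewrite projT.
  by rewrite /= -projT -(head_truncate idK idK nu).
apply: ((opnorm_leP c0 _ _).1 Gc _ bandG) => [a [x y] [w Gxw /= ->]|y [w]].
  have projZ p x' : Defs.proj p (a *: x') = a *: Defs.proj p x'.
    apply: ell2_inj => i; rewrite ell2_ZE !projE ell2_ZE.
    by case: ifP; rewrite ?mulr0.
  exists (a *: w); last by rewrite /= projZ scalerBr.
  by rewrite /= projZ; exact: (GZ a _ Gxw).
have proj0 p : Defs.proj p (0 : l2 R nat) = 0.
  by apply: ell2_inj => i; rewrite projE if_same.
by rewrite /= proj0 => /G0 -> ->; rewrite proj0 subr0.
Qed.

(** Below this size the matrix determines the compressions [P_f(k) A P_k] and
    [P_f(k) A^* P_k] for all [k] up to the stage. *)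
Definition gen_size (n : nat) (x : input Gen) : nat :=
  (n.+1 + \sum_(k < n.+1) gen_disp x.1 k)%N.

Definition gen_query (n : nat) (x : input Gen) : set (input Gen -> R[i]) :=
  [set (fun y : input Gen => r k y.2) | k in `I_n.+1] `|`
  [set (fun y : input Gen => matrix_entry (gen_op y.1) ij.1 ij.2) |
     ij in `I_(gen_size n x) `*` `I_(gen_size n x)] `|`
  [set (fun y : input Gen => (gen_disp y.1 k)%:R) | k in `I_n.+1] `|`
  [set (fun y : input Gen => ratr (gen_bound y.1 k)) | k in `I_n.+1].

Definition gen_error (n : nat) (x : input Gen) : R :=
  2 ^- n + (ratr (gen_bound x.1 n) + ratr (gen_bound x.1 n)).

Lemma gen_queryP n (x y : input Gen) : agree_on (gen_query n x) x y ->
  [/\ forall k, (k < n.+1)%N -> r k y.2 = r k x.2,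
      forall i j, (i < gen_size n x)%N -> (j < gen_size n x)%N ->
        matrix_entry (gen_op y.1) i j = matrix_entry (gen_op x.1) i j,
      forall k, (k < n.+1)%N -> gen_disp y.1 k = gen_disp x.1 k &
      forall k, (k < n.+1)%N -> gen_bound y.1 k = gen_bound x.1 k].
Proof.
move=> xy; split=> [k kn|i j iM jM|k kn|k kn].
- by apply: (xy (fun y => r k y.2)); left; left; left; exists k.
- apply: (xy (fun y => matrix_entry (gen_op y.1) i j)).
  by left; left; right; exists (i, j).
- apply/eqP; rewrite -(@eqr_nat R[i]); apply/eqP.
  by apply: (xy (fun y => (gen_disp y.1 k)%:R)); left; right; exists k.
- apply: (@fmorph_inj _ _ (@ratr R[i])).
  by apply: (xy (fun y => ratr (gen_bound y.1 k))); right; exists k.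
Qed.

Lemma gen_tails n (x : input Gen) : let c : R := ratr (gen_bound x.1 n) in
  tail_le id (gen_op x.1) n (gen_disp x.1 n) c /\
  tail_le id (adjoint (gen_op x.1)) n (gen_disp x.1 n) c.
Proof.
move=> c; have c0 : 0 <= c by rewrite ler0q gen_bound_ge0.
have := gen_dispersion x.1 n; rewrite ge_max => /andP[h h'].
split.
  apply: (tail_band c0 _ _ h) => [a p|]; last exact: op_graph_fun.
  exact: cd_scale.
apply: (tail_band c0 _ _ h') => [a p|]; first exact: adjoint_scale.
exact: (core_adjoint_fun idK idK (gen_core x.1)).
Qed.

Lemma gen_closeness n (x y : input Gen) : agree_on (gen_query n x) x y ->
  close_on (head_space id n) (gen_error n x) (gen_op x.1) (gen_op y.1) /\
  close_on (head_space id n) (gen_error n x)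
    (adjoint (gen_op x.1)) (adjoint (gen_op y.1)).
Proof.
move=> /gen_queryP[_ entries disp bound].
have [tx tx'] := gen_tails n x; have [ty ty'] := gen_tails n y.
rewrite disp// bound// in ty ty'.
have pM : (gen_disp x.1 n <= gen_size n x)%N.
  rewrite /gen_size big_ord_recr.
  exact: leq_trans (leq_addl _ _) (leq_addl _ _).
have nM : (n < gen_size n x)%N by exact: leq_addr.
have [c c'] := close_on_entries idK idK nM pM (gen_core x.1) (gen_core y.1)
  (gen_core_adj y.1) entries tx ty tx' ty'.
have le_err (G G' : set (l2 R nat * l2 R nat)) : close_on (head_space id n)
    (ratr (gen_bound x.1 n) + ratr (gen_bound x.1 n)) G G' ->
    close_on (head_space id n) (gen_error n x) G G'.
  move=> GG' u v nu /(GG' _ _ nu)[v' G'v' h]; exists v' => //.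
  by apply: le_trans h _; rewrite ler_wpM2r ?hnorm_ge0// lerDr.
by split; exact: le_err.
Qed.

Fact gen_query_eval n (x : input Gen) : gen_query n x `<=` @interface _ _ _ r code Gen.
Proof.
move=> f [[[|]|]|] [k _ <-].
- by left; left; left; exists k.
- by left; left; right; exists k.
- by left; right; exists k.
- by right; exists k.
Qed.

Fact gen_query_finite n (x : input Gen) : finite_set (gen_query n x).
Proof.
rewrite !finite_setU; do !split; apply: finite_image; try exact: finite_II.
by apply: finite_setX; exact: finite_II.
Qed.

Fact gen_queryS n (x : input Gen) : gen_query n x `<=` gen_query n.+1 x.
Proof.
have M : (gen_size n x <= gen_size n.+1 x)%N.
  by rewrite /gen_size [X in (_ <= _ + X)%N]big_ord_recr /= leq_add// leq_addr.
move=> f [[[|]|]|] [k kn <-].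
- by left; left; left; exists k => //; exact: ltnW.
- left; left; right; exists k => //; case: kn => /= h h'.
  by split; [exact: leq_trans M|exact: leq_trans M].
- by left; right; exists k => //; exact: ltnW.
- by right; exists k => //; exact: ltnW.
Qed.

Fact gen_query_agree n (x y : input Gen) :
  agree_on (gen_query n x) x y -> gen_query n y = gen_query n x.
Proof.
move=> /gen_queryP[_ _ disp _]; rewrite /gen_query /gen_size.
by under eq_bigr => k _ do rewrite disp//.
Qed.

Fact gen_error0 (x : input Gen) : gen_error n x @[n --> \oo] --> (0 : R).
Proof.
have c0 := gen_bound_null x.1.
rewrite -[X in _ --> X]addr0 -[X in _ --> _ + X](addr0 0).
exact: cvgD cvg_pow2V (cvgD c0 c0).
Qed.

Fact gen_window n (x y : input Gen) : agree_on (gen_query n x) x y ->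
  forall z w, sval x.2 z -> sval y.2 w -> normc (w - z) <= gen_error n x.
Proof.
move=> /gen_queryP[rxy _ _ _] z w xz yw.
apply: le_trans (readout_agree rxy xz yw) _; rewrite lerDl.
by rewrite addr_ge0 ?ler0q ?gen_bound_ge0.
Qed.

Definition gen_reading : local_reading r code Gen :=
  @LocalReading R Gr J r code Gen (head_space id) gen_query gen_error
    (fun n u nu k kn => nu k (ltnW kn)) (span_head idK)
    gen_query_eval gen_query_finite gen_queryS gen_query_agree gen_error0
    (fun x => gen_core x.1) (fun x => gen_core_adj x.1) gen_window
    (fun n x y xy => (gen_closeness xy).1) (fun n x y xy => (gen_closeness xy).2).

End general_operators.
Section graph_operators.
Variables (idx : vertex Gr -> nat).
Variables (vK : cancel (vnum Gr) idx) (idxK : cancel idx (vnum Gr)).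

Definition graph_size (n : nat) (x : input Graph) : nat :=
  (n.+1 + \sum_(k < n.+1) \sum_(v <- graph_nbr x.1 (vnum Gr k)) (idx v).+1)%N.

Definition graph_query (n : nat) (x : input Graph) : set (input Graph -> R[i]) :=
  [set (fun y : input Graph => r k y.2) | k in `I_n.+1] `|`
  [set (fun y : input Graph =>
      matrix_entry (graph_op y.1) (vnum Gr ij.1) (vnum Gr ij.2)) |
     ij in `I_(graph_size n x) `*` `I_(graph_size n x)] `|`
  [set (fun y : input Graph => (code (graph_nbr y.1 (vnum Gr k)))%:R) | k in `I_n.+1].

Definition graph_error (n : nat) (x : input Graph) : R := 2 ^- n.

Lemma graph_queryP n (x y : input Graph) : agree_on (graph_query n x) x y ->
  [/\ forall k, (k < n.+1)%N -> r k y.2 = r k x.2,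
      forall i j, (i < graph_size n x)%N -> (j < graph_size n x)%N ->
        matrix_entry (graph_op y.1) (vnum Gr i) (vnum Gr j) =
        matrix_entry (graph_op x.1) (vnum Gr i) (vnum Gr j) &
      forall k, (k < n.+1)%N ->
        graph_nbr y.1 (vnum Gr k) = graph_nbr x.1 (vnum Gr k)].
Proof.
move=> xy; split=> [k kn|i j iM jM|k kn].
- by apply: (xy (fun y => r k y.2)); left; left; exists k.
- apply: (xy (fun y => matrix_entry (graph_op y.1) (vnum Gr i) (vnum Gr j))).
  by left; right; exists (i, j).
- apply: (@fset_code_inj _ code); apply/eqP; rewrite -(@eqr_nat R[i]); apply/eqP.
  by apply: (xy (fun y => (code (graph_nbr y.1 (vnum Gr k)))%:R)); right; exists k.
Qed.

Lemma graph_size_nbr n (x : input Graph) k v : (k < n.+1)%N ->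
  v \in graph_nbr x.1 (vnum Gr k) -> (idx v < graph_size n x)%N.
Proof.
move=> kn vk; apply: leq_trans (leq_addl _ _).
rewrite (bigD1 (Ordinal kn))//=; apply: leq_trans (leq_addr _ _).
by rewrite (big_fsetD1 v)//= leq_addr.
Qed.

Lemma graph_supp_size n (x : input Graph) i k :
  (k < n.+1)%N -> (graph_size n x <= i)%N ->
  matrix_entry (graph_op x.1) (vnum Gr k) (vnum Gr i) = 0 /\
  matrix_entry (graph_op x.1) (vnum Gr i) (vnum Gr k) = 0.
Proof.
move=> kn iM; apply: (graph_supp (g := x.1)); apply/negP => /(graph_size_nbr kn).
by rewrite vK ltnNge iM.
Qed.

Lemma graph_core_num (x : input Graph) :
  is_core (graph_op x.1) (Defs.span (range (fun j => l2_delta (vnum Gr j)))).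
Proof. by rewrite (range_basis idxK); exact: graph_core. Qed.

Lemma graph_core_adj_num (x : input Graph) :
  is_core (adjoint (graph_op x.1)) (Defs.span (range (fun j => l2_delta (vnum Gr j)))).
Proof. by rewrite (range_basis idxK); exact: graph_core_adj. Qed.

(** The neighbourhoods of the first vertices bound the support of the columns and
    of the rows, so that nothing is cut off. *)
Lemma graph_tails n M (x : input Graph) : M = graph_size n x ->
  tail_le (vnum Gr) (graph_op x.1) n M 0 /\
  tail_le (vnum Gr) (adjoint (graph_op x.1)) n M 0.
Proof.
move=> ->; split=> u v nu Guv.
  rewrite (_ : v - _ = 0) ?hnorm0 ?mul0r//.
  apply: (coord_inj idxK) => i; rewrite ell2_BE (truncateE vK).
  case: ltnP => [_|iM]; first by rewrite subrr.
  rewrite subr0 (action_coord vK idxK (graph_core_num x) i nu Guv) big1// => k _.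
  by rewrite (graph_supp_size (ltn_ord k) iM).2 mulr0.
rewrite (_ : v - _ = 0) ?hnorm0 ?mul0r//.
apply: (coord_inj idxK) => i; rewrite ell2_BE (truncateE vK).
case: ltnP => [_|iM]; first by rewrite subrr.
rewrite subr0 (adjoint_action_coord vK idxK (graph_core_num x) i nu Guv) big1// => k _.
by rewrite (graph_supp_size (ltn_ord k) iM).1 conjc0 mulr0.
Qed.

Fact graph_size_agree n (x y : input Graph) :
  agree_on (graph_query n x) x y -> graph_size n y = graph_size n x.
Proof.
move=> /graph_queryP[_ _ nbr]; rewrite /graph_size.
by congr (_ + _)%N; apply: eq_bigr => k _; rewrite nbr.
Qed.

Lemma graph_closeness n (x y : input Graph) : agree_on (graph_query n x) x y ->
  close_on (head_space (vnum Gr) n) (graph_error n x) (graph_op x.1) (graph_op y.1) /\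
  close_on (head_space (vnum Gr) n) (graph_error n x)
    (adjoint (graph_op x.1)) (adjoint (graph_op y.1)).
Proof.
move=> xy; have [_ entries _] := graph_queryP xy.
have [tx tx'] := graph_tails (erefl (graph_size n x)).
have [ty ty'] := graph_tails (esym (graph_size_agree xy)).
have nM : (n < graph_size n x)%N by exact: leq_addr.
have [c c'] := close_on_entries vK idxK nM (leqnn _) (graph_core_num x)
  (graph_core_num y) (graph_core_adj_num y) entries tx ty tx' ty'.
have le_err (G G' : set (l2 R (vertex Gr) * l2 R (vertex Gr))) :
    close_on (head_space (vnum Gr) n) (0 + 0) G G' ->
    close_on (head_space (vnum Gr) n) (graph_error n x) G G'.
  move=> GG' u v nu /(GG' _ _ nu)[v' G'v' h]; exists v' => //.
  apply: le_trans h _; rewrite ler_wpM2r ?hnorm_ge0//.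
  by rewrite addr0 invr_ge0 exprn_ge0.
by split; exact: le_err.
Qed.

Fact graph_query_eval n (x : input Graph) :
  graph_query n x `<=` @interface _ _ _ r code Graph.
Proof.
move=> f [[|]|] [k _ <-].
- by left; left; exists k.
- by left; right; exists k.
- by right; exists k.
Qed.

Fact graph_query_finite n (x : input Graph) : finite_set (graph_query n x).
Proof.
rewrite !finite_setU; do !split; apply: finite_image; try exact: finite_II.
by apply: finite_setX; exact: finite_II.
Qed.

Fact graph_queryS n (x : input Graph) : graph_query n x `<=` graph_query n.+1 x.
Proof.
have M : (graph_size n x <= graph_size n.+1 x)%N.
  by rewrite /graph_size [X in (_ <= _ + X)%N]big_ord_recr /= leq_add// leq_addr.
move=> f [[|]|] [k kn <-].
- by left; left; exists k => //; exact: ltnW.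
- left; right; exists k => //; case: kn => /= h h'.
  by split; [exact: leq_trans M|exact: leq_trans M].
- by right; exists k => //; exact: ltnW.
Qed.

Fact graph_query_agree n (x y : input Graph) :
  agree_on (graph_query n x) x y -> graph_query n y = graph_query n x.
Proof. by move=> /graph_size_agree E; rewrite /graph_query E. Qed.

Fact graph_error0 (x : input Graph) : graph_error n x @[n --> \oo] --> (0 : R).
Proof. exact: cvg_pow2V. Qed.

Fact graph_window n (x y : input Graph) : agree_on (graph_query n x) x y ->
  forall z w, sval x.2 z -> sval y.2 w -> normc (w - z) <= graph_error n x.
Proof. by move=> /graph_queryP[rxy _ _] z w; exact: readout_agree. Qed.

Definition graph_reading : local_reading r code Graph :=
  @LocalReading R Gr J r code Graph (head_space (vnum Gr)) graph_query graph_error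
    (fun n u nu k kn => nu k (ltnW kn)) (span_head vK)
    graph_query_eval graph_query_finite graph_queryS graph_query_agree graph_error0
    graph_core_num graph_core_adj_num graph_window
    (fun n x y xy => (graph_closeness xy).1) (fun n x y xy => (graph_closeness xy).2).

End graph_operators.

Variables (S : forall H : hilbert R, set (H * H) -> set R[i]).
Variables (t : resolvent_test) (tS : decided_by t S).

Lemma gen_has_tower2 : has_tower (gp_sci (spectral_problem r code S Gen)) 2.
Proof. exact: has_tower2 gen_reading _ _ tS. Qed.

Lemma graph_has_tower2 : has_tower (gp_sci (spectral_problem r code S Graph)) 2.
Proof.
by have [idx vK idxK] := vnum_bij Gr; exact: has_tower2 (graph_reading vK idxK) _ _ tS.
Qed.

End readings.

(** * Diagonal operators as general operators and as operators on graphs *)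

Section transported_operators.
Context {R : realType} {H K : hilbert R} (U : H -> K) (uU : unitary U).

Lemma hcvg_unitary (u : nat -> H) x : hcvg (fun n => U (u n)) (U x) -> hcvg u x.
Proof.
have E n : hnorm (U (u n) - U x) = hnorm (u n - x).
  by rewrite -(unitaryB uU) (hnorm_unitary uU).
by rewrite /hcvg (funext E).
Qed.

Variable A : cd_operator H.

Fact transport0 : conj_graph U A 0.
Proof.
have := (conj_graphE uU (op_graph A) 0 0).2 (op_graph0 A).
by rewrite (unitary0 uU).
Qed.

Fact transport_linear c p q :
  conj_graph U A p -> conj_graph U A q -> conj_graph U A (c *: p + q).
Proof.
move=> [[x y] Axy <-] [[x' y'] Axy' <-] /=; rewrite pair_lin -!(unitaryP uU).
by apply/(conj_graphE uU); have := op_graph_linear c Axy Axy'; rewrite pair_lin.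
Qed.

Fact transport_fun y : conj_graph U A (0, y) -> y = 0.
Proof.
have [y' <-] := unitary_surj uU y; rewrite -(unitary0 uU) => /(conj_graphE uU).
by move=> /op_graph_fun ->.
Qed.

Fact transport_closed (u v : nat -> K) x y :
  (forall n, conj_graph U A (u n, v n)) -> hcvg u x -> hcvg v y ->
  conj_graph U A (x, y).
Proof.
have [x' <-] := unitary_surj uU x; have [y' <-] := unitary_surj uU y.
have /choice[u' u'E] n := unitary_surj uU (u n).
have /choice[v' v'E] n := unitary_surj uU (v n).
have -> : u = (fun n => U (u' n)) by apply/funext => n; rewrite u'E.
have -> : v = (fun n => U (v' n)) by apply/funext => n; rewrite v'E.
move=> Auv /hcvg_unitary ux /hcvg_unitary vy; apply/(conj_graphE uU).
by apply: op_graph_closed ux vy => n; exact/(conj_graphE uU).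
Qed.

Fact transport_dense x (e : R) : 0 < e ->
  exists2 x', domain (conj_graph U A) x' & hnorm (x - x') < e.
Proof.
have [y <-] := unitary_surj uU x => /(op_graph_dense A y)[y' [p Ap py] yy'].
exists (U y'); last by rewrite -(unitaryB uU) (hnorm_unitary uU).
by exists (U p.1, U p.2); [exists p|rewrite /= py].
Qed.

Definition transport : cd_operator K :=
  CdOperator transport0 transport_linear transport_fun transport_closed transport_dense.

Lemma core_conj_graph (G : set (H * H)) (S : set H) :
  is_core G S -> is_core (conj_graph U G) (U @` S).
Proof.
move=> [dS core]; split=> [_ [x /dS[p Gp <-] <-]|_ [p Gp <-] e e0].
  by exists (U p.1, U p.2) => //; exists p.
have [q [Gq Sq pq1 pq2]] := core p Gp e e0.
exists (U q.1, U q.2); rewrite -!(unitaryB uU) !(hnorm_unitary uU); split=> //.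
- by exists q.
- by exists q.1.
Qed.

Lemma span_unitary (S : set H) : U @` Defs.span S = Defs.span (U @` S).
Proof.
have sumU n (c : 'I_n -> R[i]) (s : 'I_n -> H) :
    U (\sum_(k < n) c k *: s k) = \sum_(k < n) c k *: U (s k).
  elim/big_ind2 : _ => [|x x' y y' <- <-|k _]; first exact: unitary0.
    by have := unitaryP uU 1 x' y'; rewrite !scale1r.
  exact: unitaryZ.
apply/seteqP; split=> [_ [_ [n [c [s [Ss ->]]]] <-]|_ [n [c [s [Ss ->]]]]].
  by exists n, c, (U \o s); split=> [k|]; [exists (s k)|exact: sumU].
have /choice[s' s'E] k : exists x, S x /\ U x = s k by have [x] := Ss k; exists x.
exists (\sum_(k < n) c k *: s' k).
  by exists n, c, s'; split=> // k; case: (s'E k).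
by rewrite sumU; apply: eq_bigr => k _; case: (s'E k) => _ ->.
Qed.

End transported_operators.

Section relabelling.
Context {R : realType} {I K : choiceType} (e : I -> K) (f : K -> I).
Variables (eK : cancel e f) (fK : cancel f e).

Lemma esum_relabel (a : I -> \bar R) :
  \esum_(k in [set: K]) a (f k) = \esum_(i in [set: I]) a i.
Proof.
apply/esym/reindex_esum; split=> [//|x y _ _ /(congr1 e)|i _].
  by rewrite !fK.
by exists (e i).
Qed.

Fact relabel_subproof (x : l2 R I) : (fun k => x (f k) : R[i]^o) \in ell2_pred.
Proof.
rewrite inE ge0_rsummableE; last by move=> k; rewrite sqr_ge0.
rewrite (esum_relabel (fun i => (normc (x i) ^+ 2)%:E)).
by rewrite -ge0_rsummableE; [exact: ell2P|move=> i; rewrite sqr_ge0].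
Qed.

Definition relabel (x : l2 R I) : l2 R K := Ell2 (relabel_subproof x).

Lemma relabel_delta i : relabel (l2_delta i) = l2_delta (e i).
Proof. by apply: ell2_inj => k /=; rewrite -(can2_eq fK eK). Qed.

Lemma rsum_relabel (u : I -> R) : rsum (fun k => u (f k)) = rsum u.
Proof.
rewrite /rsum -(esum_relabel ((EFin \o u)^\+)%E) -(esum_relabel ((EFin \o u)^\-)%E).
by congr (fine _ - fine _); apply: eq_esum => k _; rewrite ?funeposE ?funenegE.
Qed.

End relabelling.

Section relabelling_unitary.
Context {R : realType} {I K : choiceType} (e : I -> K) (f : K -> I).
Variables (eK : cancel e f) (fK : cancel f e).

Lemma relabel_unitary : unitary (relabel eK fK : l2 R I -> l2 R K).
Proof.
split=> [c x y||x y]; first exact: ell2_inj.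
  by exists (relabel fK eK) => x; apply: ell2_inj => i /=; rewrite ?eK ?fK.
rewrite -[LHS]/(ell2_dot _ _) -[RHS]/(ell2_dot _ _) /ell2_dot /csum.
congr (_ +i* _).
  exact: (rsum_relabel eK fK (fun i => complex.Re (x i * conjc (y i)))).
exact: (rsum_relabel eK fK (fun i => complex.Im (x i * conjc (y i)))).
Qed.

End relabelling_unitary.

Section diagonal_inclusions.
Context {R : realType} {Gr : cgraph}.
Implicit Type a : nat -> R[i].

Lemma op_app_eq (H : hilbert R) (A : cd_operator H) x y :
  op_graph A (x, y) -> op_app A x = y.
Proof. by move=> Axy; apply: (op_uniq (op_appP _) Axy); exists (x, y). Qed.

Lemma op_app_diag a j : op_app (diag_op a) (l2_delta j) = a j *: (l2_delta j : l2 R nat).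
Proof. by apply: op_app_eq; exact: diag_graph_delta. Qed.

Fact diag_gen_core_adj a : is_core (adjoint (diag_op a)) (Defs.span (range l2_delta)).
Proof. by rewrite adjoint_diag_graph; exact: span_core_diag_graph. Qed.

Fact diag_gen_bound_null : (ratr (2 ^- k.+1 : rat) : R) @[k --> \oo] --> (0 : R).
Proof.
have -> : (fun k => ratr (2 ^- k.+1 : rat) : R) = [sequence 2 ^- k.+1]_k.
  by apply/funext => k; rewrite fmorphV rmorphXn rmorph_nat.
by rewrite (cvg_shiftS (fun k => 2 ^- k : R)); exact: cvg_pow2V.
Qed.

Lemma opnorm_band_diag a k : (opnorm (band k.+1 k.+1 (diag_graph a)) <= 0)%E.
Proof.
apply: ge_ereal_sup => _ [p [[w Aw ->] _] <-]; rewrite lee_fin.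
rewrite (_ : w - _ = 0) ?hnorm0//; apply: ell2_inj => j.
rewrite ell2_BE projE (Aw j) /= projE.
by case: ifP; rewrite ?subrr ?mulr0 ?subr0.
Qed.

Fact diag_gen_dispersion a k :
  (maxe (opnorm (band k.+1 k.+1 (diag_op a)))
        (opnorm (band k.+1 k.+1 (adjoint (diag_op a))))
    <= (ratr (2 ^- k.+1 : rat) : R)%:E)%E.
Proof.
rewrite adjoint_diag_graph ge_max.
have c0 : (0 <= (ratr (2 ^- k.+1 : rat) : R)%:E)%E.
  by rewrite lee_fin ler0q invr_ge0 exprn_ge0.
by rewrite !(le_trans (opnorm_band_diag _ _) c0).
Qed.

Definition diag_gen a : @gen_inst R :=
  @GenInst R (diag_op a) (span_core_diag_graph a) (diag_gen_core_adj a)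
    S (fun=> isT) (fun k => 2 ^- k.+1)
    (fun k => ltac:(by rewrite invr_ge0 exprn_ge0)) diag_gen_bound_null
    (diag_gen_dispersion a).

Section graph_inclusion.
Variables (idx : vertex Gr -> nat).
Variables (vK : cancel (vnum Gr) idx) (idxK : cancel idx (vnum Gr)).
Local Notation W := (relabel vK idxK : l2 R nat -> l2 R (vertex Gr)).
Local Notation uW := (relabel_unitary vK idxK).

Lemma relabel_span :
  W @` Defs.span (range l2_delta) = Defs.span (range l2_delta).
Proof.
rewrite (span_unitary uW); congr Defs.span; apply/seteqP.
split=> [_ [_ [j _ <-] <-]|_ [v _ <-]]; first by rewrite relabel_delta; exists (vnum Gr j).
by exists (l2_delta (idx v)); [exists (idx v)|rewrite relabel_delta idxK].
Qed.

Definition diag_graph_op a : cd_operator (l2 R (vertex Gr)) :=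
  transport uW (diag_op a).

Fact diag_graph_core a : is_core (diag_graph_op a) (Defs.span (range l2_delta)).
Proof.
by rewrite -relabel_span; exact: core_conj_graph uW _ _ (span_core_diag_graph a).
Qed.

Fact diag_graph_core_adj a :
  is_core (adjoint (diag_graph_op a)) (Defs.span (range l2_delta)).
Proof.
rewrite -relabel_span /= (adjoint_conj_graph uW).
exact: core_conj_graph uW _ _ (diag_gen_core_adj a).
Qed.

Lemma op_app_diag_graph a v :
  op_app (diag_graph_op a) (l2_delta v) = a (idx v) *: (l2_delta v : l2 R (vertex Gr)).
Proof.
apply: op_app_eq; rewrite -{1 3}(idxK v) -(relabel_delta vK idxK) -(unitaryZ uW).
by apply/(conj_graphE uW); exact: diag_graph_delta.
Qed.

Fact diag_graph_supp a v w : w \notin [fset v]%fset ->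
  matrix_entry (diag_graph_op a) v w = 0 /\ matrix_entry (diag_graph_op a) w v = 0.
Proof.
rewrite inE => wv; rewrite /matrix_entry !op_app_diag_graph !hdotZl !hdot_delta /=.
by rewrite [v == w]eq_sym (negbTE wv) !mulr0.
Qed.

Definition diag_to_graph a : @graph_inst R Gr :=
  @GraphInst R Gr (diag_graph_op a) (diag_graph_core a) (diag_graph_core_adj a)
    (fun v => [fset v]%fset) (diag_graph_supp a).

End graph_inclusion.
End diagonal_inclusions.

(** * The geometric preorder *)

Section preorder.
Context {R : realType} {Gr : cgraph} {J : set R}.
Variables (eps : R) (CH : geometric_structure Gr J eps).
Local Notation problem := (@gproblem R Gr J).
Local Notation input := (@input R Gr J).
Local Notation queries S := (@gp_interface R Gr J S).

Lemma encoding_trans rho1 rho2 rho3 (E : input rho1 -> input rho2)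
    (E' : input rho2 -> input rho3) :
  encoding CH E -> encoding CH E' -> encoding CH (fun x => E' (E x)).
Proof.
move=> EE; elim: EE E' => {rho1 rho2 E} [//|rho1 rho2 rho F E FCH _ IH] E' EE'.
by apply: (encoding_comp FCH (E := fun y => E' (E y))); exact: IH.
Qed.

Lemma reads_const (S : problem) (lam : input (gp_rep S) -> R[i]) :
  (forall x y, lam x = lam y) -> reads lam.
Proof. by move=> c; exists set0; split=> // x y _; exact: c. Qed.

Lemma reads_determined (S : problem) (f lam : input (gp_rep S) -> R[i]) :
  queries S f -> (forall x y, f x = f y -> lam x = lam y) -> reads lam.
Proof.
move=> Sf flam; exists [set f]; split=> [|g ->//|x y xy]; first exact: finite_set1.
by apply: flam; exact: xy.
Qed.

Lemma reads_query (S : problem) (f : input (gp_rep S) -> R[i]) :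
  queries S f -> reads f.
Proof. by move=> Sf; exact: reads_determined Sf (fun x y xy => xy). Qed.

(** Each of the finitely many queries of the outer reduction costs finitely many
    queries of the inner one. *)
Lemma reads_comp (S P : problem) (E : input (gp_rep S) -> input (gp_rep P)) lam :
  (forall f, queries P f -> reads (f \o E)) -> reads lam -> reads (lam \o E).
Proof.
move=> SE [F [fF FP Flam]].
have /choice[G GP] f : exists G : set (input (gp_rep S) -> R[i]), F f ->
    [/\ finite_set G, G `<=` queries S &
        forall x y, (forall g, G g -> g x = g y) -> f (E x) = f (E y)].
  have [/FP/SE[G GP]|nF] := pselect (F f); first by exists G.
  by exists set0.
exists (\bigcup_(f in F) G f); split=> [|g [f /GP[_ GS _]]|x y xy].
- by apply: bigcup_finite => // f /GP[].
- exact: GS.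
- by apply: Flam => f Ff; have [_ _] := GP f Ff; apply=> g Gg; apply: xy; exists f.
Qed.

Lemma le_geom_refl (P : problem) : le_geom CH P P.
Proof.
apply/le_geomP; exists id, id; split=> // [|lam]; first exact: encoding_id.
exact: reads_query.
Qed.

Lemma le_geom_trans (Q S P : problem) :
  le_geom CH S Q -> le_geom CH Q P -> le_geom CH S P.
Proof.
move=> /le_geomP[E [D [EE DE lamE]]] /le_geomP[E' [D' [EE' DE' lamE']]].
apply/le_geomP; exists (fun x => E' (E x)), (D \o D'); split.
- exact: encoding_trans.
- by move=> x; rewrite /= DE' DE.
- by move=> lam /lamE'; exact: (reads_comp lamE).
Qed.

Section invariance.
Variable t : @resolvent_test R.
Hypothesis neutral : forall (H : hilbert R) (T : cd_operator H),
  spectrum T `&` embed J = set0 -> pseudospectrum eps T `&` embed J = set0 ->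
  forall z, embed J z -> passes t T z.

(** The first four forms are unitary conjugations; for the fifth one the neutral
    summand passes every test at points of [J]. *)
Lemma elementary_passes rho rho' (F : rep_inst Gr rho -> rep_inst Gr rho') :
  elementary_form J eps F -> forall A z, embed J z ->
  passes t (op_graph (rep_op (F A))) z <-> passes t (op_graph (rep_op A)) z.
Proof.
have unitary_passes rho1 rho2 (F' : rep_inst Gr rho1 -> rep_inst Gr rho2) U :
    unitary_form F' U -> forall A z,
    passes t (op_graph (rep_op (F' A))) z <-> passes t (op_graph (rep_op A)) z.
  by move=> [uU FU] A z; rewrite FU; exact: passes_conj_graph.
case=> {rho rho' F} [rho rho' F U uF|rho rho' F U pi _ _ _ _ uF|F U al _ _ _ uF|
    rho rho' F W uF|rho rho' F H0 T0 W uW sT pT FW] A z zJ.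
- exact: unitary_passes uF A z.
- exact: unitary_passes uF A z.
- exact: unitary_passes uF A z.
- exact: unitary_passes uF A z.
rewrite FW (passes_conj_graph t _ _ uW) passes_sum_graph.
by split=> [[]//|pA]; split=> //; exact: neutral sT pT z zJ.
Qed.

Lemma encoding_passes rho rho' (E : input rho -> input rho') : encoding CH E ->
  forall x z, embed J z -> sval x.2 = [set z] -> sval (E x).2 = [set z] /\
    (passes t (op_graph (rep_op (E x).1)) z <-> passes t (op_graph (rep_op x.1)) z).
Proof.
elim=> {rho rho' E} [//|rho1 rho2 rho3 F E FCH _ IH] x z zJ xz.
have [//|Exz ->] := IH (F x.1, x.2) z zJ; split=> //.
exact: elementary_passes (elementary_formP FCH) _ _ zJ.
Qed.

End invariance.
End preorder.

Section reductions.
Context {R : realType} {Gr : cgraph} {J : set R}.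
Variables (r : readout J) (code : fset_coding (vertex Gr)).
Variables (eps : R) (CH : geometric_structure Gr J eps).
Variables (S : forall H : hilbert R, set (H * H) -> set R[i]).
Local Notation input := (@input R Gr J).
Local Notation problem := (spectral_problem r code S).

Lemma diag_le_gen : le_geom CH (problem Diag) (problem Gen).
Proof.
pose F : rep_inst Gr Diag -> rep_inst Gr Gen := @diag_gen R.
have FCH : elementary CH F by apply: elementary_diag_gen => a; split.
apply/le_geomP; exists (fun x => (F x.1, x.2)), id; split=> // [|lam].
  exact: (encoding_comp FCH (encoding_id CH Gen)).
have rdiag k : interface r code (rho := Diag) (fun x : input Diag => r k x.2).
  by left; exists k.
have adiag j : interface r code (rho := Diag) (fun x : input Diag => x.1 j).
  by right; exists j.
case=> [[[|]|]|] [k _ <-].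
- exact: (reads_query (S := problem Diag) (rdiag k)).
- apply: (reads_determined (S := problem Diag) (adiag k.2)) => x y /= xy.
  by rewrite /matrix_entry !op_app_diag xy.
- exact: reads_const.
- exact: reads_const.
Qed.

Variables (t : @resolvent_test R) (tS : decided_by t S).

Lemma diag_le_graph : le_geom CH (problem Diag) (problem Graph).
Proof.
have [idx vK idxK] := vnum_bij Gr.
pose F : @rep_inst R Gr Diag -> @rep_inst R Gr Graph := diag_to_graph vK idxK.
pose W : @rep_space R Gr Diag -> @rep_space R Gr Graph := relabel vK idxK.
have uF : unitary_form F W by split=> //; exact: relabel_unitary.
have FCH : elementary CH F.
  apply: elementary_diag_graph; split=> //; exists W => // j.
  exact: relabel_delta.
pose E (x : input Diag) : input Graph := (F x.1, x.2).
apply/le_geomP; exists E, id; split=> [|x|lam].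
- exact: (encoding_comp FCH (encoding_id CH Graph)).
- have [z xz] := window_singleton x.2.
  apply/idP/idP => h.
    apply/(missesE tS xz)/(passes_conj_graph t _ _ (relabel_unitary vK idxK)).
    by have := (missesE (x := E x) tS xz).1 h.
  apply/(missesE (x := E x) tS xz)/(passes_conj_graph t _ _ (relabel_unitary vK idxK)).
  exact/(missesE tS xz).
have rdiag k : interface r code (rho := Diag) (fun x : input Diag => r k x.2).
  by left; exists k.
have adiag j : interface r code (rho := Diag) (fun x : input Diag => x.1 j).
  by right; exists j.
case=> [[|]|] [k _ <-].
- exact: (reads_query (S := problem Diag) (rdiag k)).
- apply: (reads_determined (S := problem Diag) (adiag k.2)) => x y /= xy.
  by rewrite /matrix_entry !op_app_diag_graph vK xy.
- exact: reads_const.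
Qed.

Lemma diag_le rho : le_geom CH (problem Diag) (problem rho).
Proof.
by case: rho; [exact: le_geom_refl|exact: diag_le_gen|exact: diag_le_graph].
Qed.

(** Along [diag_le] the lower bound passes from the diagonal problem to the others,
    and the upper bound from general to diagonal operators. *)
Theorem SCI_spectral_problem (e0 : R) rho :
  diag_margin t e0 -> 0 <= e0 -> J !=set0 ->
  SCI_G (gp_sci (problem rho)) = 2%:E.
Proof.
move=> te0 e00 J0; apply: (SCI_G_eq (k := 1)).
  case: rho; [|exact: gen_has_tower2 tS|exact: graph_has_tower2 tS].
  exact: has_tower_le_geom diag_le_gen (gen_has_tower2 r code tS).
move=> /(has_tower_le_geom (diag_le rho)).
exact: diag_not_height1 tS te0 e00 J0.
Qed.

End reductions.

(** * Separation of the two blocks and minimal degrees *)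

Section separation.
Context {R : realType} {Gr : cgraph} {J : set R}.
Variables (r : readout J) (code : fset_coding (vertex Gr)).
Variables (eps : R) (CH : geometric_structure Gr J eps).
Local Notation input := (@input R Gr J).

Lemma const_diag_passes (t : @resolvent_test R) (e0 d : R) (z : R[i]) :
  diag_margin t e0 -> 0 <= d ->
  passes t (diag_graph (fun=> z + d%:C)) z <-> e0 < d.
Proof.
move=> te0 d0; rewrite te0 addrC addKr normcR ger0_norm//.
split=> [[rho rho0 /(_ 0%N)]|e0d]; first by lra.
by exists (d - e0) => [|_]; lra.
Qed.

(** An encoding preserves the answers.  For the constant sequence at distance [d]
    from the window these are [e0 < d] and [e0' < d]; the decoder is forced to be the
    identity by [d = 0] and by large [d], which fails at [d = e0] or [d = e0']. *)
Theorem not_le_geom (S S' : forall H : hilbert R, set (H * H) -> set R[i])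
    (t t' : @resolvent_test R) (e0 e0' : R) rho :
  decided_by t S -> decided_by t' S' -> diag_margin t e0 -> diag_margin t' e0' ->
  (forall (H : hilbert R) (T : cd_operator H),
    spectrum T `&` embed J = set0 -> pseudospectrum eps T `&` embed J = set0 ->
    forall z, embed J z -> passes t' T z) ->
  0 <= e0 -> 0 <= e0' -> e0 != e0' -> J !=set0 ->
  ~ le_geom CH (spectral_problem r code S Diag) (spectral_problem r code S' rho).
Proof.
move=> tS tS' te te' neutral e00 e00' ee' [z0 Jz0] /le_geomP[E [D [EE DE _]]].
pose z : R[i] := z0%:C; have zJ : embed J z by exists z0.
pose K : window J := exist _ [set z] (ex_intro2 _ _ z zJ erefl).
pose x d : input Diag := (fun=> z + d%:C, K).
have D_eq (d : R) : 0 <= d -> D (e0' < d) = (e0 < d).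
  move=> d0; have [Ez Ep] := encoding_passes neutral EE zJ (erefl : sval (x d).2 = _).
  have <- : gp_target (E (x d)) = (e0' < d).
    apply/idP/idP => [/(missesE tS' Ez)/Ep/(const_diag_passes z te' d0)//|h].
    exact/(missesE tS' Ez)/Ep/(const_diag_passes z te' d0).
  rewrite DE; apply/idP/idP => [/(missesE (x := x d) tS erefl)/(const_diag_passes z te d0)//|h].
  exact/(missesE (x := x d) tS erefl)/(const_diag_passes z te d0).
have D0 := D_eq 0 (lexx 0); rewrite !ltNge e00 e00' /= in D0.
have D1 : D true = true.
  have h : 0 <= e0 + e0' + 1 by lra.
  have h0 : e0 < e0 + e0' + 1 by lra.
  have h1 : e0' < e0 + e0' + 1 by lra.
  by have := D_eq _ h; rewrite h0 h1.
case: ltgtP ee' => // h _.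
  by have := D_eq e0' e00'; rewrite ltxx h D0.
by have := D_eq e0 e00; rewrite ltxx h D1.
Qed.

End separation.

Section minimal_degrees.
Context {R : realType} {T : Type} (sci : T -> \bar R) (le : T -> T -> Prop).
Hypotheses (le_refl : forall P, le P P)
  (le_trans : forall Q P S, le P Q -> le Q S -> le P S).

Lemma eq_degree U P Q : le P Q -> le Q P -> degree sci le U P = degree sci le U Q.
Proof.
move=> PQ QP; apply/seteqP.
by split=> X [oX [h1 h2]]; split=> //; split;
  [exact: le_trans QP h1|exact: le_trans h2 PQ
  |exact: le_trans PQ h1|exact: le_trans h2 QP].
Qed.

(** A problem below a source lies in the same block, for otherwise the other source
    would be below it, too. *)
Theorem min_degrees_sources (A B : set T) (a b : T) :
  A a -> B b -> (forall P, (A `|` B) P -> sci P = 2%:E) ->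
  (forall P, A P -> le a P) -> (forall P, B P -> le b P) ->
  (forall P, B P -> ~ le a P) -> (forall P, A P -> ~ le b P) ->
  min_degrees sci le (A `|` B) =
  [set degree sci le (A `|` B) a; degree sci le (A `|` B) b].
Proof.
move=> Aa Bb sci2 aA bB aB bA; set U := A `|` B.
have oU P : U P -> order2 sci U P by move=> UP; split=> //; exact: sci2.
have degP P : U P -> degree sci le U P P by move=> /oU oP; split.
have source s : U s -> (forall Q, U Q -> le Q s -> le s Q) ->
    min_degrees sci le U (degree sci le U s).
  move=> Us smin; split; first by exists s => //; exact: oU.
  move=> _ [Q [UQ _] <-] [P [S [[_ [QP _]] [[_ [sS Ss]] PS]]]].
  have Qs : le Q s by exact: le_trans (le_trans QP PS) Ss.
  by apply: eq_degree => //; exact: smin.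
apply/seteqP; split=> [c [[P [UP sP] <-] Pmin]|_ [->|->]].
- case: UP => hP.
    left; apply/esym/Pmin; first by exists a => //; apply: oU; left.
    exists a, P; split; first by apply: degP; left.
    by split; [apply: degP; left|exact: aA].
  right; apply/esym/Pmin; first by exists b => //; apply: oU; right.
  exists b, P; split; first by apply: degP; right.
  by split; [apply: degP; right|exact: bB].
- apply: source; first by left.
  move=> Q [AQ _|BQ Qa]; first exact: aA.
  by case: (bA a Aa); exact: le_trans (bB Q BQ) Qa.
- apply: source; first by right.
  move=> Q [AQ Qb|BQ _]; last exact: bB.
  by case: (aB b Bb); exact: le_trans (aA Q AQ) Qb.
Qed.

End minimal_degrees.

Theorem theorem8p1 (R : realType) (J : set R) (eps : R) (Gr : cgraph)
    (r : readout J) (code : fset_coding (vertex Gr))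
    (CH : geometric_structure Gr J eps) :
  is_interval J -> compact J -> J° !=set0 -> 0 < eps ->
  let P_sigma := problem_sigma r code in
  let P_pseudo := problem_pseudo r code eps in
  let U_sigma := block P_sigma in
  let U_pseudo := block P_pseudo in
  let U_sharp := U_sigma `|` U_pseudo in
  let sci P := SCI_G (gp_sci P) in
  let le := le_geom CH in
  [/\ forall P, U_sharp P -> sci P = 2%:E,
      (forall P, U_sigma P -> le (P_sigma Diag) P) /\
      (forall P, U_pseudo P -> le (P_pseudo Diag) P),
      (forall P, U_pseudo P -> ~ le (P_sigma Diag) P) /\
      (forall P, U_sigma P -> ~ le (P_pseudo Diag) P) &
      min_degrees sci le U_sharp =
      [set degree sci le U_sharp (P_sigma Diag);
           degree sci le U_sharp (P_pseudo Diag)]].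
Proof.
move=> _ _ [t0 /interior_subset Jt0] eps0 P_sigma P_pseudo U_sigma U_pseudo U_sharp sci le.
have J0 : J !=set0 by exists t0.
have blockP (P : rep -> gproblem Gr J) Q : block P Q -> exists rho, Q = P rho.
  by move=> [[->|->]|->]; [exists Diag|exists Gen|exists Graph].
have dS : decided_by spectrum_test (@spectrum R) := spectrum_decided.
have dP := pseudospectrum_decided eps0.
have neS (H : hilbert R) (T : cd_operator H) : spectrum T `&` embed J = set0 ->
    pseudospectrum eps T `&` embed J = set0 ->
    forall z, embed J z -> passes spectrum_test T z.
  move=> sT _ z zJ; apply/dS => zT.
  by have : (spectrum T `&` embed J) z by []; rewrite sT.
have neP (H : hilbert R) (T : cd_operator H) : spectrum T `&` embed J = set0 ->
    pseudospectrum eps T `&` embed J = set0 ->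
    forall z, embed J z -> passes (pseudospectrum_test eps0) T z.
  move=> _ pT z zJ; apply/dP => zT.
  by have : (pseudospectrum eps T `&` embed J) z by []; rewrite pT.
have sci2 P : U_sharp P -> sci P = 2%:E.
  move=> [/blockP[rho ->]|/blockP[rho ->]].
    exact: (SCI_spectral_problem r code CH dS rho spectrum_margin (lexx 0) J0).
  exact: (SCI_spectral_problem r code CH dP rho (pseudospectrum_margin eps0) (ltW eps0) J0).
have leS P : U_sigma P -> le (P_sigma Diag) P.
  by move=> /blockP[rho ->]; exact: (diag_le r code CH dS).
have leP P : U_pseudo P -> le (P_pseudo Diag) P.
  by move=> /blockP[rho ->]; exact: (diag_le r code CH dP).
have eps_neq0 : 0 != eps by rewrite lt_eqF.
have nleS P : U_pseudo P -> ~ le (P_sigma Diag) P.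
  move=> /blockP[rho ->] h.
  exact: (not_le_geom dS dP spectrum_margin
    (pseudospectrum_margin eps0) neP (lexx 0) (ltW eps0) eps_neq0 J0 h).
have nleP P : U_sigma P -> ~ le (P_pseudo Diag) P.
  move=> /blockP[rho ->] h; rewrite eq_sym in eps_neq0.
  exact: (not_le_geom dP dS (pseudospectrum_margin eps0)
    spectrum_margin neS (ltW eps0) (lexx 0) eps_neq0 J0 h).
split=> //; apply: min_degrees_sources => //.
- exact: le_geom_refl.
- by move=> Q P S; exact: le_geom_trans.
- by left; left.
- by left; left.
Qed.
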